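(* Let $p$ be a constant with $1<p<\infty$ and let $w$ be a weight. Then $w\in B_p$ if and only if there exist $w_1,w_2\in B_1$ such that $w=w_1w_2^{1-p}$.
   Context: $\mathbb B$ unit ball of $\mathbb C^n$, $\alpha>0$, $d\mu_\alpha(z)=(1-|z|^2)^{\alpha-1}d\mu(z)$. Pseudo-distance $d(z,\zeta)=\big||z|-|\zeta|\big|+\big|1-\frac{\langle z,\zeta\rangle}{|z||\zeta|}\big|$ ($z,\zeta\ne0$), $d(z,\zeta)=|z|+|\zeta|$ otherwise; pseudo-balls $B(z,r)=\{\zeta:d(z,\zeta)<r\}$; $\mathcal B$ = pseudo-balls $B(z,r)$ with $r>1-|z|$. A weight is a non-negative locally integrable function on $\mathbb B$. $m_\alpha f(z)=\sup_{B\in\mathcal B}\frac{\chi_B(z)}{\mu_\alpha(B)}\int_B|f|d\mu_\alpha$. $w\in B_p$ iff $\sup_{B\in\mathcal B}\big(\frac1{\mu_\alpha(B)}\int_Bw\,d\mu_\alpha\big)\big(\frac1{\mu_\alpha(B)}\int_Bw^{-1/(p-1)}d\mu_\alpha\big)^{p-1}<\infty$. $w\in B_1$ iff $[w]_{B_1}:=\operatorname{ess\,sup}_{z\in\mathbb B}\frac{m_\alpha w(z)}{w(z)}<\infty$. *)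

(* Defs.v *)
From mathcomp Require Import all_boot all_order all_algebra.
From mathcomp Require Import all_classical all_reals all_analysis.
From mathcomp Require Import ess_sup_inf.
Set Implicit Arguments. Unset Strict Implicit. Unset Printing Implicit Defensive.
Import Order.TTheory GRing.Theory Num.Theory.
Local Open Scope classical_set_scope.
Local Open Scope ring_scope.

Section Ball.
Variables (R : realType) (n : nat).

(* C^n is represented as n-tuples of pairs (Re z_j, Im z_j), with the
   product (Borel) sigma-algebra provided by the library. *)
Definition Cn := (n.-tuple (R * R))%type.

Definition re (z : Cn) (j : 'I_n) : R := (tnth z j).1.
Definition im (z : Cn) (j : 'I_n) : R := (tnth z j).2.

Definition cnorm (z : Cn) : R :=
  Num.sqrt (\sum_(j < n) (re z j ^+ 2 + im z j ^+ 2)).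

(* <z, zeta> = sum_j z_j * conj(zeta_j), real and imaginary parts. *)
Definition cinner_re (z zeta : Cn) : R :=
  \sum_(j < n) (re z j * re zeta j + im z j * im zeta j).
Definition cinner_im (z zeta : Cn) : R :=
  \sum_(j < n) (im z j * re zeta j - re z j * im zeta j).

Definition unit_ball : set Cn := [set z | cnorm z < 1].

Definition is_lebesgue_Cn (mu : {measure set Cn -> \bar R}) : Prop :=
  forall a b c d : 'I_n -> R,
    mu [set z | forall j, `[a j, b j[%classic (re z j) /\
                          `[c j, d j[%classic (im z j)] =
    (\prod_(j < n) (lebesgue_measure `[a j, b j[%classic *
                    lebesgue_measure `[c j, d j[%classic))%E.

Definition pdist (z zeta : Cn) : R :=
  if (cnorm z != 0) && (cnorm zeta != 0) then
    let q := cnorm z * cnorm zeta in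
    (* |1 - <z,zeta>/(|z||zeta|)| written with real and imaginary parts *)
    `|cnorm z - cnorm zeta| +
    Num.sqrt ((1 - cinner_re z zeta / q) ^+ 2 + (cinner_im z zeta / q) ^+ 2)
  else cnorm z + cnorm zeta.

Definition pball (z : Cn) (r : R) : set Cn :=
  [set zeta | unit_ball zeta /\ pdist z zeta < r].

Definition calB : set (set Cn) :=
  [set E | exists z r, unit_ball z /\ 1 - cnorm z < r /\ E = pball z r].

Variable mu : {measure set Cn -> \bar R}.
Variable alpha : R.

Definition dens (z : Cn) : R := (1 - cnorm z ^+ 2) `^ (alpha - 1).

(* \int_E g d mu_alpha, mu_alpha being carried by the unit ball. *)
Definition int_alpha (E : set Cn) (g : Cn -> \bar R) : \bar R :=
  (\int[mu]_(z in E `&` unit_ball) (g z * (dens z)%:E))%E.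

Definition mu_alpha (E : set Cn) : \bar R := int_alpha E (fun _ => 1%E).

Definition avg_alpha (E : set Cn) (g : Cn -> \bar R) : \bar R :=
  (((fine (mu_alpha E))^-1)%:E * int_alpha E g)%E.

Definition m_alpha (f : Cn -> R) (z : Cn) : \bar R :=
  ereal_sup [set avg_alpha E (fun x => (`|f x|)%:E) | E in
             [set E | calB E /\ E z]].

Definition is_weight (w : Cn -> R) : Prop :=
  (forall z, unit_ball z -> 0 <= w z) /\
  measurable_fun unit_ball w /\
  forall rho : R, 0 <= rho < 1 ->
    mu.-integrable [set z | cnorm z <= rho] (EFin \o w).

Definition epow (x s : R) : \bar R :=
  if (x == 0) && (s < 0) then +oo%E else (x `^ s)%:E.

Definition in_Bp (p : R) (w : Cn -> R) : Prop :=
  exists C : R, forall E, calB E ->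
    (avg_alpha E (fun x => (w x)%:E) *
     (avg_alpha E (fun x => epow (w x) (- (p - 1)^-1))) `^ (p - 1) <= C%:E)%E.

(* B_1 condition: ess sup over the ball of m_alpha w / w is finite
   (ratio taken as +oo when w = 0 < m_alpha w, and 0 when both vanish). *)
Definition in_B1 (w : Cn -> R) : Prop :=
  (ess_sup mu (fun z => if z \in unit_ball then
      (m_alpha w z * epow (w z) (-1))%E else 0%E) < +oo)%E.

End Ball.

(* Main.v *)
(* For [p > 1] let [v = w^(-1/(p-1))].  If [w] is in [B_p], the averages of
   [w] and [v] control those of any [f]: the maximal function [M f] is at most
   [C (M_w ((M_v (f / v))^(p-1) / w))^(1/(p-1))], where [M_w] and [M_v] are
   taken with respect to the weighted measures.  Both are bounded by a Vitali
   covering argument, since the [B_p] condition makes these measures doubling on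
   the pseudo-balls that reach the boundary; so [M] is bounded on [L^p(w)] and
   [L^p'(v)], without the reverse Hoelder inequality, which [B_p] lacks.  The
   increasing iterates of [u |-> 1 + e (M u + (w^-1 M (w u^(p-1)))^(1/(p-1)))]
   then converge in [L^p(w)] to some [w2] such that [w2] and [w1 = w w2^(p-1)]
   are in [B_1].  Conversely, [B_1] bounds the averages of [w1] and [w2] over a
   pseudo-ball by their essential infima, up to a constant, and this gives the
   [B_p] condition for [w1 w2^(1-p)].

   On the geometric side, [M] is a supremum over countably many pseudo-balls with
   rational data.  Their doubling constant comes from cutting the boundary layer
   into dyadic shells of a cone, and from one affine map contracting the wide
   cone into the narrow one. *)
From HB Require Import structures.
Require Import Defs.
From mathcomp Require Import all_boot all_order all_algebra.
From mathcomp Require Import all_classical all_reals all_analysis.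
From mathcomp Require Import measurable_realfun ess_sup_inf ring lra.
Import Order.TTheory GRing.Theory Num.Theory.
Import numFieldNormedType.Exports.
Local Open Scope classical_set_scope.
Local Open Scope ring_scope.

Set Implicit Arguments.
Unset Strict Implicit.
Unset Printing Implicit Defensive.

(** * Measures with a density *)

(** Two inequalities for [u] carry the factorization: [e M u <= u] puts [u] in [B_1], and
    [e (w^-1 M (w u^(p-1)))^(1/(p-1)) <= u] puts [w u^(p-1)] in [B_1]. The second operator acts on
    [L^p(w)] because its [p]-th power times [w] equals [M (w u^(p-1))^p' v]; this is what
    boundedness on [L^p'(v)] is for. The summand 1 keeps [u] positive. It lies in [L^p(w)] because
    the unit ball is itself one of the pseudo-balls: unless [w] vanishes almost everywhere, [B_p] on
    the ball makes both [w] and [v] integrable for the weighted measure. A weight that is null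
    almost everywhere is factored by hand as [0 = 0 * 1]. The limit of the iterates may be infinite
    on a null set, so the analysis is carried out for functions with values in the extended reals,
    and real-valued weights are chosen only at the end. Likewise [w] is first replaced by an
    everywhere positive representative. *)

Section MonotoneSup.
Local Open Scope ereal_scope.
Context d (T : measurableType d) (R : realType).
Implicit Types (mu : {measure set T -> \bar R}) (f : nat -> T -> \bar R).

Lemma measurable_fun_ereal_sup D f : (forall k, measurable_fun D (f k)) ->
  measurable_fun D (fun x => ereal_sup (range (f ^~ x))).
Proof.
move=> mf; rewrite (_ : (fun _ => _) = (fun x => esups (f ^~ x) 0%N)).
  exact: measurable_fun_esups.
apply/funext => x; congr ereal_sup; apply/seteqP; split => y [k _ <-] /=.
  by exists k.
by exists k.
Qed.

(** Monotone convergence stated with suprema, the form in which the maximal operators and the limit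
    of the iterates are given. *)
Lemma integral_nd_ereal_sup mu f D : measurable D ->
  (forall k, measurable_fun D (f k)) ->
  (forall k x, D x -> 0 <= f k x) ->
  (forall k x, D x -> f k x <= f k.+1 x) ->
  \int[mu]_(x in D) ereal_sup (range (f ^~ x)) =
  ereal_sup (range (fun k => \int[mu]_(x in D) f k x)).
Proof.
move=> mD mf f0 fS.
have ndf x : D x -> {homo f ^~ x : m n / (m <= n)%N >-> m <= n}.
  by move=> Dx; apply/nondecreasing_seqP => n; exact: fS.
rewrite (eq_integral (fun x => limn (f ^~ x))); last first.
  move=> x /[!inE] Dx; apply/esym/cvg_lim => //.
  exact/ereal_nondecreasing_cvgn/ndf.
rewrite monotone_convergence//.
  apply/cvg_lim => //; apply: ereal_nondecreasing_cvgn.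
  apply/nondecreasing_seqP => n.
  by apply: ge0_le_integral => // x Dx; [exact: f0|exact: fS].
Qed.

End MonotoneSup.

Section Density.
Import HBNNSimple.
Local Open Scope ereal_scope.
Context d (T : measurableType d) (R : realType).
Context (mu : {measure set T -> \bar R}) (g : T -> R).
Hypothesis g0 : forall x, (0 <= g x)%R.
Hypothesis mg : measurable_fun setT g.

Definition density_measure (A : set T) : \bar R := \int[mu]_(x in A) (g x)%:E.

Let density_measure0 : density_measure set0 = 0.
Proof. by rewrite /density_measure integral_set0. Qed.

Let density_measure_ge0 A : 0 <= density_measure A.
Proof. by apply: integral_ge0 => x _; rewrite lee_fin. Qed.

Let mgE D : measurable_fun D (fun x => (g x)%:E).
Proof. by apply/measurable_EFinP; exact: measurable_funTS. Qed.

Let density_measure_sigma_additive : semi_sigma_additive density_measure.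
Proof.
move=> F mF tF mUF; rewrite /density_measure ge0_integral_bigcup//.
- by apply: is_cvg_ereal_nneg_natsum_cond => n _ _; apply: integral_ge0 => x _;
    rewrite lee_fin.
- by move=> x _; rewrite lee_fin.
Qed.

HB.instance Definition _ := isMeasure.Build _ _ _ density_measure
  density_measure0 density_measure_ge0 density_measure_sigma_additive.

Definition density : {measure set T -> \bar R} := density_measure.

Lemma densityE A : density A = \int[mu]_(x in A) (g x)%:E.
Proof. by []. Qed.

(** Extending [f] by zero reduces to the whole space. Both sides then commute with increasing limits
    of simple functions, for which the identity is a finite sum. *)
Lemma integral_density D (f : T -> \bar R) : measurable D -> measurable_fun D f ->
  (forall x, D x -> 0 <= f x) ->
  \int[density]_(x in D) f x = \int[mu]_(x in D) (f x * (g x)%:E).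
Proof.
move=> mD mf f0.
wlog DT : D mD f mf f0 / D = setT.
  move=> wlg; rewrite integral_mkcond wlg//; last 2 first.
    exact/(measurable_restrictT _ mD).
  - by move=> x _; apply: erestrict_ge0.
  rewrite [RHS]integral_mkcond; apply: eq_integral => x _.
  by rewrite !patchE; case: ifPn => //; rewrite mul0e.
rewrite {}DT {D mD} in mf f0 *.
pose h := nnsfun_approx measurableT mf.
have mh n : measurable_fun setT (fun x => (h n x)%:E) by apply/measurable_EFinP.
have ndh x : {homo (fun n => (h n x)%:E) : m n / (m <= n)%N >-> m <= n}.
  by move=> a b ab; rewrite lee_fin; exact/lefP/nd_nnsfun_approx.
have cvh x : (fun n => (h n x)%:E) @ \oo --> f x.
  by apply: (cvg_nnsfun_approx measurableT mf) => // t _; exact: f0.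
transitivity (limn (fun n => \int[density]_x (h n x)%:E)).
  rewrite -monotone_convergence//; last by move=> n x _; rewrite lee_fin.
  by apply: eq_integral => x _; apply/esym/cvg_lim => //; exact: cvh.
transitivity (limn (fun n => \int[mu]_x ((h n x)%:E * (g x)%:E))); last first.
  rewrite -monotone_convergence//; last 3 first.
  - move=> n; apply: emeasurable_funM => //.
  - by move=> n x _; rewrite mule_ge0// lee_fin.
  - by move=> x _ a b ab; rewrite lee_wpmul2r ?lee_fin//; exact/lefP/nd_nnsfun_approx.
  apply: eq_integral => x _; apply/cvg_lim => //.
  by apply: cvgeZr => //; exact: cvh.
congr (limn _); apply/funext => n.
(* For a simple function, [g] integrates over the fibre of each value [y] to the density measure of
   that fibre. *)
rewrite integralT_nnsfun sintegralE.
transitivity (\int[mu]_x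
   (\sum_(y \in range (h n)) ((y * \1_(h n @^-1` [set y]) x)%:E * (g x)%:E))).
  rewrite ge0_integral_fsum//; last 2 first.
  - move=> y; apply: emeasurable_funM; last exact: mgE.
    by apply/measurable_EFinP; exact: measurable_funM.
  - by move=> y x _; rewrite mule_ge0 ?lee_fin// -lee_fin; exact: nnfun_muleindic_ge0.
  apply: eq_fsbigr => r /[!inE] -[x _ <-].
  under eq_integral do rewrite EFinM -muleA.
  rewrite ge0_integralZl//; last 3 first.
  - by apply: emeasurable_funM => //; exact/measurable_EFinP.
  - by move=> t _; rewrite mule_ge0// lee_fin.
  - by rewrite lee_fin.
  congr (_ * _); rewrite densityE [LHS]integral_mkcond.
  by apply: eq_integral => t _; rewrite epatch_indic muleC.
apply: eq_integral => x _.
rewrite -ge0_mule_fsuml => [|y]; last exact: nnfun_muleindic_ge0.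
by rewrite fsumEFin // -fimfunE.
Qed.

End Density.

(** * Elementary inequalities for powers *)

Section PowerInequalities.
Context (R : realType).
Implicit Types a b q : R.

(* After division by [a `^ (q - 1)] this is Young's inequality for
   [b / a] with exponents [q] and [q / (q - 1)]. *)
Lemma powR_increment a b q : 1 < q -> 0 <= b -> 0 < a ->
  a `^ q - b `^ q <=
  a * (q / (q - 1)) * (a `^ (q - 1) - b `^ (q - 1)).
Proof.
move=> q1 b0 a0.
have q0 : 0 < q by lra.
have q10 : 0 < q - 1 by lra.
have := @conjugate_powR R a (b `^ (q - 1)) q (q / (q - 1)) (ltW a0)
  (powR_ge0 _ _) q0 (divr_gt0 q0 q10) _.
rewrite invf_div => /(_ _)/wrap[].
  by field; rewrite gt_eqF.
rewrite -powRrM (mulrC (q - 1)) divfK ?gt_eqF// => young.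
rewrite mulrBr.
have e1 : a * (q / (q - 1)) * b `^ (q - 1) =
  (q / (q - 1)) * (a * b `^ (q - 1)) by ring.
rewrite e1.
have q'0 : 0 < q / (q - 1) by rewrite divr_gt0.
have := ler_wpM2l (ltW q'0) young.
rewrite mulrDr.
have -> : q / (q - 1) * (a `^ q / q) = a `^ q / (q - 1).
  by field; rewrite !gt_eqF.
have -> : q / (q - 1) * (b `^ q * ((q - 1) / q)) = b `^ q.
  by field; rewrite !gt_eqF.
have -> : a `^ q = a * a `^ (q - 1) by rewrite mulr_powRB1// ltW.
set X := a * a `^ (q - 1).
have -> : a * (q / (q - 1)) * a `^ (q - 1) = X + X / (q - 1).
  by rewrite /X; field; rewrite gt_eqF.
lra.
Qed.

Local Open Scope ereal_scope.

(** If [f <= e g] the first term on the right dominates, otherwise [g < f / e] and the second one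
    does. The parameter [e] is free so that the [g]-term can later be absorbed into a left-hand
    side. *)
Lemma young_absorb (f : \bar R) (g q e : R) : (1 < q)%R -> (0 < e)%R ->
  (0 <= g)%R -> 0 <= f ->
  f * (g `^ (q - 1))%:E <= (e * g `^ q)%:E + (e `^ (1 - q))%:E * f `^ q.
Proof.
move=> q1 e0 g0; have q0 : (0 < q)%R by lra.
case: f => [f| _ |//]; last first.
  rewrite poweRyr ?gt_eqF// gt0_muley ?lte_fin ?powR_gt0//.
  by rewrite addeC addye ?leey// ?ltNye// -EFinM.
rewrite lee_fin => f0; rewrite poweR_EFin -!EFinM -EFinD lee_fin.
have [fg|gf] := leP f (e * g)%R.
  apply: (@le_trans _ _ (e * g * g `^ (q - 1))%R).
    by rewrite ler_wpM2r// powR_ge0.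
  rewrite -mulrA mulr_powRB1//.
  by rewrite lerDl mulr_ge0// powR_ge0.
apply: (@le_trans _ _ (e `^ (1 - q) * f `^ q)%R); last first.
  by rewrite lerDr mulr_ge0// ?powR_ge0// ltW.
rewrite -(mulr_powRB1 f0 q0) mulrCA ler_wpM2l//.
have -> : (e `^ (1 - q) * f `^ (q - 1) = (f / e) `^ (q - 1))%R.
  rewrite powRM// ?invr_ge0 ?ltW// mulrC; congr (_ * _)%R.
  by rewrite -(opprB q) powRN -(powR_inv1 (ltW e0)) -powRrM mulN1r powRN.
rewrite ge0_ler_powR ?nnegrE//; [lra| |].
  by rewrite divr_ge0// ltW.
by rewrite ler_pdivlMr// mulrC ltW.
Qed.

Lemma gee0_ler_poweR (x y : \bar R) q : (0 < q)%R -> 0 <= x -> x <= y ->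
  x `^ q <= y `^ q.
Proof.
move=> q0 x0 xy; apply: gt0_ler_poweR => //; first exact: ltW.
  by rewrite in_itv/= x0 leey.
by rewrite in_itv/= (le_trans x0 xy) leey.
Qed.

(** The power [q] is an increasing bijection of [[0, +oo]]; the nontrivial inequality is obtained
    through the inverse power [1/q]. *)
Lemma poweR_ereal_sup (u : nat -> \bar R) q : (0 < q)%R ->
  (forall k, 0 <= u k) ->
  ereal_sup (range u) `^ q = ereal_sup (range (fun k => u k `^ q)).
Proof.
move=> q0 u0.
have s0 : 0 <= ereal_sup (range u).
  by apply: (le_trans (u0 0%N)); apply: ereal_sup_ubound; exists 0%N.
apply/eqP; rewrite eq_le; apply/andP; split; last first.
  apply: ge_ereal_sup => _ [k _ <-]; apply: gee0_ler_poweR => //.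
  by apply: ereal_sup_ubound; exists k.
set S := leRHS.
have S0 : 0 <= S.
  apply: (@le_trans _ _ (u 0%N `^ q)); first exact: poweR_ge0.
  by apply: ereal_sup_ubound; exists 0%N.
have -> : S = (S `^ q^-1) `^ q.
  by rewrite -poweRrM mulVf ?gt_eqF// poweRe1.
apply: gee0_ler_poweR => //; apply: ge_ereal_sup => _ [k _ <-].
have -> : u k = (u k `^ q) `^ q^-1.
  by rewrite -poweRrM mulfV ?gt_eqF// poweRe1.
apply: gee0_ler_poweR; [by rewrite invr_gt0|exact: poweR_ge0|].
by apply: ereal_sup_ubound; exists k.
Qed.

End PowerInequalities.

(** * Maximal operators over countable families *)

Lemma measurable_fun_poweR d (T : measurableType d) (R : realType) (D : set T)
  (f : T -> \bar R) r :
  measurable_fun D f -> measurable_fun D (fun x => (f x `^ r)%E).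
Proof. by move=> mf; apply: (measurableT_comp (measurable_poweR r)). Qed.

Section Maximal.
Local Open Scope ereal_scope.
Context d (T : measurableType d) (R : realType).
Implicit Types (m : {measure set T -> \bar R}) (f : T -> \bar R).

Definition average m f (A : set T) : \bar R :=
  ((fine (m A))^-1)%:E * \int[m]_(x in A) f x.

(** Multiplying by the indicator keeps the index set independent of [x], which makes the operator
    measurable, and gives 0 instead of [-oo] at a point lying in no cell. *)
Definition maximal m (F : nat -> set T) f (x : T) : \bar R :=
  ereal_sup (range (fun k => average m f (F k) * (\1_(F k) x)%:E)).

(** An abstract Vitali structure: [s k] stands for the radius of the cell [F k], and [G k] for its
    enlargement, which swallows every cell that meets [F k] and is not larger. *)
Context (F G : nat -> set T) (s : nat -> R).
Hypothesis mF : forall k, measurable (F k).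
Hypothesis mG : forall k, measurable (G k).
Hypothesis engulf : forall i j, F i `&` F j !=set0 -> (s i <= s j)%R ->
  F i `<=` G j.

Let U (l : seq nat) := \bigcup_(i in [set` l]) F i.

Let mU l : measurable (U l).
Proof. by apply: fin_bigcup_measurable => // i _; exact: mF. Qed.

Let exists_max (l : seq nat) : l != [::] ->
  exists2 j, j \in l & forall i, i \in l -> (s i <= s j)%R.
Proof.
elim: l => // a l IH _; have [->|/IH[j jl jmax]] := eqVneq l [::].
  by exists a; rewrite ?inE// => i; rewrite inE => /eqP ->.
have [aj|ja] := leP (s a) (s j).
  exists j; first by rewrite inE jl orbT.
  by move=> i; rewrite inE => /orP[/eqP ->//|/jmax].
exists a; first by rewrite inE eqxx.
by move=> i; rewrite inE => /orP[/eqP ->//|/jmax /le_trans]; apply; exact: ltW.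
Qed.

(** Vitali selection by induction: take a cell [F j] of largest radius; the cells meeting it lie in
    [G j], and the others are disjoint from [F j]. The right-hand integral runs over the union of
    the cells only, and [doob] needs this sharper form. *)
Lemma weak_type m f (K : R) (c : R) (l : seq nat) :
  (forall k, m (G k) <= K%:E * m (F k)) -> (forall k, 0 < m (F k)) ->
  (0 <= K)%R -> (0 <= c)%R ->
  (forall x, 0 <= f x) -> measurable_fun setT f ->
  (forall i, i \in l -> c%:E * m (F i) <= \int[m]_(x in F i) f x) ->
  c%:E * m (U l) <= K%:E * \int[m]_(x in U l) f x.
Proof.
move=> mGF m0 K0 c0 f0 mf.
have mfD D : measurable_fun D f by exact: measurable_funTS.
have [n] := ubnP (size l); elim: n l => // n IH l ln H.
have [->|/exists_max[j jl jmax]] := eqVneq l [::].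
  by rewrite /U bigcup0//= measure0 integral_set0 !mule0.
pose l1 := [seq i <- l | `[< F i `&` F j = set0 >]].
have l1l i : i \in l1 -> i \in l by rewrite mem_filter => /andP[].
(* [F j] has positive measure, hence meets itself; this makes [l1] strictly shorter than [l]. *)
have jl1 : j \notin l1.
  rewrite mem_filter; apply/negP => /andP[/asboolP + _].
  by rewrite setIid => Fj0; have := m0 j; rewrite Fj0 measure0 ltxx.
have {}IH : c%:E * m (U l1) <= K%:E * \int[m]_(x in U l1) f x.
  apply: IH => [|i /l1l/H//].
  rewrite -ltnS; apply: leq_trans ln; rewrite ltnS size_filter.
  rewrite ltn_neqAle count_size andbT -all_count.
  by apply: contra jl1 => /allP/(_ _ jl) ?; rewrite mem_filter jl andbT.
have UG : U l `<=` G j `|` U l1.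
  move=> x [i /= il Fix].
  have [/asboolP ij0|/asboolP /eqP/set0P ij] := boolP `[< F i `&` F j = set0 >].
    by right; exists i => //=; rewrite mem_filter il andbT; apply/asboolP.
  by left; apply: (engulf ij) => //; exact: jmax.
have step1 : m (U l) <= m (G j) + m (U l1).
  apply: le_trans (measureU2 _ _ _) => //.
  by apply: le_measure; rewrite ?inE//; exact: measurableU.
apply: (@le_trans _ _ (c%:E * (m (G j) + m (U l1)))).
  by apply: lee_wpmul2l; rewrite ?lee_fin.
rewrite ge0_muleDr//.
apply: (@le_trans _ _ (K%:E * \int[m]_(x in F j) f x +
    K%:E * \int[m]_(x in U l1) f x)).
  apply: leeD IH; apply: (@le_trans _ _ (c%:E * (K%:E * m (F j)))).
    by apply: lee_wpmul2l; rewrite ?lee_fin.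
  by rewrite muleCA; apply: lee_wpmul2l; [rewrite lee_fin|exact: H].
rewrite -ge0_muleDr; [|exact: integral_ge0..].
apply: lee_wpmul2l; first by rewrite lee_fin.
rewrite -ge0_integral_setU//; last first.
  apply/disj_setPS => x [Fjx [i /=]].
  rewrite mem_filter => /andP[/asboolP ij0 _] Fix.
  by have : (F i `&` F j) x by []; rewrite ij0.
apply: ge0_subset_integral => //; first exact: measurableU.
move=> x [Fjx|[i /= /l1l il Fix]]; first by exists j.
by exists i.
Qed.

Section FiniteFamily.
Context m f (K q : R).
Hypothesis mGF : forall k, m (G k) <= K%:E * m (F k).
Hypothesis m_gt0 : forall k, 0 < m (F k).
Hypothesis m_lty : forall k, m (F k) < +oo.
Hypothesis K_gt0 : (0 < K)%R.
Hypothesis q_gt1 : (1 < q)%R.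
Hypothesis f0 : forall x, 0 <= f x.
Hypothesis mf : measurable_fun setT f.
Hypothesis fq : \int[m]_x (f x `^ q) < +oo.

Let mfD D : measurable_fun D f. Proof. exact: measurable_funTS. Qed.

(** [f <= 1 + f^q], and [F k] has finite measure. *)
Let f_lty k : \int[m]_(x in F k) f x < +oo.
Proof.
apply: (@le_lt_trans _ _ (\int[m]_(x in F k) (cst 1 x + f x `^ q))).
  apply: ge0_le_integral => //.
    apply: emeasurable_funD => //.
    exact: measurable_fun_poweR.
  move=> x _; move: (f0 x); case: (f x) => [r| |//]; last first.
    by rewrite poweRyr ?gt_eqF ?(lt_trans _ q_gt1)// addey ?leey.
  rewrite lee_fin poweR_EFin /= -EFinD lee_fin => r0.
  have [r1|r1] := leP 1%R r.
    by rewrite (le_trans (le1r_powR r1 (ltW q_gt1)))// lerDr.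
  by rewrite (le_trans (ltW r1))// lerDl powR_ge0.
have mfq : measurable_fun (F k) (fun x => f x `^ q).
  exact: measurable_fun_poweR.
rewrite ge0_integralD//; last by move=> x _; exact: poweR_ge0.
rewrite integral_cst// mul1e lte_add_pinfty//.
apply: le_lt_trans fq; apply: ge0_subset_integral => //.
  exact: measurable_fun_poweR.
by move=> x _; exact: poweR_ge0.
Qed.

Let a k : R := fine (average m f (F k)).

Let aE k : average m f (F k) = (a k)%:E.
Proof.
by rewrite /a fineK// /average fin_numM// ge0_fin_numE ?f_lty ?integral_ge0.
Qed.

Let a0 k : (0 <= a k)%R.
Proof.
by rewrite -lee_fin -aE /average mule_ge0 ?integral_ge0// lee_fin invr_ge0 fine_ge0.
Qed.

Let aM k : (a k)%:E * m (F k) = \int[m]_(x in F k) f x.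
Proof.
rewrite -aE /average muleAC -[X in _ * X * _]fineK; last first.
  by rewrite ge0_fin_numE.
rewrite -EFinM mulVf ?mul1e// gt_eqF//.
by rewrite fine_gt0// m_gt0 m_lty.
Qed.

Context (N : nat).

(** The first [N] cells by decreasing average: [A i] is the [i]-th largest average, with default 0
    from rank [N] on, and [V i] is the union of the cells of rank at most [i]. *)
Let l := sort (fun i j => (a j <= a i)%R) (iota 0 N).
Let A i : R := nth 0%R (map a l) i.
Let V i := U (take i.+1 l).
(** The first cell of the sorted list containing [x] has the largest average, so [g] is the maximal
    function of the finite family. If no cell contains [x], [find] returns [N] and the value is
    0. *)
Let g x : R := A (find (fun k => x \in F k) l).

Let sl : size l = N. Proof. by rewrite size_sort size_iota. Qed.

Let A0 i : (0 <= A i)%R.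
Proof.
rewrite /A; have [iN|Ni] := ltnP i N; first by rewrite (nth_map 0%N) ?sl.
by rewrite nth_default// size_map sl.
Qed.

Let AN i : (N <= i)%N -> A i = 0%R.
Proof. by move=> Ni; rewrite /A nth_default// size_map sl. Qed.

Let A_nonincr i j : (i <= j)%N -> (A j <= A i)%R.
Proof.
move=> ij; have [jN|Nj] := ltnP j N; last by rewrite (AN Nj).
have iN := leq_ltn_trans ij jN.
have := @sorted_leq_nth R (fun x y => y <= x)%R _ _ 0%R (map a l).
apply => //; rewrite ?inE ?size_map ?sl//.
- by move=> y x z /= yx zy; exact: le_trans zy yx.
- by rewrite sorted_map; apply: sort_sorted => x y; exact: le_total.
Qed.

Let V_indic i x : (i < N)%N ->
  (\1_(V i) x : R) = (find (fun k => x \in F k) l <= i)%N%:R.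
Proof.
move=> iN; rewrite indicE; congr (nat_of_bool _)%:R.
rewrite -ltnS -has_take_leq ?sl//; apply/idP/idP.
  rewrite inE => -[k /= kl Fkx]; apply/hasP; exists k => //.
  by rewrite inE.
by move/hasP => [k kl]; rewrite !inE => Fkx; exists k.

Qed.

(** Abel summation over the nested sets [V i], a finite layer-cake formula. *)
Let telescope (phi : R -> R) x : phi 0%R = 0%R ->
  phi (g x) = (\sum_(i < N) (phi (A i) - phi (A i.+1)) * \1_(V i) x)%R.
Proof.
move=> phi0.
under eq_bigr do rewrite V_indic//.
rewrite /g; set p := find _ _.
have pN : (p <= N)%N by rewrite -sl find_size.
rewrite -(big_mkord xpredT (fun i => (phi (A i) - phi (A i.+1)) * (p <= i)%:R)%R).
rewrite (big_cat_nat (leq0n p) pN)/=.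
rewrite big_nat big1 ?add0r; last first.
  by move=> i /andP[_ ip]; rewrite leqNgt ip mulr0.
under eq_big_nat => i /andP[pi _].
  rewrite pi mulr1 -[X in (X - _)%R]opprK addrC; over.
rewrite (telescope_sumr (fun i => - phi (A i))%R pN).
by rewrite (AN (leqnn N)) phi0 oppr0 add0r opprK.
Qed.

Let mV i : measurable (V i). Proof. exact: mU. Qed.

Let mg : measurable_fun setT g.
Proof.
rewrite (_ : g = fun x => (\sum_(i < N) (A i - A i.+1) * \1_(V i) x)%R).
  by apply: measurable_sum => i; apply: measurable_funM.
by apply/funext => x; exact: (telescope (phi := id)).
Qed.

Let g0 x : (0 <= g x)%R. Proof. exact: A0. Qed.

Let phi_incr r i : (0 < r)%R -> (0 <= A i `^ r - A i.+1 `^ r)%R.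
Proof.
by move=> r0; rewrite subr_ge0 ge0_ler_powR ?nnegrE// ?A_nonincr// ltW.
Qed.

Let integral_g r (h : T -> \bar R) : (0 < r)%R -> (forall x, 0 <= h x) ->
  measurable_fun setT h ->
  \int[m]_x (h x * (g x `^ r)%:E) =
  \sum_(i < N) (A i `^ r - A i.+1 `^ r)%:E * \int[m]_(x in V i) h x.
Proof.
move=> r0 h0 mh.
under eq_integral => x _.
  rewrite (telescope (phi := fun y => y `^ r)%R) ?powR0 ?gt_eqF//.
  rewrite -sumEFin ge0_sume_distrr; last first.
    by move=> i _; rewrite lee_fin mulr_ge0// phi_incr.
  under eq_bigr do rewrite EFinM muleCA.
  over.
rewrite ge0_integral_sum//; last 2 first.
- move=> i; apply: measurable_funeM; apply: emeasurable_funM => //.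
  exact/measurable_EFinP.
- by move=> i x _; rewrite !mule_ge0// lee_fin// phi_incr.
apply: eq_bigr => i _; rewrite ge0_integralZl//; last 3 first.
- by apply: emeasurable_funM => //; exact/measurable_EFinP.
- by move=> x _; rewrite mule_ge0// lee_fin.
- by rewrite lee_fin phi_incr.
congr (_ * _); rewrite [RHS]integral_mkcond.
by apply: eq_integral => x _; rewrite epatch_indic.
Qed.

(** Every cell of rank at most [i] has average at least [A i], so the weak-type bound applies with
    [c = A i]. *)
Let V_weak i : (i < N)%N ->
  (A i)%:E * m (V i) <= K%:E * \int[m]_(x in V i) f x.
Proof.
move=> iN; apply: weak_type => //; first exact: ltW.
move=> k /(nthP 0%N)[j]; rewrite size_take sl.
have -> : (if (i.+1 < N)%N then i.+1 else N) = i.+1.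
  by case: ltnP => // ?; apply/eqP; rewrite eqn_leq iN andbT.
move=> ji <-; rewrite nth_take// -aM lee_pmul2r ?lee_fin//.
  have := A_nonincr (ji : (j <= i)%N).
  by rewrite {2}/A (nth_map 0%N)// sl (leq_ltn_trans _ iN).
by rewrite ge0_fin_numE.
Qed.

(** A discrete form of Doob's inequality. Both integrals are expanded over the sets [V i];
    [powR_increment] compares the coefficients, at the cost of a factor [A i] that [V_weak]
    consumes. *)
Let doob : \int[m]_x (g x `^ q)%:E <=
  (K * (q / (q - 1)))%:E * \int[m]_x (f x * (g x `^ (q - 1))%:E).
Proof.
have q0 : (0 < q)%R by apply: lt_trans q_gt1.
have q10 : (0 < q - 1)%R by rewrite subr_gt0.
have -> : \int[m]_x (g x `^ q)%:E = \int[m]_x (cst 1 x * (g x `^ q)%:E).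
  by apply: eq_integral => x _; rewrite mul1e.
rewrite !integral_g// ge0_sume_distrr; last first.
  by move=> i _; rewrite mule_ge0 ?lee_fin ?phi_incr// integral_ge0.
apply: lee_sum => i _; rewrite integral_cst// mul1e.
have := A0 i; rewrite le_eqVlt => /predU1P[Ai0|Ai_gt0].
  have -> : A i.+1 = 0%R.
    by apply/eqP; rewrite eq_le A0 andbT Ai0 A_nonincr.
  by rewrite -Ai0 !subrr !mul0e mule0.
set D := (A i `^ (q - 1) - A i.+1 `^ (q - 1))%R.
have D0 : (0 <= D)%R by exact: phi_incr.
have q'0 : (0 <= q / (q - 1))%R by rewrite divr_ge0 ?ltW.
apply: (@le_trans _ _ ((q / (q - 1) * D)%:E * ((A i)%:E * m (V i)))).
  rewrite muleA -EFinM; apply: lee_wpmul2r => //.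
  rewrite lee_fin (le_trans (powR_increment q_gt1 (A0 _) Ai_gt0))//.
  by rewrite -/D le_eqVlt; apply/orP; left; apply/eqP; ring.
apply: (@le_trans _ _ ((q / (q - 1) * D)%:E * (K%:E * \int[m]_(x in V i) f x))).
  by apply: lee_wpmul2l; [rewrite lee_fin mulr_ge0|exact: V_weak].
rewrite !muleA -!EFinM le_eqVlt; apply/orP; left; apply/eqP.
by congr (_%:E * _); ring.
Qed.

Lemma maximal_finite : exists g : T -> R,
  [/\ measurable_fun setT g, forall x, (0 <= g x)%R,
      forall k x, (k < N)%N -> F k x -> average m f (F k) <= (g x)%:E &
      \int[m]_x (g x `^ q)%:E <=
        ((2 * K * (q / (q - 1))) `^ q)%:E * \int[m]_x (f x `^ q)].
Proof.
exists g; split => //.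
  move=> k x kN Fkx; rewrite aE lee_fin.
  have kl : k \in l by rewrite mem_sort mem_iota.
  have -> : a k = A (index k l).
    by rewrite /A (nth_map 0%N) ?index_mem// nth_index.
  apply: A_nonincr; rewrite leqNgt; apply/negP => /(before_find 0%N)/negP.
  by rewrite nth_index//; apply; rewrite inE.
have q10 : (0 < q - 1)%R by rewrite subr_gt0.
have q0 : (0 < q)%R by exact: lt_trans q_gt1.
set X := \int[m]_x (g x `^ q)%:E.
set Y := \int[m]_x (f x `^ q).
set L := (K * (q / (q - 1)))%R.
have L0 : (0 < L)%R by rewrite mulr_gt0// divr_gt0.
(* Absorbing a multiple of [X] requires [X] to be finite: [g] takes finitely many values, on a union
   of finitely many cells of finite measure. This is why the family is first truncated to [N]
   cells. *)
have Xfin : X \is a fin_num.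
  rewrite /X; under eq_integral do rewrite -[(_ `^ _)%:E]mul1e.
  rewrite (@integral_g q (cst 1))//; apply/sum_fin_numP => i _ _.
  rewrite fin_numM// integral_cst// mul1e ge0_fin_numE//.
  apply: (@le_lt_trans _ _ (\sum_(k <- l) m (F k))).
    apply: (@le_trans _ _ (m (U l))).
      apply: le_measure; rewrite ?inE//.
      by move=> x [k /= kl Fkx]; exists k => //=; exact: mem_take kl.
    rewrite /U bigcup_seq; elim: (l) => [|k l' IH].
      by rewrite !big_nil measure0.
    rewrite !big_cons (le_trans (measureU2 _ _ _))//.
      by apply: bigsetU_measurable.
    by rewrite leeD.
  by apply: lte_sum_pinfty => k _; exact: m_lty.
have X0 : 0 <= X by apply: integral_ge0 => x _; rewrite lee_fin powR_ge0.
have Y0 : 0 <= Y by apply: integral_ge0 => x _; exact: poweR_ge0.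
(* With this [e], the term [L e X] in [key] is exactly [X / 2], and the remaining constant
   [2 L e^(1-q)] is [(2 L)^q]. *)
pose e := ((2 * L)^-1)%R.
have e0 : (0 < e)%R by rewrite invr_gt0 mulr_gt0.
have mgq : measurable_fun setT (fun x => (g x `^ q)%:E).
  by apply/measurable_EFinP; exact: (measurableT_comp (measurable_powR q)).
have mfqq : measurable_fun setT (fun x => f x `^ q) by exact: measurable_fun_poweR.
have key : X <= L%:E * (e%:E * X + (e `^ (1 - q))%:E * Y).
  apply: (le_trans doob); apply: lee_wpmul2l; first by rewrite lee_fin ltW.
  have -> : e%:E * X = \int[m]_x (e%:E * (g x `^ q)%:E).
    by rewrite ge0_integralZl// => [x _|]; rewrite lee_fin ?powR_ge0 ?ltW.
  have -> : (e `^ (1 - q))%:E * Y = \int[m]_x ((e `^ (1 - q))%:E * f x `^ q).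
    by rewrite ge0_integralZl// => [x _|]; rewrite ?poweR_ge0 ?lee_fin ?powR_ge0.
  rewrite -ge0_integralD//; last 4 first.
  - by move=> x _; rewrite mule_ge0 ?lee_fin ?powR_ge0// ltW.
  - exact: measurable_funeM.
  - by move=> x _; rewrite mule_ge0// ?poweR_ge0// lee_fin powR_ge0.
  - exact: measurable_funeM.
  apply: ge0_le_integral => //.
  - by move=> x _; rewrite mule_ge0// lee_fin powR_ge0.
  - apply: emeasurable_funM => //; apply/measurable_EFinP.
    exact: (measurableT_comp (measurable_powR _)).
  - by apply: emeasurable_funD; exact: measurable_funeM.
  - move=> x _; rewrite -EFinM; exact: young_absorb.
move: key X0 Y0; rewrite -(fineK Xfin).
set X' := fine X.
move: fq; rewrite -/Y; case: Y => [Y _|//|//].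
rewrite -(EFinM e) -(EFinM (e `^ (1 - q))) -EFinD -!EFinM !lee_fin => key X0 Y0.
have Le : (L * (e * X') = X' / 2)%R.
  by rewrite /e; field; rewrite gt_eqF.
have -> : ((2 * K * (q / (q - 1))) `^ q = 2 * L * e `^ (1 - q))%R.
  have -> : (2 * K * (q / (q - 1)) = 2 * L)%R by rewrite /L; ring.
  have L20 : (0 <= 2 * L)%R by rewrite mulr_ge0// ltW.
  rewrite -(mulr_powRB1 L20 q0); congr (_ * _)%R.
  by rewrite /e -powR_inv1// -powRrM mulN1r opprB.
rewrite mulrDr Le in key.
have -> : (2 * L * e `^ (1 - q) * Y = 2 * (L * (e `^ (1 - q) * Y)))%R by ring.
by move: key; set Z := (L * _)%R; lra.
Qed.

End FiniteFamily.

Theorem maximal_inequality m f (K q : R) :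
  (forall k, m (G k) <= K%:E * m (F k)) ->
  (forall k, 0 < m (F k)) -> (forall k, m (F k) < +oo) ->
  (0 < K)%R -> (1 < q)%R ->
  (forall x, 0 <= f x) -> measurable_fun setT f ->
  \int[m]_x (maximal m F f x `^ q) <=
    ((2 * K * (q / (q - 1))) `^ q)%:E * \int[m]_x (f x `^ q).
Proof.
move=> mGF m_gt0 m_lty K0 q1 f0 mf.
have q0 : (0 < q)%R by exact: lt_trans q1.
set C := (2 * K * (q / (q - 1)))%R.
have C0 : (0 < C)%R by rewrite !mulr_gt0// invr_gt0 subr_gt0.
have av0 k : 0 <= average m f (F k).
  by rewrite mule_ge0 ?integral_ge0// lee_fin invr_ge0 fine_ge0.
have [fq|] := ltP (\int[m]_x (f x `^ q)) +oo; last first.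
  rewrite leye_eq => /eqP ->; rewrite gt0_muley ?leey// lte_fin powR_gt0//.
pose u k x := (average m f (F k) * (\1_(F k) x)%:E) `^ q.
have u0 k x : 0 <= u k x by exact: poweR_ge0.
have mu_ k : measurable_fun setT (u k).
  apply: measurable_fun_poweR; apply: measurable_funeM.
  exact/measurable_EFinP.
(* Running maxima increase with [N], so monotone convergence reduces the claim to finite
   families. *)
pose h N x := iteri N (fun k y => maxe y (u k x)) 0.
have hS N x : h N x <= h N.+1 x by rewrite /= le_max lexx.
have h0 N x : 0 <= h N x.
  by elim: N => // N /le_trans; apply; exact: hS.
have h_le N x y : 0 <= y -> (forall k, (k < N)%N -> u k x <= y) -> h N x <= y.
  move=> y0; elim: N => // N IH uy; rewrite /= ge_max (uy N)// andbT.
  by apply: IH => k kN; apply: uy; exact: ltnW.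
have mh N : measurable_fun setT (h N).
  elim: N => [|N IH]; first exact: measurable_cst.
  exact: measurable_maxe.
have -> : (fun x => maximal m F f x `^ q) = (fun x => ereal_sup (range (h ^~ x))).
  apply/funext => x; rewrite /maximal poweR_ereal_sup//; last first.
    by move=> k; rewrite mule_ge0// lee_fin.
  apply/eqP; rewrite eq_le; apply/andP; split.
    apply: ge_ereal_sup => _ [k _ <-]; apply: le_ereal_sup_tmp.
    by exists (h k.+1 x); [exists k.+1|rewrite /= le_max lexx orbT].
  apply: ge_ereal_sup => _ [N _ <-]; apply: h_le => [|k _].
    by apply: le_ereal_sup_tmp; exists (u 0%N x) => //; exists 0%N.
  by apply: ereal_sup_ubound; exists k.
rewrite integral_nd_ereal_sup//.
apply: ge_ereal_sup => _ [N _ <-].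
have [g [mg g0 gF gq]] := maximal_finite mGF m_gt0 m_lty K0 q1 f0 mf fq N.
apply: le_trans gq; apply: ge0_le_integral => //.
  by apply/measurable_EFinP; exact: (measurableT_comp (measurable_powR q)).
move=> x _; apply: h_le => [|k kN]; first by rewrite lee_fin powR_ge0.
rewrite -poweR_EFin; apply: gee0_ler_poweR => //.
  by rewrite mule_ge0// lee_fin.
rewrite indicE; case: (boolP (x \in F k)) => [|_]; last by rewrite mule0 lee_fin.
by rewrite inE mule1 => Fkx; exact: gF.
Qed.

End Maximal.

Section MaximalBasics.
Local Open Scope ereal_scope.
Context d (T : measurableType d) (R : realType).
Context (m : {measure set T -> \bar R}) (F : nat -> set T).
Hypothesis mF : forall k, measurable (F k).
Implicit Types f g : T -> \bar R.

Lemma average_ge0 f A : (forall x, 0 <= f x) -> 0 <= average m f A.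
Proof.
by move=> f0; rewrite mule_ge0 ?integral_ge0// lee_fin invr_ge0 fine_ge0.
Qed.

Lemma average_maximal f k x : F k x -> average m f (F k) <= maximal m F f x.
Proof.
move=> Fkx; apply: ereal_sup_ubound; exists k => //.
by rewrite indicE mem_set// mule1.
Qed.

Lemma maximal_ge0 f x : (forall y, 0 <= f y) -> 0 <= maximal m F f x.
Proof.
move=> f0; apply: le_ereal_sup_tmp; eexists; first by exists 0%N.
by rewrite mule_ge0 ?average_ge0// lee_fin.
Qed.

Lemma maximal_le f x y : 0 <= y ->
  (forall k, F k x -> average m f (F k) <= y) -> maximal m F f x <= y.
Proof.
move=> y0 H; apply: ge_ereal_sup => _ [k _ <-].
rewrite indicE; case: (boolP (x \in F k)) => [|_]; last by rewrite mule0.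
by rewrite inE mule1; exact: H.
Qed.

Lemma measurable_maximal f : measurable_fun setT (maximal m F f).
Proof.
apply: measurable_fun_ereal_sup => k; apply: measurable_funeM.
exact/measurable_EFinP.
Qed.

Lemma le_average f g A : measurable A ->
  (forall x, 0 <= f x) -> (forall x, f x <= g x) ->
  measurable_fun setT f -> measurable_fun setT g ->
  average m f A <= average m g A.
Proof.
move=> mA f0 fg mf mg; apply: lee_wpmul2l.
  by rewrite lee_fin invr_ge0 fine_ge0.
by apply: ge0_le_integral => //; exact: measurable_funTS.
Qed.

Lemma le_maximal f g x : (forall x, 0 <= f x) -> (forall x, f x <= g x) ->
  measurable_fun setT f -> measurable_fun setT g ->
  maximal m F f x <= maximal m F g x.
Proof.
move=> f0 fg mf mg; apply: maximal_le => [|k Fkx].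
  by apply: maximal_ge0 => y; exact: le_trans (fg y).
apply: le_trans (average_maximal _ Fkx).
exact: le_average.
Qed.

End MaximalBasics.

Lemma density_gt0 d (T : measurableType d) (R : realType)
  (m : {measure set T -> \bar R}) (g : T -> R) (g0 : forall x, 0 <= g x)
  (mg : measurable_fun setT g) A :
  measurable A -> (forall x, A x -> 0 < g x) -> (0 < m A)%E ->
  (0 < density m g0 mg A)%E.
Proof.
move=> mA g_gt0 mA0; rewrite lt0e measure_ge0 andbT densityE.
apply/eqP => int0.
have mgA : measurable_fun A (EFin \o g).
  by apply/measurable_EFinP; exact: measurable_funTS.
have : ae_eq m A (EFin \o g) (cst 0%E).
  apply/(ae_eq_integral_abs _ mA mgA); rewrite -int0.
  by apply: eq_integral => x _; rewrite /= ger0_norm.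
move=> [N [mN N0 sub]].
have : (m A <= m N)%E.
  apply: le_measure; rewrite ?inE// => x Ax; apply: sub => /= /(_ Ax) [] gx.
  by have := g_gt0 x Ax; rewrite gx ltxx.
by rewrite N0 leNgt mA0.
Qed.

Lemma measurable_funV_ge0 d (T : measurableType d) (R : realType) (D : set T)
  (f : T -> R) : (forall x, 0 <= f x) -> measurable_fun D f ->
  measurable_fun D (fun x => (f x)^-1).
Proof.
move=> f0 mf; rewrite (_ : (fun _ => _) = (fun x => f x `^ (-1))).
  exact: (measurableT_comp (measurable_powR (-1))).
by apply/funext => x; rewrite powR_inv1.
Qed.

(** * Weights satisfying a Muckenhoupt condition: doubling and the weighted maximal inequality *)

Section Weights.
Context d (T : measurableType d) (R : realType).
Context (nu : {measure set T -> \bar R}) (F G : nat -> set T) (s : nat -> R).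
Hypothesis mF : forall k, measurable (F k).
Hypothesis mG : forall k, measurable (G k).
Hypothesis engulf : forall i j, F i `&` F j !=set0 -> s i <= s j ->
  F i `<=` G j.
Context (K : R).
Hypothesis K_gt0 : 0 < K.
Hypothesis nu_gt0 : forall k, (0 < nu (F k))%E.
Hypothesis nu_lty : forall k, (nu (G k) < +oo)%E.
Hypothesis nuGF : forall k, (nu (G k) <= K%:E * nu (F k))%E.

Let FG k : F k `<=` G k.
Proof.
apply: engulf => //; rewrite setIid; apply/set0P/eqP => F0.
by have := nu_gt0 k; rewrite F0 measure0 ltxx.
Qed.

Section WeightPair.
Context (w v : T -> R) (p A : R).
Hypothesis p_gt1 : 1 < p.
Hypothesis w_gt0 : forall x, 0 < w x.
Hypothesis v_gt0 : forall x, 0 < v x.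
Hypothesis mw : measurable_fun setT w.
Hypothesis mv : measurable_fun setT v.
(** This says [v = w^(-1/(p-1))], in a form that passes to the pair [(v, w)] with the conjugate
    exponent; see [dual_weight]. *)
Hypothesis wv : forall x, w x * v x `^ (p - 1) = 1.
Let w0 x : 0 <= w x. Proof. exact: ltW. Qed.
Let v0 x : 0 <= v x. Proof. exact: ltW. Qed.
Local Notation nw := (density nu (fun x => ltW (w_gt0 x)) mw).
Local Notation nv := (density nu (fun x => ltW (v_gt0 x)) mv).
Hypothesis nw_lty : forall k, (nw (G k) < +oo)%E.
Hypothesis nv_lty : forall k, (nv (G k) < +oo)%E.
Hypothesis A_gt0 : 0 < A.
Hypothesis ap : forall k,
  fine (nw (G k)) * fine (nv (G k)) `^ (p - 1) <= A * fine (nu (G k)) `^ p.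

Let p0 : 0 < p. Proof. exact: lt_trans p_gt1. Qed.
Let p10 : 0 < p - 1. Proof. by rewrite subr_gt0. Qed.

Let fin_pos (m : {measure set T -> \bar R}) k :
  (0 < m (F k))%E -> (m (G k) < +oo)%E ->
  [/\ m (F k) = (fine (m (F k)))%:E, m (G k) = (fine (m (G k)))%:E,
      0 < fine (m (F k)) & fine (m (F k)) <= fine (m (G k))].
Proof.
move=> m0 mGy.
have mFG : (m (F k) <= m (G k))%E by apply: le_measure; rewrite ?inE.
have mFy : (m (F k) < +oo)%E by exact: le_lt_trans mGy.
have mFf : m (F k) \is a fin_num by rewrite ge0_fin_numE.
have mGf : m (G k) \is a fin_num by rewrite ge0_fin_numE.
by split; rewrite ?fineK// ?fine_gt0 ?m0// fine_le.
Qed.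

Let nw_gt0 k : (0 < nw (F k))%E. Proof. exact: density_gt0. Qed.
Let nv_gt0 k : (0 < nv (F k))%E. Proof. exact: density_gt0. Qed.

(* A weak Young inequality replaces Hoelder's: [1 <= t w + t^(-1/(p-1)) v]
   pointwise for every [t > 0], and [t] is chosen so that the first term
   integrates to half of [nu (F k)]. *)
Lemma nu_le_weights k :
  (fine (nu (F k)) / 2) `^ p <= fine (nw (F k)) * fine (nv (F k)) `^ (p - 1).
Proof.
have [NE _ N0 _] := fin_pos (nu_gt0 k) (nu_lty k).
have [WE _ W0 _] := fin_pos (nw_gt0 k) (nw_lty k).
have [SE _ S0 _] := fin_pos (nv_gt0 k) (nv_lty k).
move: NE N0 WE W0 SE S0.
set N := fine (nu _); set W := fine (nw _); set S := fine (nv _).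
move=> NE N0 WE W0 SE S0.
pose t := N / (2 * W).
have t0 : 0 < t by rewrite divr_gt0// mulr_gt0.
have tE : t = N / (2 * W) by []; clearbody t.
pose t' := t `^ (- (p - 1)^-1).
have t'0 : 0 < t' by exact: powR_gt0.
have t'E : t' = t `^ (- (p - 1)^-1) by []; clearbody t'.
have young x : 1 <= t * w x + t' * v x.
  (* If [t w < 1], then [v^(p-1) = 1/w > t], so the second term is at least 1. *)
  have [tw|tw] := leP 1 (t * w x); first by rewrite ler_wpDr// mulr_ge0// ltW.
  rewrite ler_wpDl//; first by rewrite mulr_ge0// ltW.
  suff : 1 `^ (p - 1)^-1 <= (t' * v x) `^ (p - 1 ) `^ (p - 1)^-1.
    rewrite powR1 -powRrM mulfV ?gt_eqF// powRr1//.
    by rewrite mulr_ge0// ltW.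
  rewrite ge0_ler_powR ?nnegrE ?powR_ge0 ?invr_ge0 ?(ltW p10)//.
  rewrite powRM ?(ltW t'0)// t'E -powRrM mulNr mulVf ?gt_eqF//.
  rewrite powRN powRr1 ?(ltW t0)// -[X in X <= _](wv x) ler_pM2r ?powR_gt0//.
  by rewrite -div1r ler_pdivlMr// mulrC ltW.
have : N <= t * W + t' * S.
  rewrite -lee_fin EFinD !EFinM -NE -WE -SE !densityE.
  rewrite -!ge0_integralZl_EFin//.
  all: try (by move=> x _; rewrite lee_fin).
  all: try (by apply/measurable_EFinP; exact: measurable_funTS).
  all: try (exact: ltW).
  have -> : nu (F k) = (\int[nu]_(x in F k) (cst 1 x))%E.
    by rewrite integral_cst// mul1e.
  rewrite -ge0_integralD//.
  all: try (by move=> x _; rewrite -EFinM lee_fin mulr_ge0// ltW).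
  all: try (by apply: measurable_funeM; apply/measurable_EFinP;
            exact: measurable_funTS).
  apply: ge0_le_integral => //.
    by apply: emeasurable_funD; apply: measurable_funeM; apply/measurable_EFinP;
            exact: measurable_funTS.
  by move=> x _; rewrite -!EFinM -EFinD lee_fin.
have -> : t * W = N / 2 by rewrite tE; field; rewrite gt_eqF.
move=> H.
have {}H : N / 2 <= t' * S by lra.
have := ge0_ler_powR (ltW p10) _ _ H.
rewrite !nnegrE => /(_ _)/wrap[]; first by rewrite divr_ge0// ltW.
move=> /(_ _)/wrap[]; first by rewrite mulr_ge0// ltW.
rewrite powRM ?(ltW t'0) ?(ltW S0)// t'E -powRrM mulNr mulVf ?gt_eqF//.
rewrite powRN powRr1 ?(ltW t0)//.
have N20 : 0 <= N / 2 by rewrite divr_ge0// ltW.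
rewrite -(mulr_powRB1 N20 p0) => {}H.
have := ler_wpM2l N20 H.
move/le_trans; apply.
have -> : t^-1 = 2 * W / N by rewrite tE invf_div.
rewrite le_eqVlt; apply/orP; left; apply/eqP; field.
by rewrite gt_eqF.
Qed.

(** Chain the Muckenhoupt condition on [G k], the doubling of [nu], and [nu_le_weights] on [F k];
    then enlarge [nv (F k)] to [nv (G k)] and cancel its power. The 2 in [2 * K] is the loss of the
    weak Young inequality. *)
Lemma weight_doubling k :
  (nw (G k) <= (A * (2 * K) `^ p)%:E * nw (F k))%E.
Proof.
have [NE NGE N0 NN] := fin_pos (nu_gt0 k) (nu_lty k).
have [WE WGE W0 WW] := fin_pos (nw_gt0 k) (nw_lty k).
have [SE SGE S0 SS] := fin_pos (nv_gt0 k) (nv_lty k).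
have := nuGF k; rewrite NE NGE -EFinM lee_fin => NGN.
have apk := ap k; have hold := nu_le_weights k.
rewrite WE WGE -EFinM lee_fin.
move: NGN apk hold N0 NN W0 WW S0 SS; clear NE NGE WE WGE SE SGE.
move: (fine (nu (F k))) (fine (nu (G k))) => N N'.
move: (fine (nw (F k))) (fine (nw (G k))) => W W'.
move: (fine (nv (F k))) (fine (nv (G k))) => S S'.
move=> NGN apk hold N0 NN W0 WW S0 SS.
have S'0 : 0 < S' by exact: lt_le_trans SS.
have S'p : 0 < S' `^ (p - 1) by exact: powR_gt0.
rewrite -(ler_pM2r S'p); apply: (le_trans apk).
rewrite -!mulrA ler_pM2l//.
apply: (@le_trans _ _ ((2 * K) `^ p * (N / 2) `^ p)).
  rewrite -powRM ?divr_ge0 ?mulr_ge0 ?(ltW K_gt0) ?(ltW N0)//.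
  rewrite ge0_ler_powR ?nnegrE ?(ltW p0)//.
  - by rewrite (le_trans _ NN)// ltW.
  - by rewrite mulr_ge0 ?divr_ge0 ?mulr_ge0 ?(ltW K_gt0) ?(ltW N0).
  - by rewrite (le_trans NGN)// le_eqVlt; apply/orP; left; apply/eqP; field.
rewrite ler_pM2l ?powR_gt0 ?mulr_gt0//.
apply: (le_trans hold); rewrite ler_pM2l//.
by rewrite ge0_ler_powR ?nnegrE// ltW.
Qed.

Lemma dual_weight x : v x * w x `^ (p / (p - 1) - 1) = 1.
Proof.
have -> : p / (p - 1) - 1 = (p - 1)^-1 by field; rewrite gt_eqF.
have -> : v x = (v x `^ (p - 1)) `^ (p - 1)^-1.
  by rewrite -powRrM mulfV ?gt_eqF// powRr1.
rewrite -powRM ?powR_ge0 ?(ltW (w_gt0 _))//.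
by have := wv x; rewrite mulrC => ->; rewrite powR1.
Qed.

(** The power [1/(p-1)] of [ap]. With [dual_weight] it makes every result on [(w, v, p)] available
    for [(v, w, p/(p-1))]. *)
Lemma dual_ap k : fine (nv (G k)) * fine (nw (G k)) `^ (p / (p - 1) - 1) <=
  A `^ (p - 1)^-1 * fine (nu (G k)) `^ (p / (p - 1)).
Proof.
have -> : p / (p - 1) - 1 = (p - 1)^-1 by field; rewrite gt_eqF.
move: (ap k) (fine_ge0 (measure_ge0 nw (G k))) (fine_ge0 (measure_ge0 nv (G k)))
  (fine_ge0 (measure_ge0 nu (G k))).
move: (fine (nw _)) (fine (nv _)) (fine (nu _)) => W S N apk W0 S0 N0.
have := ge0_ler_powR _ _ _ apk.
move=> /(_ (p - 1)^-1); rewrite !nnegrE invr_ge0 !mulr_ge0 ?powR_ge0 ?(ltW A_gt0)//.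
move=> /(_ (ltW p10) isT isT).
rewrite !powRM ?powR_ge0 ?(ltW A_gt0)// -!powRrM mulfV ?gt_eqF// powRr1//.
by rewrite mulrC.
Qed.

Local Open Scope ereal_scope.

Let h (f : T -> \bar R) (x : T) : \bar R :=
  maximal nv F (fun y => f y * ((v y)^-1)%:E) x `^ (p - 1) * ((w x)^-1)%:E.

(* Lerner's pointwise bound.  If [b] is the [nv]-average of [f / v] over [F k],
   the [nu]-average of [f] is [b nv (F k) / nu (F k)], and the Muckenhoupt
   condition bounds this by [(b^(p-1) nu (F k) / nw (F k))^(1/(p-1))]; finally
   [b] is at most the [nv]-maximal function of [f / v] at each point of [F k]. *)
Lemma maximal_le_weighted_maximal f x : (forall x, 0 <= f x) -> measurable_fun setT f ->
  maximal nu F f x <=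
  ((A * K `^ p) `^ (p - 1)^-1)%:E * (maximal nw F (h f) x `^ (p - 1)^-1).
Proof.
move=> f0 mf.
have fv0 y : 0 <= f y * ((v y)^-1)%:E by rewrite mule_ge0// lee_fin invr_ge0.
have mfv : measurable_fun setT (fun y => f y * ((v y)^-1)%:E).
  apply: emeasurable_funM => //; apply/measurable_EFinP.
  exact: measurable_funV_ge0.
have h0 y : 0 <= h f y by rewrite mule_ge0 ?poweR_ge0// lee_fin invr_ge0.
have mh : measurable_fun setT (h f).
  apply: emeasurable_funM; first by apply: measurable_fun_poweR; exact: measurable_maximal.
  by apply/measurable_EFinP; exact: measurable_funV_ge0.
apply: maximal_le => [|k Fkx].
  by rewrite mule_ge0 ?poweR_ge0// lee_fin powR_ge0.
have [NE NGE N0 NN] := fin_pos (nu_gt0 k) (nu_lty k).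
have [WE WGE W0 WW] := fin_pos (nw_gt0 k) (nw_lty k).
have [SE SGE S0 SS] := fin_pos (nv_gt0 k) (nv_lty k).
pose N := fine (nu (F k)); pose W := fine (nw (F k)); pose S := fine (nv (F k)).
set r := ((p - 1)^-1)%R.
have r0 : (0 < r)%R by rewrite invr_gt0.
pose b := average nv (fun y => f y * ((v y)^-1)%:E) (F k).
have b0 : 0 <= b by exact: average_ge0.
have mfF D : measurable_fun D f by exact: measurable_funTS.
have bE : b = (S^-1)%:E * \int[nu]_(x in F k) f x.
  rewrite /b /average integral_density//; last exact: measurable_funTS.
  congr (_ * _); apply: eq_integral => y _.
  by rewrite -muleA -EFinM mulVf ?mule1// gt_eqF.
(* The factor [1/w] in [h] cancels the density of [nw], which leaves a [nu]-integral of something at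
   least [b^(p-1)] on [F k]. *)
have hb : (W^-1)%:E * (b `^ (p - 1) * nu (F k)) <= maximal nw F (h f) x.
  apply: le_trans (average_maximal _ _ Fkx); apply: lee_wpmul2l.
    by rewrite lee_fin invr_ge0 ltW.
  rewrite integral_density//; last exact: measurable_funTS.
  rewrite -integral_cst//; apply: ge0_le_integral => //.
  - by move=> y _; exact: poweR_ge0.
  - apply: emeasurable_funM; first exact: measurable_funTS.
    by apply/measurable_EFinP; exact: measurable_funTS.
  - move=> y Fky; rewrite /h -muleA -EFinM mulVf ?mule1 ?gt_eqF//.
    by apply: gee0_ler_poweR => //; exact: average_maximal.
have hb' : ((W^-1 * N) `^ r)%:E * b <= maximal nw F (h f) x `^ r.
  apply: le_trans (gee0_ler_poweR r0 _ hb).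
    have -> : (W^-1)%:E * (b `^ (p - 1) * nu (F k)) =
        (W^-1 * N)%:E * b `^ (p - 1).
      by rewrite NE EFinM -muleA (muleC (b `^ _)).
    rewrite poweRM ?poweR_ge0//; last first.
      by rewrite lee_fin mulr_ge0 ?invr_ge0 ?ltW.
    by rewrite poweR_EFin -poweRrM mulfV ?gt_eqF// poweRe1.
  by rewrite !mule_ge0 ?poweR_ge0// lee_fin invr_ge0 ltW.
apply: (@le_trans _ _ (((A * K `^ p) `^ r)%:E * (((W^-1 * N) `^ r)%:E * b))).
  rewrite bE !muleA -!EFinM; apply: lee_wpmul2r; first exact: integral_ge0.
  rewrite lee_fin -/N.
  have := ap k; have := nuGF k; rewrite NE NGE -EFinM lee_fin.
  move: N0 NN W0 WW S0 SS; rewrite -/N -/W -/S.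
  clear NE NGE WE WGE SE SGE b b0 bE hb hb'.
  move: N (fine (nu (G k))) W (fine (nw (G k))) S (fine (nv (G k))).
  move=> N N' W W' S S' N0 NN W0 WW S0 SS NK apk.
  have AK0 : (0 < A * K `^ p)%R by rewrite mulr_gt0// powR_gt0.
  (* The Muckenhoupt condition passes from [G k] down to [F k] at the cost of [K^p]. *)
  have H : (W * S `^ (p - 1) <= A * K `^ p * N `^ p)%R.
    apply: (@le_trans _ _ (W' * S' `^ (p - 1))%R).
      apply: ler_pM => //; [exact: ltW|exact: powR_ge0|].
      by rewrite ge0_ler_powR ?nnegrE// ?ltW// (lt_le_trans S0).
    apply: (le_trans apk); rewrite -mulrA ler_pM2l//.
    rewrite -powRM ?(ltW K_gt0) ?(ltW N0)//.
    rewrite ge0_ler_powR ?nnegrE ?(ltW p0)//.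
      by rewrite ltW// (lt_le_trans N0).
    by rewrite mulr_ge0 ?(ltW K_gt0) ?(ltW N0).
  have := ge0_ler_powR (ltW r0) _ _ H.
  rewrite !nnegrE !mulr_ge0 ?powR_ge0 ?(ltW A_gt0) ?(ltW W0)//.
  move=> /(_ isT isT).
  rewrite (powRM _ (ltW W0) (powR_ge0 _ _)) -(powRrM S) mulfV ?gt_eqF//.
  rewrite powRr1 ?(ltW S0)// (powRM _ (ltW AK0) (powR_ge0 _ _)) -(powRrM N).
  have -> : (p * r = 1 + r)%R by rewrite /r; field; rewrite gt_eqF.
  rewrite powRD; last by rewrite (gt_eqF N0) implybT.
  rewrite powRr1 ?(ltW N0)// => {}H.
  set c := ((A * K `^ p) `^ r)%R in H *.
  have Wr0 : (0 < W `^ r)%R by exact: powR_gt0.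
  have -> : ((W^-1 * N) `^ r = (W `^ r)^-1 * N `^ r)%R.
    rewrite powRM ?invr_ge0 ?(ltW W0) ?(ltW N0)//.
    by rewrite -(powR_inv1 (ltW W0)) powRAC powR_inv1 ?powR_ge0.
  have -> : (c * ((W `^ r)^-1 * N `^ r) * S^-1 =
             c * (N * N `^ r) / (W `^ r * S) * N^-1)%R.
    by field; rewrite !gt_eqF.
  rewrite -[leLHS]mul1r ler_wpM2r ?invr_ge0 ?(ltW N0)//.
  by rewrite ler_pdivlMr ?mulr_gt0// mul1r.
by apply: lee_wpmul2l => //; rewrite lee_fin powR_ge0.
Qed.

(** The pointwise bound is raised to the power [p]. The maximal inequality for [nw] applies with
    exponent [q]; since [w^(1-q) = v], the integral of [h^q] for [nw] is that of [M_v (f/v)^p] for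
    [nv]. The maximal inequality for [nv] with exponent [p] and [v^(1-p) = w] finish. *)
Lemma weighted_maximal_inequality (L : R) : (0 < L)%R ->
  (forall k, nv (G k) <= L%:E * nv (F k)) ->
  exists2 C : R, (0 < C)%R & forall f, (forall x, 0 <= f x) ->
    measurable_fun setT f ->
    \int[nu]_x (maximal nu F f x `^ p * (w x)%:E) <=
    C%:E * \int[nu]_x (f x `^ p * (w x)%:E).
Proof.
move=> L0 nvGF.
set r := ((p - 1)^-1)%R; have r0 : (0 < r)%R by rewrite invr_gt0.
set q := (p / (p - 1))%R.
have q1 : (1 < q)%R by rewrite /q ltr_pdivlMr// mul1r gtrBl.
have q0 : (0 < q)%R by exact: lt_trans q1.
have rp : (r * p = q)%R by rewrite mulrC.
have pq : ((p - 1) * q = p)%R by rewrite /q mulrC divfK// gt_eqF.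
set C0 := ((A * K `^ p) `^ r)%R.
have C00 : (0 < C0)%R by rewrite powR_gt0// mulr_gt0// powR_gt0.
pose K1 := (A * (2 * K) `^ p)%R.
have K10 : (0 < K1)%R by rewrite mulr_gt0// powR_gt0// mulr_gt0.
pose C1 := ((2 * K1 * (q / (q - 1))) `^ q)%R.
pose C2 := ((2 * L * (p / (p - 1))) `^ p)%R.
have C10 : (0 < C1)%R.
  apply: powR_gt0; apply: mulr_gt0; first exact: mulr_gt0.
  by rewrite divr_gt0// subr_gt0.
have C20 : (0 < C2)%R.
  by apply: powR_gt0; apply: mulr_gt0; [exact: mulr_gt0|exact: divr_gt0].
exists (C0 `^ p * (C1 * C2))%R => [|f f0 mf].
  by apply: mulr_gt0; [exact: powR_gt0|exact: mulr_gt0].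
have fv0 y : 0 <= f y * ((v y)^-1)%:E by rewrite mule_ge0// lee_fin invr_ge0.
have mfv : measurable_fun setT (fun y => f y * ((v y)^-1)%:E).
  apply: emeasurable_funM => //; apply/measurable_EFinP.
  exact: measurable_funV_ge0.
have h0 y : 0 <= h f y by rewrite mule_ge0 ?poweR_ge0// lee_fin invr_ge0.
have mh : measurable_fun setT (h f).
  apply: emeasurable_funM; first by apply: measurable_fun_poweR; exact: measurable_maximal.
  by apply/measurable_EFinP; exact: measurable_funV_ge0.
have mww : measurable_fun setT (fun x => (w x)%:E) by apply/measurable_EFinP.
have mvv : measurable_fun setT (fun x => (v x)%:E) by apply/measurable_EFinP.
have mMh : measurable_fun setT (fun x => maximal nw F (h f) x `^ q).
  by apply: measurable_fun_poweR; exact: measurable_maximal.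
have FGlty (m : {measure set T -> \bar R}) k : m (G k) < +oo -> m (F k) < +oo.
  by apply: le_lt_trans; apply: le_measure; rewrite ?inE.
apply: (@le_trans _ _ ((C0 `^ p)%:E * \int[nw]_x (maximal nw F (h f) x `^ q))).
  rewrite integral_density//; last by move=> x _; exact: poweR_ge0.
  rewrite -ge0_integralZl//; last 3 first.
  - exact: emeasurable_funM.
  - by move=> x _; rewrite mule_ge0 ?poweR_ge0// lee_fin.
  - by rewrite lee_fin powR_ge0.
  apply: ge0_le_integral => //.
  - by move=> x _; rewrite mule_ge0 ?poweR_ge0// lee_fin.
  - apply: emeasurable_funM => //; apply: measurable_fun_poweR.
    exact: measurable_maximal.
  - by apply: measurable_funeM; exact: emeasurable_funM.
  move=> x _; rewrite muleA; apply: lee_wpmul2r; first by rewrite lee_fin.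
  rewrite -poweR_EFin -rp [X in _ * X]poweRrM -poweRM ?poweR_ge0//; last first.
    by rewrite lee_fin ltW.
  apply: gee0_ler_poweR => //; first exact: maximal_ge0.
  exact: maximal_le_weighted_maximal.
rewrite EFinM -!muleA; apply: lee_wpmul2l; first by rewrite lee_fin powR_ge0.
have nwF k : 0 < nw (F k) by exact: nw_gt0.
apply: (@le_trans _ _ (C1%:E * \int[nw]_x (h f x `^ q))).
  apply: (maximal_inequality mF mG engulf) => // k.
    exact: weight_doubling.
  exact: FGlty.
rewrite EFinM -muleA; apply: lee_wpmul2l; first by rewrite lee_fin ltW.
have -> : \int[nw]_x (h f x `^ q) = \int[nv]_x
    (maximal nv F (fun y => f y * ((v y)^-1)%:E) x `^ p).
  rewrite !integral_density//; last 4 first.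
  - by apply: measurable_fun_poweR; exact: measurable_maximal.
  - by move=> x _; exact: poweR_ge0.
  - exact: measurable_fun_poweR.
  - by move=> x _; exact: poweR_ge0.
  apply: eq_integral => x _; rewrite /h poweRM ?poweR_ge0//; last first.
    by rewrite lee_fin invr_ge0.
  rewrite -poweRrM pq -muleA; congr (_ * _).
  rewrite poweR_EFin -EFinM; congr _%:E.
  rewrite -(powR_inv1 (w0 x)) powRAC powR_inv1 ?powR_ge0//.
  have wq0 := powR_gt0 (q - 1)%R (w_gt0 x).
  apply: (mulIf (lt0r_neq0 wq0)); rewrite dual_weight -(mulr_powRB1 (w0 x) q0).
  by field; rewrite !gt_eqF.
apply: (@le_trans _ _ (C2%:E * \int[nv]_x ((f x * ((v x)^-1)%:E) `^ p))).
  apply: (maximal_inequality mF mG engulf) => // k.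
  exact: FGlty.
apply: lee_wpmul2l; first by rewrite lee_fin ltW.
rewrite integral_density//; last 2 first.
- exact: measurable_fun_poweR.
- by move=> x _; exact: poweR_ge0.
rewrite le_eqVlt; apply/orP; left; apply/eqP; apply: eq_integral => x _.
rewrite poweRM//; last by rewrite lee_fin invr_ge0.
rewrite -muleA; congr (_ * _); rewrite poweR_EFin -EFinM; congr _%:E.
rewrite -(powR_inv1 (v0 x)) powRAC powR_inv1 ?powR_ge0//.
have vp0 := powR_gt0 (p - 1)%R (v_gt0 x).
apply: (mulIf (lt0r_neq0 vp0)); rewrite wv -(mulr_powRB1 (v0 x) p0).
by field; rewrite !gt_eqF.
Qed.

End WeightPair.
End Weights.

(** * Supersolutions of the maximal operators *)

Section Iteration.
Local Open Scope ereal_scope.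
Context d (T : measurableType d) (R : realType).
Context (nu : {measure set T -> \bar R}) (F : nat -> set T).
Hypothesis mF : forall k, measurable (F k).
Hypothesis nuF_gt0 : forall k, 0 < nu (F k).
Hypothesis nuF_lty : forall k, nu (F k) < +oo.
Context (w v : T -> R) (p C : R).
Hypothesis p_gt1 : (1 < p)%R.
Hypothesis C_gt0 : (0 < C)%R.
Hypothesis w_gt0 : forall x, (0 < w x)%R.
Hypothesis v_gt0 : forall x, (0 < v x)%R.
Hypothesis mw : measurable_fun setT w.
Hypothesis wv : forall x, (w x * v x `^ (p - 1) = 1)%R.
Let q := (p / (p - 1))%R.
Local Notation M := (maximal nu F).
Hypothesis Mw : forall f, (forall x, 0 <= f x) -> measurable_fun setT f ->
  \int[nu]_x (M f x `^ p * (w x)%:E) <= C%:E * \int[nu]_x (f x `^ p * (w x)%:E).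
Hypothesis Mv : forall f, (forall x, 0 <= f x) -> measurable_fun setT f ->
  \int[nu]_x (M f x `^ q * (v x)%:E) <= C%:E * \int[nu]_x (f x `^ q * (v x)%:E).
Hypothesis w_int : \int[nu]_x (w x)%:E < +oo.

Let p0 : (0 < p)%R. Proof. exact: lt_trans p_gt1. Qed.
Let p10 : (0 < p - 1)%R. Proof. by rewrite subr_gt0. Qed.
Let r := ((p - 1)^-1)%R.
Let r0 : (0 < r)%R. Proof. by rewrite invr_gt0. Qed.
Let rp : (r * p = q)%R. Proof. by rewrite mulrC. Qed.
Let pq : ((p - 1) * q = p)%R. Proof. by rewrite /q mulrC divfK// gt_eqF. Qed.
Let mww : measurable_fun setT (fun x => (w x)%:E).
Proof. exact/measurable_EFinP. Qed.
Let ww0 x : 0 <= (w x)%:E. Proof. by rewrite lee_fin ltW. Qed.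

(** The two changes of weight in [N_dualM]: one turns the [L^p(w)] norm of [dualM u] into an
    [L^q(v)] norm, the other leads back to [u]. *)
Let wq_v x : ((w x)^-1 `^ q * w x = v x)%R /\ (w x `^ q * v x = w x)%R.
Proof.
have w0 := ltW (w_gt0 x).
have q0 : (0 < q)%R by exact: divr_gt0.
have dual := dual_weight p_gt1 w_gt0 v_gt0 wv x.
have wq0 := powR_gt0 (q - 1)%R (w_gt0 x).
rewrite -/q in dual.
rewrite -(powR_inv1 w0) powRAC powR_inv1 ?powR_ge0// -(mulr_powRB1 w0 q0).
split; last by rewrite -mulrA (mulrC _ (v x)) dual mulr1.
apply: (mulIf (lt0r_neq0 wq0)); rewrite dual.
by field; rewrite !gt_eqF.
Qed.

(** The sum is at most three times its largest term; by symmetry that term is [x]. *)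
Lemma poweR_add3_le (x y z : \bar R) : 0 <= x -> 0 <= y -> 0 <= z ->
  (x + y + z) `^ p <= (3 `^ p)%:E * (x `^ p + y `^ p + z `^ p).
Proof.
move=> x0 y0 z0.
wlog [yx zx] : x y z x0 y0 z0 / y <= x /\ z <= x.
  move=> H; have [xy|/ltW yx] := leP x y; have [xz|/ltW zx] := leP x z.
  - have [yz|/ltW zy] := leP y z.
      rewrite (addeC _ z) addeA (addeC (_ `^ _ + _) (z `^ p)) addeA.
      exact: H.
    rewrite (addeC x) (addeC (x `^ p)); exact: H.
  - by rewrite (addeC x) (addeC (x `^ p)); apply: H => //; split => //; exact: le_trans xy.
  - rewrite (addeC _ z) addeA (addeC (_ `^ _ + _) (z `^ p)) addeA.
    by apply: H => //; split => //; exact: le_trans xz.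
  - exact: H.
apply: (@le_trans _ _ ((3%:E * x) `^ p)).
  apply: gee0_ler_poweR => //; first by rewrite !adde_ge0.
  have -> : 3%:E * x = x + x + x.
    have -> : (3 : R)%R = (1 + 1 + 1)%R by ring.
    by rewrite !EFinD !ge0_muleDl ?adde_ge0 ?mul1e.
  by rewrite !leeD.
rewrite poweRM// poweR_EFin; apply: lee_wpmul2l; first by rewrite lee_fin powR_ge0.
by rewrite -addeA leeDl// adde_ge0// poweR_ge0.
Qed.

(** Chosen so that [3^p (e^p C + e^p C) = 1/2]: the part of [step] depending on [u] at most halves
    the [p]-th power of the norm. *)
Let e := ((4 * C * 3 `^ p)^-1 `^ p^-1)%R.
Let e_gt0 : (0 < e)%R.
Proof. by rewrite powR_gt0// invr_gt0 !mulr_gt0// powR_gt0. Qed.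
Let ep : (e `^ p = (4 * C * 3 `^ p)^-1)%R.
Proof.
by rewrite /e -powRrM mulVf ?gt_eqF// powRr1// invr_ge0 ltW// !mulr_gt0// powR_gt0.
Qed.

(** [M] conjugated by the weight. An inequality [e dualM u <= u] is a [B_1] bound for [w u^(p-1)],
    just as [e M u <= u] is one for [u]. *)
Let dualM (u : T -> \bar R) x :=
  (((w x)^-1)%:E * M (fun y => (w y)%:E * u y `^ (p - 1)) x) `^ r.

Let step (u : T -> \bar R) x := 1 + e%:E * M u x + e%:E * dualM u x.

Let good (u : T -> \bar R) := (forall x, 0 <= u x) /\ measurable_fun setT u.

Let goodw u : good u -> good (fun y => (w y)%:E * u y `^ (p - 1)).
Proof.
move=> [u0 mu]; split => [x|]; first by rewrite mule_ge0 ?poweR_ge0.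
by apply: emeasurable_funM => //; exact: measurable_fun_poweR.
Qed.

Let good_dualM u : good u -> good (dualM u).
Proof.
move=> gu; split => [x|]; first exact: poweR_ge0.
apply: measurable_fun_poweR; apply: emeasurable_funM; last exact: measurable_maximal.
by apply/measurable_EFinP; apply: measurable_funV_ge0 => // x; exact: ltW.
Qed.

Let good_M u : good u -> good (M u).
Proof.
by move=> [u0 mu]; split => [x|]; [exact: maximal_ge0|exact: measurable_maximal].
Qed.

Let good_scale c u : (0 <= c)%R -> good u -> good (fun x => c%:E * u x).
Proof.
move=> c0 [u0 mu]; split => [x|]; first by rewrite mule_ge0.
exact: measurable_funeM.
Qed.

Let good_add u1 u2 : good u1 -> good u2 -> good (fun x => u1 x + u2 x).
Proof.
move=> [u10 mu1] [u20 mu2]; split => [x|]; first by rewrite adde_ge0.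
exact: emeasurable_funD.
Qed.

Let good_pow s u : good u -> good (fun x => u x `^ s).
Proof.
move=> [u0 mu]; split => [x|]; first exact: poweR_ge0.
exact: measurable_fun_poweR.
Qed.

Let good_cst c : (0 <= c)%R -> good (cst c%:E).
Proof. by move=> c0; split => [x|]; [rewrite lee_fin|exact: measurable_cst]. Qed.

Let good_step u : good u -> good (step u).
Proof.
move=> gu; have := ltW e_gt0; move=> e0.
apply: good_add; last by apply: good_scale => //; exact: good_dualM.
apply: good_add; first exact: (good_cst ler01).
by apply: good_scale => //; exact: good_M.
Qed.

Let step_mono u1 u2 : good u1 -> good u2 -> (forall x, u1 x <= u2 x) ->
  forall x, step u1 x <= step u2 x.
Proof.
move=> g1 g2 u12 x; have e0 : 0 <= e%:E by rewrite lee_fin ltW.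
apply: leeD; [apply: leeD => //|]; apply: lee_wpmul2l => //.
  by case: g1 => ? ?; case: g2 => ? ?; apply: le_maximal.
have w0 : 0 <= ((w x)^-1)%:E by rewrite lee_fin invr_ge0 ltW.
apply: gee0_ler_poweR => //.
  by rewrite mule_ge0// maximal_ge0// => y; case: (goodw g1).
apply: lee_wpmul2l => //; case: (goodw g1) => ? ?; case: (goodw g2) => ? ?.
apply: le_maximal => // y; apply: lee_wpmul2l => //.
by apply: gee0_ler_poweR => //; case: g1.
Qed.

(** The [p]-th power of the [L^p(w)] norm; [poweR_add3_le] takes the place of Minkowski's
    inequality. *)
Let N (u : T -> \bar R) := \int[nu]_x (u x `^ p * (w x)%:E).

Let goodN u : good u -> good (fun x => u x `^ p * (w x)%:E).
Proof.
move=> gu; have [u0 mu] := good_pow p gu; split => [x|]; first by rewrite mule_ge0.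
exact: emeasurable_funM.
Qed.

Let N_dualM u : good u -> N (dualM u) <= C%:E * N u.
Proof.
move=> gu; have [g0 mg] := goodw gu.
have -> : N (dualM u) =
    \int[nu]_x (M (fun y => (w y)%:E * u y `^ (p - 1)) x `^ q * (v x)%:E).
  apply: eq_integral => x _; rewrite /dualM -poweRrM rp.
  rewrite poweRM ?maximal_ge0 ?lee_fin ?invr_ge0 ?(ltW (w_gt0 x))//.
  rewrite muleAC poweR_EFin -EFinM (wq_v x).1 muleC//.
apply: (le_trans (Mv g0 mg)); rewrite le_eqVlt; apply/orP; left; apply/eqP.
congr (_ * _); apply: eq_integral => x _.
rewrite poweRM ?poweR_ge0// -poweRrM pq muleAC poweR_EFin -EFinM.
by rewrite (wq_v x).2 muleC.
Qed.

Let N_scale c u : (0 <= c)%R -> good u ->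
  N (fun x => c%:E * u x) = (c `^ p)%:E * N u.
Proof.
move=> c0 gu; have [g0 mg] := goodN gu.
rewrite /N -ge0_integralZl//; last by rewrite lee_fin powR_ge0.
apply: eq_integral => x _; rewrite poweRM ?lee_fin//; first by rewrite muleA poweR_EFin.
by case: gu.
Qed.

Let W := \int[nu]_x (w x)%:E.
Let W0 : 0 <= W. Proof. exact: integral_ge0. Qed.

Let N_step u : good u ->
  N (step u) <= (3 `^ p)%:E * W + (2^-1)%:E * N u.
Proof.
move=> gu; have e0 := ltW e_gt0.
have gM := good_scale e0 (good_M gu).
have gD := good_scale e0 (good_dualM gu).
have g1 := good_cst (ler01 : (0 <= 1 :> R)%R).
have [M0 mM] := goodN gM; have [D0 mD] := goodN gD; have [I0 mI] := goodN g1.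
have T0 : 0 <= (3 `^ p)%:E by rewrite lee_fin powR_ge0.
apply: (@le_trans _ _ ((3 `^ p)%:E * (N (cst 1) + N (fun x => e%:E * M u x) +
    N (fun x => e%:E * dualM u x)))).
  rewrite /N -ge0_integralD// -ge0_integralD//; last 2 first.
  - by move=> x _; rewrite adde_ge0 ?M0 ?I0.
  - exact: emeasurable_funD.
  rewrite -ge0_integralZl//; last 2 first.
  - by apply: emeasurable_funD => //; exact: emeasurable_funD.
  - by move=> x _; rewrite !adde_ge0 ?M0 ?I0 ?D0.
  have [s0 ms] := goodN (good_step gu).
  apply: ge0_le_integral => //.
    by apply: measurable_funeM; apply: emeasurable_funD => //; exact: emeasurable_funD.
  move=> x _; rewrite -!ge0_muleDl ?adde_ge0 ?poweR_ge0// muleA.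
  apply: lee_wpmul2r => //; apply: poweR_add3_le => //.
    by case: gM.
  by case: gD.
rewrite (N_scale e0 (good_M gu)) (N_scale e0 (good_dualM gu)).
have -> : N (cst 1) = W.
  by apply: eq_integral => x _; rewrite poweR1r mul1e.
have [N0 mN] := goodN gu.
have Nu0 : 0 <= N u by apply: integral_ge0.
apply: (@le_trans _ _ ((3 `^ p)%:E * (W + (e `^ p)%:E * (C%:E * N u) +
    (e `^ p)%:E * (C%:E * N u)))).
  apply: lee_wpmul2l => //; apply: leeD; last first.
    by apply: lee_wpmul2l; [rewrite lee_fin powR_ge0|exact: N_dualM].
  apply: leeD => //; apply: lee_wpmul2l; first by rewrite lee_fin powR_ge0.
  by case: gu => ? ?; exact: Mw.
have eC0 : (0 <= e `^ p * C)%R by rewrite mulr_ge0 ?powR_ge0 ?(ltW C_gt0).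
rewrite muleA -EFinM -addeA -ge0_muleDl ?lee_fin// ge0_muleDr//; last first.
  by apply: mule_ge0 => //; rewrite lee_fin addr_ge0.
rewrite leeD2l// muleA -EFinD -EFinM.
apply: lee_wpmul2r => //; rewrite lee_fin ep.
rewrite le_eqVlt; apply/orP; left; apply/eqP; field.
by rewrite !gt_eqF// powR_gt0.
Qed.

Let u_ k := iter k step (cst 0).

Let good_u k : good (u_ k).
Proof. by elim: k => [|k IH]; [exact: (good_cst (lexx 0%R))|exact: good_step]. Qed.

Let u_stepE k : u_ k.+1 = step (u_ k). Proof. by []. Qed.

Let u_S k x : u_ k x <= u_ k.+1 x.
Proof.
elim: k x => [|k IH] x.
  by case: (good_u 1) => + _; apply.
exact: (step_mono (good_u k) (good_u k.+1) IH).
Qed.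

(** The right-hand side is the fixed point of [x |-> 3^p W + x / 2], the bound in [N_step]. *)
Let N_u k : N (u_ k) <= (2 * 3 `^ p)%:E * W.
Proof.
have B0 : 0 <= (2 * 3 `^ p)%:E * W.
  by apply: mule_ge0 => //; rewrite lee_fin mulr_ge0 ?powR_ge0.
elim: k => [|k IH].
  apply: le_trans B0; rewrite le_eqVlt; apply/orP; left; apply/eqP.
  by apply: integral0_eq => x _; rewrite poweR0r ?gt_eqF// mul0e.
apply: (le_trans (N_step (good_u k))).
apply: (@le_trans _ _ ((3 `^ p)%:E * W + (2^-1)%:E * ((2 * 3 `^ p)%:E * W))).
  by apply: leeD => //; apply: lee_wpmul2l.
rewrite muleA -EFinM -ge0_muleDl ?lee_fin ?mulr_ge0 ?powR_ge0// -EFinD.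
rewrite le_eqVlt; apply/orP; left; apply/eqP; congr (_%:E * _).
by field.
Qed.

(* Increasing iterates replace the usual Neumann series, so that the maximal
   operators only need to be monotone, not sublinear. *)
Theorem exists_supersolution : exists (u : T -> \bar R) (D : R),
  [/\ measurable_fun setT u, forall x, 1 <= u x, (0 <= D)%R,
      \int[nu]_x (u x `^ p * (w x)%:E) < +oo &
      forall k x, F k x ->
        \int[nu]_(y in F k) u y <= D%:E * nu (F k) * u x /\
        \int[nu]_(y in F k) ((w y)%:E * u y `^ (p - 1)) <=
          D%:E * nu (F k) * ((w x)%:E * u x `^ (p - 1))].
Proof.
pose u x := ereal_sup (range (u_ ^~ x)).
have u_u k x : u_ k x <= u x by apply: ereal_sup_ubound; exists k.
have mu_ k : measurable_fun setT (u_ k) by case: (good_u k).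
have u_0 k x : 0 <= u_ k x by case: (good_u k).
have mu : measurable_fun setT u by exact: measurable_fun_ereal_sup.
have e0 := ltW e_gt0.
pose nw := density nu (fun x => ltW (w_gt0 x)) mw.
have u_pow s A : (0 < s)%R -> measurable A -> \int[nw]_(x in A) (u x `^ s) =
    ereal_sup (range (fun k => \int[nw]_(x in A) (u_ k x `^ s))).
  move=> s0 mA; rewrite -integral_nd_ereal_sup//.
  - by apply: eq_integral => x _; rewrite poweR_ereal_sup.
  - by move=> k; apply: measurable_fun_poweR; exact: measurable_funTS.
  - by move=> k x _; exact: poweR_ge0.
  - by move=> k x _; exact: gee0_ler_poweR.
have u1 x : 1 <= u x.
  apply: (@le_trans _ _ (u_ 1 x)) => //.
  have [M0 _] := good_M (good_u 0); have [D0 _] := good_dualM (good_u 0).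
  by rewrite u_stepE /step -addeA leeDl// adde_ge0// mule_ge0.
(* [1/e] comes from [e M u <= u]; its power [p - 1] comes from raising [e dualM u <= u] to that
   power. *)
exists u, (Num.max (e^-1) (e^-1 `^ (p - 1)))%R; split => //.
- by rewrite le_max invr_ge0 e0.
- have -> : \int[nu]_x (u x `^ p * (w x)%:E) = \int[nw]_x (u x `^ p).
    rewrite integral_density//; first exact: measurable_fun_poweR.
    by move=> x _; exact: poweR_ge0.
  rewrite u_pow//.
  apply: (@le_lt_trans _ _ ((2 * 3 `^ p)%:E * W)).
    apply: ge_ereal_sup => _ [k _ <-]; rewrite integral_density//.
    + exact: N_u.
    + exact: measurable_fun_poweR.
    + by move=> x _; exact: poweR_ge0.
  by apply: lte_mul_pinfty => //; rewrite lee_fin mulr_ge0 ?powR_ge0.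
move=> k x Fkx.
have nuF : nu (F k) = (fine (nu (F k)))%:E by rewrite fineK// ge0_fin_numE.
have nuF0 : (0 < fine (nu (F k)))%R by rewrite fine_gt0// nuF_gt0 nuF_lty.
move: nuF nuF0; set n := fine _ => nuF nuF0.
have n_avg f : \int[nu]_(y in F k) f y = n%:E * average nu f (F k).
  by rewrite /average -/n muleA -EFinM mulfV ?mul1e// gt_eqF.
have ux0 : 0 <= u x by exact: le_trans (u1 x).
split.
- apply: (@le_trans _ _ ((e^-1)%:E * nu (F k) * u x)); last first.
    apply: lee_wpmul2r => //; apply: lee_wpmul2r => //.
    by rewrite lee_fin le_max lexx.
  rewrite integral_nd_ereal_sup//; last first.
    by move=> j; exact: measurable_funTS.
  apply: ge_ereal_sup => _ [j _ <-].
  rewrite n_avg nuF (muleC _ n%:E) -muleA; apply: lee_wpmul2l.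
    by rewrite lee_fin ltW.
  apply: (le_trans (average_maximal _ _ Fkx)).
  rewrite lee_pdivlMl//; apply: le_trans (u_u j.+1 x).
  have [D0 _] := good_dualM (good_u j).
  by rewrite u_stepE /step addeAC leeDr// adde_ge0// mule_ge0.
- apply: (@le_trans _ _
     ((e^-1 `^ (p - 1))%:E * nu (F k) * ((w x)%:E * u x `^ (p - 1)))); last first.
    apply: lee_wpmul2r; first by rewrite mule_ge0 ?poweR_ge0.
    apply: lee_wpmul2r => //.
    by rewrite lee_fin le_max lexx orbT.
  have -> : \int[nu]_(y in F k) ((w y)%:E * u y `^ (p - 1)) =
      \int[nw]_(y in F k) (u y `^ (p - 1)).
    rewrite integral_density//.
    + by apply: eq_integral => y _; rewrite muleC.
    + by apply: measurable_fun_poweR; exact: measurable_funTS.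
    + by move=> y _; exact: poweR_ge0.
  rewrite u_pow//; apply: ge_ereal_sup => _ [j _ <-].
  have -> : \int[nw]_(y in F k) (u_ j y `^ (p - 1)) =
      \int[nu]_(y in F k) ((w y)%:E * u_ j y `^ (p - 1)).
    rewrite integral_density//.
    + by apply: eq_integral => y _; rewrite muleC.
    + by apply: measurable_fun_poweR; exact: measurable_funTS.
    + by move=> y _; exact: poweR_ge0.
  rewrite n_avg nuF (muleC _ n%:E) -muleA; apply: lee_wpmul2l.
    by rewrite lee_fin ltW.
  apply: (le_trans (average_maximal _ _ Fkx)).
  set Y := maximal _ _ _ _.
  have Y0 : 0 <= Y by apply: maximal_ge0 => y; case: (goodw (good_u j)).
  (* The iterate [u_ j.+1] dominates [e dualM (u_ j)]; only afterwards is the supremum over [j]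
     taken, through the integral. *)
  have step1 : e%:E * ((w x)^-1%:E * Y) `^ r <= u x.
    apply: le_trans (u_u j.+1 x).
    have [M0 _] := good_M (good_u j).
    by rewrite u_stepE /step leeDr// adde_ge0// mule_ge0.
  have wY0 : 0 <= (w x)^-1%:E * Y by rewrite mule_ge0// lee_fin invr_ge0 ltW.
  have := gee0_ler_poweR p10 _ step1.
  rewrite mule_ge0 ?poweR_ge0 ?lee_fin// => /(_ isT).
  rewrite poweRM ?poweR_ge0 ?lee_fin// -poweRrM mulVf ?gt_eqF// poweRe1//.
  rewrite poweR_EFin => H.
  have ep0 : (0 < e `^ (p - 1))%R by rewrite powR_gt0.
  rewrite -(powR_inv1 e0) powRAC powR_inv1 ?powR_ge0//.
  rewrite lee_pdivlMl// -lee_pdivrMl//.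
  by rewrite muleCA.
Qed.

End Iteration.

Section FactorWeight.
Local Open Scope ereal_scope.
Context d (T : measurableType d) (R : realType).
Context (nu : {measure set T -> \bar R}) (F G : nat -> set T) (s : nat -> R).
Context (K p A : R) (w v : T -> R).

(** The previous results are used for [(w, v, p)] and for [(v, w, q)]. The weighted maximal
    inequality for one weight needs the doubling of the other, so both doublings come first. *)
Theorem muckenhoupt_supersolution :
  (forall k, measurable (F k)) -> (forall k, measurable (G k)) ->
  (forall i j, F i `&` F j !=set0 -> (s i <= s j)%R -> F i `<=` G j) ->
  (0 < K)%R -> (forall k, 0 < nu (F k)) -> (forall k, nu (G k) < +oo) ->
  (forall k, nu (G k) <= K%:E * nu (F k)) ->
  (1 < p)%R -> (0 < A)%R ->
  measurable_fun setT w -> measurable_fun setT v ->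
  (forall x, (0 < w x)%R) -> (forall x, (0 < v x)%R) ->
  (forall x, (w x * v x `^ (p - 1) = 1)%R) ->
  \int[nu]_x (w x)%:E < +oo -> \int[nu]_x (v x)%:E < +oo ->
  (forall k, (fine (\int[nu]_(x in G k) (w x)%:E) *
    fine (\int[nu]_(x in G k) (v x)%:E) `^ (p - 1) <=
    A * fine (nu (G k)) `^ p)%R) ->
  exists (u : T -> \bar R) (D : R),
  [/\ measurable_fun setT u, forall x, 1 <= u x, (0 <= D)%R,
      \int[nu]_x (u x `^ p * (w x)%:E) < +oo &
      forall k x, F k x ->
        \int[nu]_(y in F k) u y <= D%:E * nu (F k) * u x /\
        \int[nu]_(y in F k) ((w y)%:E * u y `^ (p - 1)) <=
          D%:E * nu (F k) * ((w x)%:E * u x `^ (p - 1))].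
Proof.
move=> mF mG engulf K0 nu0 nuy nuGF p1 A0 mw mv w0 v0 wv wint vint ap.
have p10 : (0 < p - 1)%R by rewrite subr_gt0.
have lty (g : T -> R) : (forall x, (0 < g x)%R) -> measurable_fun setT g ->
    \int[nu]_x (g x)%:E < +oo ->
    forall k, \int[nu]_(x in G k) (g x)%:E < +oo.
  move=> g0 mg gint k; apply: le_lt_trans gint.
  apply: ge0_subset_integral => //; first exact/measurable_EFinP.
  by move=> x _; rewrite lee_fin ltW.
have wlty := lty _ w0 mw wint; have vlty := lty _ v0 mv vint.
pose q := (p / (p - 1))%R.
have q1 : (1 < q)%R by rewrite /q ltr_pdivlMr// mul1r gtrBl.
have q1E : (q - 1 = (p - 1)^-1)%R by rewrite /q; field; rewrite gt_eqF.
have qq : (q / (q - 1) = p)%R by rewrite q1E invrK /q divfK// gt_eqF.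
have vw := dual_weight p1 w0 v0 wv.
have nwd := weight_doubling (w_gt0 := w0) (v_gt0 := v0) (mw := mw) (mv := mv) mF mG engulf K0 nu0 nuy
  nuGF p1 wv
  wlty vlty A0 ap.
have apd := dual_ap (w_gt0 := w0) (v_gt0 := v0) (mw := mw) (mv := mv) p1 A0 ap.
have A0' := powR_gt0 (p - 1)^-1%R A0.
have nvd := weight_doubling (w_gt0 := v0) (v_gt0 := w0) (mw := mv) (mv := mw) mF mG engulf K0 nu0 nuy
  nuGF q1 vw
  vlty wlty A0' apd.
have K20 : (0 < 2 * K)%R by rewrite mulr_gt0.
have L1 : (0 < A * (2 * K) `^ p)%R by rewrite mulr_gt0// powR_gt0.
have L2 : (0 < A `^ (p - 1)^-1 * (2 * K) `^ q)%R by rewrite mulr_gt0// powR_gt0.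
have [C1 C10 H1] := weighted_maximal_inequality (w_gt0 := w0) (v_gt0 := v0) (mw := mw) (mv := mv)
  mF mG engulf K0 nu0 nuy nuGF p1 wv wlty vlty A0 ap L2 nvd.
have [C2 C20 H2] := weighted_maximal_inequality (w_gt0 := v0) (v_gt0 := w0) (mw := mv) (mv := mw)
  mF mG engulf K0 nu0 nuy nuGF q1 vw vlty wlty A0' apd L1 nwd.
have nuFy k : nu (F k) < +oo.
  apply: le_lt_trans (nuy k); apply: le_measure; rewrite ?inE//.
  apply: engulf => //; rewrite setIid; apply/set0P/eqP => F0.
  by have := nu0 k; rewrite F0 measure0 ltxx.
have C0 : (0 < C1 + C2)%R by rewrite addr_gt0.
apply: (exists_supersolution mF nu0 nuFy p1 C0 w0 v0 mw wv _ _ wint).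
- move=> f f0 mf; apply: (le_trans (H1 f f0 mf)); apply: lee_wpmul2r.
    by apply: integral_ge0 => x _; rewrite mule_ge0 ?poweR_ge0 ?lee_fin ?ltW.
  by rewrite lee_fin lerDl ltW.
- move=> f f0 mf; apply: (le_trans (H2 f f0 mf)); apply: lee_wpmul2r.
    by apply: integral_ge0 => x _; rewrite mule_ge0 ?poweR_ge0 ?lee_fin ?ltW.
  by rewrite lee_fin lerDr ltW.
Qed.

End FactorWeight.

(** * Geometry of the pseudo-distance *)

Section LebesgueCn.
Context (R : realType) (n : nat).
Local Notation C := (Cn R n).
Implicit Types (z : C) (t : R).

Lemma measurable_re (j : 'I_n) : measurable_fun setT (fun z : C => re z j).
Proof. exact: (measurableT_comp measurable_fst (measurable_tnth j)). Qed.

Lemma measurable_im (j : 'I_n) : measurable_fun setT (fun z : C => im z j).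
Proof. exact: (measurableT_comp measurable_snd (measurable_tnth j)). Qed.

Definition box (a b c d : 'I_n -> R) : set C :=
  [set z | forall j, `[a j, b j[%classic (re z j) /\ `[c j, d j[%classic (im z j)].

Definition boxes : set (set C) :=
  [set A | exists a b c d, A = box a b c d].

Lemma Cn_bounded z : exists k : nat, forall j,
  (- k%:R <= re z j < k%:R) && (- k%:R <= im z j < k%:R).
Proof.
exists (Num.truncn (\sum_j (`|re z j| + `|im z j|))).+1 => j.
set S := \sum_j _; set k := (Num.truncn S).+1.
have Sk : S < k%:R by exact: truncnS_gt.
have jS : `|re z j| + `|im z j| <= S.
  rewrite /S (bigD1 j)//= lerDl sumr_ge0// => i _; exact: addr_ge0.
have r0 := normr_ge0 (re z j); have i0 := normr_ge0 (im z j).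
have rk : `|re z j| < k%:R by lra.
have ik : `|im z j| < k%:R by lra.
move: rk ik; rewrite !ltr_norml => /andP[r1 r2] /andP[i1 i2].
by rewrite r2 i2 !ltW.
Qed.

Lemma boxes_setI : setI_closed boxes.
Proof.
move=> _ _ [a [b [c [d ->]]]] [a' [b' [c' [d' ->]]]].
exists (fun j => Num.max (a j) (a' j)), (fun j => Num.min (b j) (b' j)),
  (fun j => Num.max (c j) (c' j)), (fun j => Num.min (d j) (d' j)).
apply/seteqP; split=> z.
  move=> [z1 z2] j; have [] := z1 j; have [] := z2 j.
  rewrite /= !in_itv/= => /andP[h1 h2] /andP[h3 h4] /andP[h5 h6] /andP[h7 h8].
  by rewrite !ge_max !lt_min h1 h2 h3 h4 h5 h6 h7 h8.
move=> H; split=> j; have := H j; rewrite /= !in_itv/= !ge_max !lt_min;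
  move=> [/andP[/andP[h1 h2] /andP[h3 h4]] /andP[/andP[h5 h6] /andP[h7 h8]]];
  by rewrite ?h1 ?h2 ?h3 ?h4 ?h5 ?h6 ?h7 ?h8.
Qed.

Definition big_box (k : nat) : set C :=
  box (fun=> - k%:R) (fun=> k%:R) (fun=> - k%:R) (fun=> k%:R).

Lemma bigcup_big_box : \bigcup_k big_box k = setT.
Proof.
apply/seteqP; split=> // z _; have [k kz] := Cn_bounded z.
by exists k => // j; move: (kz j) => /andP[rz iz]; rewrite /= !in_itv.
Qed.

Lemma measurable_box a b c d : measurable (box a b c d).
Proof.
rewrite (_ : box a b c d = \bigcap_(j in [set: 'I_n])
    ((fun z => re z j) @^-1` `[a j, b j[%classic `&`
     (fun z => im z j) @^-1` `[c j, d j[%classic)).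
  apply: fin_bigcap_measurable => // j _; apply: measurableI.
    by rewrite -[X in measurable X]setTI; apply: measurable_re.
  by rewrite -[X in measurable X]setTI; apply: measurable_im.
apply/seteqP; split=> z; first by move=> H j _; exact: H.
by move=> H j; apply: H.
Qed.

(** [is_lebesgue_Cn] prescribes [mu] on boxes only, and uniqueness of measures extends that
    information once boxes are known to generate. It suffices that the coordinates are measurable
    for the generated sigma-algebra. *)
Lemma measurable_Cn_boxes : (measurable : set (set C)) = <<s boxes >>.
Proof.
apply/seteqP; split; last first.
  apply: smallest_sub; first exact: sigma_algebra_measurable.
  by move=> _ [a [b [c [d ->]]]]; exact: measurable_box.
pose GT := g_sigma_algebraType boxes.
have mbox a b c d : (measurable : set (set GT)) (box a b c d).
  by apply: sub_sigma_algebra; exists a, b, c, d.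
have coord (f : C -> R) : (forall x : R, (measurable : set (set GT)) [set z | x <= f z]) ->
    measurable_fun (setT : set GT) (f : GT -> R).
  move=> H; apply: (measurability _ (RGenCInfty.measurableE R)) => _ [_ [x ->] <-].
  rewrite setTI; have := H x; congr (measurable _).
  by apply/seteqP; split => z /=; rewrite in_itv/= andbT.
have mre (j : 'I_n) : measurable_fun (setT : set GT) ((fun z => re z j) : GT -> R).
  apply: coord => x.
  (* A half-space is a countable union of boxes whose other sides grow. *)
  rewrite (_ : [set z | _] = \bigcup_k (box
    (fun i => if i == j then x else - k%:R) (fun=> k%:R) (fun=> - k%:R) (fun=> k%:R))).
    by apply: bigcup_measurable.
  apply/seteqP; split => z /=.
    move=> xz; have [k kz] := Cn_bounded z; exists k => // i.
    rewrite /= !in_itv/=; have /andP[/andP[h1 h2] /andP[h3 h4]] := kz i.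
    by rewrite h2 h3 h4 andbT; split => //; case: eqP => [->|].
  by move=> [k _ /(_ j)[]]; rewrite /= in_itv/= eqxx => /andP[].
have mim (j : 'I_n) : measurable_fun (setT : set GT) ((fun z => im z j) : GT -> R).
  apply: coord => x.
  rewrite (_ : [set z | _] = \bigcup_k (box
    (fun=> - k%:R) (fun=> k%:R) (fun i => if i == j then x else - k%:R) (fun=> k%:R))).
    by apply: bigcup_measurable.
  apply/seteqP; split => z /=.
    move=> xz; have [k kz] := Cn_bounded z; exists k => // i.
    rewrite /= !in_itv/=; have /andP[/andP[h1 h2] /andP[h3 h4]] := kz i.
    by rewrite h1 h2 h4 !andbT; split => //; case: eqP => [->|].
  by move=> [k _ /(_ j)[]]; rewrite /= !in_itv/= eqxx => _ /andP[].
have mt (j : 'I_n) :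
    measurable_fun (setT : set GT) ((fun z => tnth z j) : GT -> R * R).
  rewrite (_ : (fun z : GT => _) = (fun z : GT => (re z j, im z j))).
    exact: measurable_fun_pair.
  by apply/funext => z; rewrite /re /im -surjective_pairing.
apply: smallest_sub; first exact: (@sigma_algebra_measurable _ GT).
rewrite -bigcup_seq; apply: bigcup_sub => j _ _ [B mB <-].
exact: mt.
Qed.

Definition affine (c : C) (t : R) (z : C) : C :=
  [tuple (re c j + t * re z j, im c j + t * im z j) | j < n].

Lemma re_affine c t z j : re (affine c t z) j = re c j + t * re z j.
Proof. by rewrite /re tnth_mktuple. Qed.

Lemma im_affine c t z j : im (affine c t z) j = im c j + t * im z j.
Proof. by rewrite /im tnth_mktuple. Qed.

Lemma measurable_affine c t : measurable_fun setT (affine c t).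
Proof.
apply/measurable_fun_tnthP => j.
rewrite (_ : _ \o _ = fun z => (re c j + t * re z j, im c j + t * im z j)).
  apply: measurable_fun_pair; apply: measurable_funD => //;
    apply: measurable_funM => //; [exact: measurable_re|exact: measurable_im].
by apply/funext => z /=; rewrite tnth_mktuple.
Qed.

Context (mu : {measure set C -> \bar R}).
Hypothesis mu_leb : is_lebesgue_Cn mu.

Lemma mu_box a b c d : mu (box a b c d) =
  (\prod_(j < n) (lebesgue_measure `[a j, b j[%classic *
                  lebesgue_measure `[c j, d j[%classic))%E.
Proof. exact: mu_leb. Qed.

Lemma lebesgue_itv_co (a b : R) :
  lebesgue_measure (`[a, b[%classic : set R) = (Num.max 0 (b - a))%:E.
Proof.
rewrite lebesgue_measure_itv/= lte_fin; case: ltP => ab.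
  by rewrite max_r// subr_ge0 ltW.
by rewrite max_l// subr_le0.
Qed.

Lemma mu_big_box_lty k : (mu (big_box k) < +oo)%E.
Proof.
rewrite mu_box; under eq_bigr do rewrite !lebesgue_itv_co -EFinM.
by rewrite prodEFin ltry.
Qed.

(** Both sides are measures in [A]; they agree on boxes, a generating family stable under
    intersection, and are finite on the exhausting boxes [big_box k]. *)
Lemma mu_affine c t A : 0 < t -> measurable A ->
  mu A = ((t ^+ (2 * n))%:E * mu (affine c t @^-1` A))%E.
Proof.
move=> t0 mA.
have t2n : 0 <= t ^+ (2 * n) by rewrite exprn_ge0// ltW.
have [m2 m2E] : exists m2 : {measure set C -> \bar R},
    forall A, m2 A = ((t ^+ (2 * n))%:E * mu (affine c t @^-1` A))%E.
  have mf := measurable_affine c t.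
  unshelve (eexists (mscale (NngNum t2n) (pushforward mu (affine c t)))).
    exact: mf.
  by [].
rewrite -m2E.
apply: (measure_unique boxes big_box) => //.
- exact: measurable_Cn_boxes.
- exact: boxes_setI.
- by move=> k; do 4 eexists.
- exact: bigcup_big_box.
- move=> _ [a [b [e [d ->]]]]; rewrite m2E.
  have -> : affine c t @^-1` (box a b e d) =
      box (fun j => (a j - re c j) / t) (fun j => (b j - re c j) / t)
          (fun j => (e j - im c j) / t) (fun j => (d j - im c j) / t).
    apply/seteqP; split => z H j; have := H j; rewrite /= re_affine im_affine;
      rewrite !in_itv/= !ler_pdivrMr// !ltr_pdivlMr//;
      rewrite ![_ * t]mulrC !lerBlDl !ltrBrDl//.
  rewrite !mu_box exprM -[X in _ ^+ X](card_ord n) -prodr_const -prodEFin -big_split/=.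
  apply: eq_bigr => j _; rewrite !lebesgue_itv_co -!EFinM; congr _%:E.
  have maxt (x y : R) r : Num.max 0 (x - y) = t * Num.max 0 ((x - r) / t - (y - r) / t).
    rewrite maxr_pMr ?ltW// mulr0; congr Num.max; field; by rewrite gt_eqF.
  by rewrite (maxt (b j) _ (re c j)) (maxt (d j) _ (im c j)); ring.
- by move=> k; exact: mu_big_box_lty.
Qed.

End LebesgueCn.

(** * Absolute value of a complex number given by its real and imaginary parts *)

Section Modulus.
Context (R : realType).
Implicit Types a b c d : R.

Definition modulus a b : R := Num.sqrt (a ^+ 2 + b ^+ 2).

Lemma modulus_ge0 a b : 0 <= modulus a b. Proof. exact: sqrtr_ge0. Qed.

Lemma sqr_modulus a b : modulus a b ^+ 2 = a ^+ 2 + b ^+ 2.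
Proof. by rewrite sqr_sqrtr// addr_ge0 ?sqr_ge0. Qed.

Lemma le_modulusl a b : `|a| <= modulus a b.
Proof.
by rewrite -sqrtr_sqr ler_wsqrtr// lerDl sqr_ge0.
Qed.

Lemma le_modulusr a b : `|b| <= modulus a b.
Proof. by rewrite -sqrtr_sqr ler_wsqrtr// lerDr sqr_ge0. Qed.

Lemma modulus_le a b c : 0 <= c -> a ^+ 2 + b ^+ 2 <= c ^+ 2 -> modulus a b <= c.
Proof. by move=> c0 H; rewrite -(ger0_norm c0) -sqrtr_sqr ler_wsqrtr. Qed.

Lemma modulusD a b c d : modulus (a + c) (b + d) <= modulus a b + modulus c d.
Proof.
apply: modulus_le; first by rewrite addr_ge0 ?modulus_ge0.
rewrite !sqrrD !sqr_modulus.
have : a * c + b * d <= modulus a b * modulus c d.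
  rewrite /modulus -sqrtrM ?addr_ge0 ?sqr_ge0//.
  apply: le_trans (ler_norm _) _; rewrite -sqrtr_sqr ler_wsqrtr//.
  (* Lagrange's identity, whence the Cauchy-Schwarz inequality in the plane. *)
  rewrite -subr_ge0 (_ : _ - _ = (a * d - b * c) ^+ 2); first exact: sqr_ge0.
  by ring.
by move=> H; lra.
Qed.

Lemma modulusM a b c : 0 <= c -> modulus (c * a) (c * b) = c * modulus a b.
Proof.
move=> c0; rewrite /modulus !exprMn -mulrDr sqrtrM ?sqr_ge0//.
by rewrite sqrtr_sqr ger0_norm.
Qed.

Lemma modulus_le_add a b : modulus a b <= `|a| + `|b|.
Proof.
apply: modulus_le; first exact: addr_ge0.
rewrite sqrrD !real_normK ?num_real//.
have := mulr_ge0 (normr_ge0 a) (normr_ge0 b); lra.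
Qed.

Lemma modulusN a b : modulus (- a) (- b) = modulus a b.
Proof. by rewrite /modulus !sqrrN. Qed.

Lemma modulusNr a b : modulus a (- b) = modulus a b.
Proof. by rewrite /modulus sqrrN. Qed.

End Modulus.

(** * Hermitian product, angle, and the quasi-triangle inequality *)

Section Geometry.
Context (R : realType) (n : nat).
Local Notation C := (Cn R n).
Implicit Types x y z : C.

Lemma cnorm_ge0 z : 0 <= cnorm z. Proof. exact: sqrtr_ge0. Qed.

Lemma sqr_cnorm z : cnorm z ^+ 2 = cinner_re z z.
Proof.
rewrite sqr_sqrtr; last by apply: sumr_ge0 => j _; rewrite addr_ge0 ?sqr_ge0.
by apply: eq_bigr => j _; rewrite !expr2.
Qed.

Lemma cinner_re_sym x y : cinner_re x y = cinner_re y x.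
Proof. by apply: eq_bigr => j _; ring. Qed.

Lemma cinner_im_sym x y : cinner_im x y = - cinner_im y x.
Proof. by rewrite /cinner_im -sumrN; apply: eq_bigr => j _; ring. Qed.

Lemma cinner_im_self x : cinner_im x x = 0.
Proof. by apply: big1 => j _; ring. Qed.

Lemma cinner_re_affine c t x y :
  cinner_re (affine c t x) y = cinner_re c y + t * cinner_re x y.
Proof.
rewrite /cinner_re mulr_sumr -big_split/=; apply: eq_bigr => j _.
by rewrite re_affine im_affine; ring.
Qed.

Lemma cinner_im_affine c t x y :
  cinner_im (affine c t x) y = cinner_im c y + t * cinner_im x y.
Proof.
rewrite /cinner_im mulr_sumr -big_split/=; apply: eq_bigr => j _.
by rewrite re_affine im_affine; ring.
Qed.

Lemma cinner_re_affiner c t x y :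
  cinner_re y (affine c t x) = cinner_re y c + t * cinner_re y x.
Proof. by rewrite cinner_re_sym cinner_re_affine !(cinner_re_sym _ y). Qed.

Lemma cinner_im_affiner c t x y :
  cinner_im y (affine c t x) = cinner_im y c + t * cinner_im y x.
Proof.
by rewrite cinner_im_sym cinner_im_affine !(cinner_im_sym _ y); ring.
Qed.

Lemma sqr_cnorm_affine c t x : cnorm (affine c t x) ^+ 2 =
  cnorm c ^+ 2 + 2 * t * cinner_re c x + t ^+ 2 * cnorm x ^+ 2.
Proof.
rewrite !sqr_cnorm cinner_re_affine !cinner_re_affiner (cinner_re_sym x c).
by ring.
Qed.

Definition czero : C := [tuple (0, 0) | j < n].

Lemma re0 j : re czero j = 0. Proof. by rewrite /re tnth_mktuple. Qed.
Lemma im0 j : im czero j = 0. Proof. by rewrite /im tnth_mktuple. Qed.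

Lemma cinner_re0 y : cinner_re czero y = 0.
Proof. by apply: big1 => j _; rewrite re0 im0; ring. Qed.

Lemma cinner_im0 y : cinner_im czero y = 0.
Proof. by apply: big1 => j _; rewrite re0 im0; ring. Qed.

Lemma cnorm0 : cnorm czero = 0.
Proof. by apply/eqP; rewrite -sqrf_eq0 sqr_cnorm cinner_re0. Qed.

Lemma re_le_cnorm z j : `|re z j| <= cnorm z /\ `|im z j| <= cnorm z.
Proof.
have H : re z j ^+ 2 + im z j ^+ 2 <= \sum_(j < n) (re z j ^+ 2 + im z j ^+ 2).
  rewrite (bigD1 j)//= lerDl; apply: sumr_ge0 => i _.
  by rewrite addr_ge0 ?sqr_ge0.
have r0 := sqr_ge0 (re z j); have i0 := sqr_ge0 (im z j).
by split; rewrite -sqrtr_sqr ler_wsqrtr//; lra.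
Qed.

Lemma cnorm_eq0 z : cnorm z = 0 -> z = czero.
Proof.
move=> z0; apply: eq_from_tnth => j; have [] := re_le_cnorm z j.
rewrite z0 !normr_le0 tnth_mktuple => /eqP r0 /eqP i0.
by rewrite [LHS]surjective_pairing -/(re z j) -/(im z j) r0 i0.
Qed.

(** Cauchy-Schwarz: expand the square of the norm of [|y|^2 x - <x, y> y], which is nonnegative, and
    divide by [|y|^2]. *)
Lemma modulus_cinner_le x y :
  modulus (cinner_re x y) (cinner_im x y) <= cnorm x * cnorm y.
Proof.
apply: modulus_le; first by rewrite mulr_ge0 ?cnorm_ge0.
rewrite exprMn; set a := cinner_re x y; set b := cinner_im x y.
have [y0|y0] := eqVneq (cnorm y) 0.
  have yE := cnorm_eq0 y0.
  rewrite /a /b cinner_re_sym cinner_im_sym yE cinner_re0 cinner_im0.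
  by rewrite cnorm0; lra.
set N := cnorm y ^+ 2.
have N0 : 0 < N by rewrite exprn_gt0// lt_neqAle eq_sym y0 cnorm_ge0.
have : 0 <= \sum_(j < n) ((N * re x j - (a * re y j - b * im y j)) ^+ 2 +
                         (N * im x j - (a * im y j + b * re y j)) ^+ 2).
  by apply: sumr_ge0 => j _; rewrite addr_ge0 ?sqr_ge0.
have -> : \sum_(j < n) ((N * re x j - (a * re y j - b * im y j)) ^+ 2 +
                         (N * im x j - (a * im y j + b * re y j)) ^+ 2) =
  N ^+ 2 * cnorm x ^+ 2 - 2 * N * (a * a + b * b) + (a ^+ 2 + b ^+ 2) * N.
  rewrite (eq_bigr (fun j => N ^+ 2 * (re x j * re x j + im x j * im x j) -
    2 * N * (a * (re x j * re y j + im x j * im y j) +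
             b * (im x j * re y j - re x j * im y j)) +
    (a ^+ 2 + b ^+ 2) * (re y j * re y j + im y j * im y j))); last first.
    by move=> j _; ring.
  rewrite big_split/= sumrB -!mulr_sumr /N !sqr_cnorm -sqr_cnorm.
  congr (_ - _ * _ + _); last by rewrite sqr_cnorm.
  rewrite {1}/a {2}/a {2}/b /cinner_re /cinner_im.
  by rewrite big_split/= -!mulr_sumr.
move=> H; rewrite -(ler_pM2l N0) -subr_ge0; apply: (le_trans H).
by rewrite le_eqVlt; apply/orP; left; apply/eqP; ring.
Qed.

Definition csub x y := affine x (-1) y.

Lemma cnorm_sub_le x y : `|cnorm x - cnorm y| <= cnorm (csub x y).
Proof.
rewrite -(ger0_norm (cnorm_ge0 (csub x y))) -!sqrtr_sqr ler_wsqrtr//.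
rewrite sqr_cnorm_affine sqrrB.
have := le_trans (le_trans (ler_norm _) (le_modulusl _ _)) (modulus_cinner_le x y).
lra.
Qed.

Lemma pdist0r z : pdist z czero = cnorm z.
Proof. by rewrite /pdist cnorm0 eqxx andbF addr0. Qed.

Definition angle x y : R :=
  modulus (1 - cinner_re x y / (cnorm x * cnorm y))
          (cinner_im x y / (cnorm x * cnorm y)).

Lemma angle_ge0 x y : 0 <= angle x y. Proof. exact: modulus_ge0. Qed.

Lemma pdistE x y : cnorm x != 0 -> cnorm y != 0 ->
  pdist x y = `|cnorm x - cnorm y| + angle x y.
Proof. by move=> x0 y0; rewrite /pdist x0 y0. Qed.

Lemma angle_sym x y : angle x y = angle y x.
Proof.
rewrite /angle cinner_re_sym cinner_im_sym (mulrC (cnorm x)) mulNr.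
by rewrite modulusNr.
Qed.

Lemma pdist_sym x y : pdist x y = pdist y x.
Proof.
have [x0|x0] := eqVneq (cnorm x) 0.
  by rewrite /pdist x0 eqxx andbF/= addrC.
have [y0|y0] := eqVneq (cnorm y) 0.
  by rewrite /pdist y0 eqxx andbF/= addrC.
by rewrite !pdistE// distrC angle_sym.
Qed.

Lemma cnorm_scale c x : 0 <= c -> cnorm (affine czero c x) = c * cnorm x.
Proof.
move=> c0; apply/eqP; rewrite -(eqrXn2 (n := 2))// ?mulr_ge0 ?cnorm_ge0//.
by rewrite sqr_cnorm_affine cnorm0 cinner_re0 exprMn; apply/eqP; ring.
Qed.

Lemma angle_scale c x y : 0 < c -> angle x (affine czero c y) = angle x y.
Proof.
move=> c0; rewrite /angle cinner_re_affiner cinner_im_affiner.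
rewrite (cinner_re_sym x) (cinner_im_sym x) cinner_re0 cinner_im0.
rewrite cnorm_scale ?ltW// oppr0 !add0r.
have H a : c * a / (cnorm x * (c * cnorm y)) = a / (cnorm x * cnorm y).
  by rewrite mulrCA -mulf_div divff ?mul1r// gt_eqF.
by rewrite !H.
Qed.

(* For unit vectors,
   [1 - <a, c> = (1 - <a, b>) + (1 - <b, c>) + <a - b, b - c>]
   and [|a - b|^2 = 2 - 2 Re <a, b> <= 2 |1 - <a, b>|]. *)
Lemma angle_quasi_triangle_unit a b c :
  cnorm a = 1 -> cnorm b = 1 -> cnorm c = 1 ->
  angle a c <= 2 * (angle a b + angle b c).
Proof.
move=> a1 b1 c1; rewrite /angle a1 b1 c1 mulr1 !divr1.
have sub_le x y : cnorm x = 1 -> cnorm y = 1 ->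
    cnorm (csub x y) ^+ 2 <= 2 * modulus (1 - cinner_re x y) (cinner_im x y).
  move=> x1 y1; rewrite sqr_cnorm_affine x1 y1 !expr1n.
  have := le_trans (ler_norm _) (le_modulusl (1 - cinner_re x y) (cinner_im x y)).
  lra.
have ab := sub_le a b a1 b1; have bc := sub_le b c b1 c1.
have -> : 1 - cinner_re a c = ((1 - cinner_re a b) + (1 - cinner_re b c)) +
    cinner_re (csub a b) (csub b c).
  rewrite cinner_re_affine !cinner_re_affiner -!sqr_cnorm b1; ring.
have -> : cinner_im a c = (cinner_im a b + cinner_im b c) -
    cinner_im (csub a b) (csub b c).
  rewrite cinner_im_affine !cinner_im_affiner cinner_im_self; ring.
apply: (le_trans (modulusD _ _ _ _)); rewrite modulusNr.
apply: (le_trans (lerD (modulusD _ _ _ _) (modulus_cinner_le _ _))).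
move: ab bc; set A := modulus _ _; set B := modulus _ _.
move: (cnorm_ge0 (csub a b)) (cnorm_ge0 (csub b c)).
move: (cnorm (csub a b)) (cnorm (csub b c)) => X Y X0 Y0 XA YB.
have := sqr_ge0 (X - Y); rewrite sqrrB; lra.
Qed.

Lemma angle_quasi_triangle x y z :
  cnorm x != 0 -> cnorm y != 0 -> cnorm z != 0 ->
  angle x z <= 2 * (angle x y + angle y z).
Proof.
move=> x0 y0 z0.
have inv_gt0 (u : C) : cnorm u != 0 -> 0 < (cnorm u)^-1.
  by move=> u0; rewrite invr_gt0 lt_neqAle eq_sym u0 cnorm_ge0.
pose u (v : C) := affine czero (cnorm v)^-1 v.
have u1 v : cnorm v != 0 -> cnorm (u v) = 1.
  by move=> v0; rewrite cnorm_scale ?(ltW (inv_gt0 _ v0))// mulVf.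
have au a b : cnorm a != 0 -> cnorm b != 0 -> angle (u a) (u b) = angle a b.
  move=> a0 b0; rewrite angle_scale ?inv_gt0// angle_sym angle_scale ?inv_gt0//.
  exact: angle_sym.
rewrite -(au x z)// -(au x y)// -(au y z)//.
by apply: angle_quasi_triangle_unit; exact: u1.
Qed.

Lemma pdist_quasi_triangle x y z :
  cnorm x != 0 -> cnorm y != 0 -> cnorm z != 0 ->
  pdist x z <= 2 * (pdist x y + pdist y z).
Proof.
move=> x0 y0 z0; rewrite !pdistE//.
have H1 := angle_quasi_triangle x0 y0 z0.
have H2 := ler_distD (cnorm y) (cnorm x) (cnorm z).
have := normr_ge0 (cnorm x - cnorm y); have := normr_ge0 (cnorm y - cnorm z).
lra.
Qed.

Lemma angle_le2 x y : angle x y <= 2.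
Proof.
rewrite /angle; set q := cnorm x * cnorm y.
have q0 : 0 <= q by rewrite mulr_ge0 ?cnorm_ge0.
have -> : modulus (1 - cinner_re x y / q) (cinner_im x y / q) =
    modulus (1 + - (q^-1 * cinner_re x y)) (0 + - (q^-1 * - cinner_im x y)).
  by congr modulus; ring.
apply: (le_trans (modulusD _ _ _ _)).
rewrite modulusN modulusM ?invr_ge0// modulusNr.
have -> : modulus 1 0 = 1 :> R by rewrite /modulus expr0n addr0 expr1n sqrtr1.
have : q^-1 * modulus (cinner_re x y) (cinner_im x y) <= 1.
  have [->|qn] := eqVneq q 0; first by rewrite invr0 mul0r.
  have qp : 0 < q by rewrite lt_neqAle eq_sym qn.
  by rewrite ler_pdivrMl// mulr1; exact: modulus_cinner_le.
lra.
Qed.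

(** From [|x| |y| - <x, y> = |x| (|y| - |x|) + <x, x - y>], whose two terms are each at most
    [|x| |x - y|]. It allows centres to be moved to rational points. *)
Lemma pdist_near x y : cnorm x != 0 -> cnorm y != 0 ->
  pdist x y <= (1 + 2 / cnorm y) * cnorm (csub x y).
Proof.
move=> x0 y0.
have X0 : 0 < cnorm x by rewrite lt_neqAle eq_sym x0 cnorm_ge0.
have Y0 : 0 < cnorm y by rewrite lt_neqAle eq_sym y0 cnorm_ge0.
rewrite pdistE// mulrDl mul1r lerD ?cnorm_sub_le//.
rewrite /angle; set X := cnorm x; set Y := cnorm y.
have -> : modulus (1 - cinner_re x y / (X * Y)) (cinner_im x y / (X * Y)) =
   modulus ((X * Y)^-1 * (X * (Y - X) + cinner_re x (csub x y)))
           ((X * Y)^-1 * (0 - cinner_im x (csub x y))).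
  rewrite cinner_re_affiner cinner_im_affiner -sqr_cnorm cinner_im_self -/X.
  by congr modulus; field; rewrite x0 y0.
rewrite modulusM; last by rewrite invr_ge0 mulr_ge0 ?ltW.
rewrite ler_pdivrMl ?mulr_gt0//.
have -> : X * Y * (2 / Y * cnorm (csub x y)) = X * cnorm (csub x y) + X * cnorm (csub x y).
  by field.
apply: (le_trans (modulusD _ _ _ _)); rewrite modulusNr lerD//; last first.
  exact: modulus_cinner_le.
rewrite /modulus expr0n addr0 sqrtr_sqr normrM gtr0_norm// ler_pM2l// distrC.
exact: cnorm_sub_le.
Qed.

Lemma measurable_fun_sqrt d (T : measurableType d) (f : T -> R) :
  measurable_fun setT f -> measurable_fun setT (fun t : T => Num.sqrt (f t)).
Proof.
move=> mf; apply: (measurableT_comp _ mf).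
by apply: continuous_measurable_fun; exact: sqrt_continuous.
Qed.

Lemma measurable_cnorm : measurable_fun setT (@cnorm R n).
Proof.
apply: measurable_fun_sqrt; apply: measurable_sum => j.
by apply: measurable_funD; apply: measurable_funX;
  [exact: measurable_re|exact: measurable_im].
Qed.

Lemma measurable_cinner_re z : measurable_fun setT (cinner_re z).
Proof.
apply: measurable_sum => j; apply: measurable_funD; apply: measurable_funM => //;
  [exact: measurable_re|exact: measurable_im].
Qed.

Lemma measurable_cinner_im z : measurable_fun setT (cinner_im z).
Proof.
apply: measurable_sum => j; apply: measurable_funB; apply: measurable_funM => //;
  [exact: measurable_re|exact: measurable_im].
Qed.

Lemma measurable_angle z : measurable_fun setT (angle z).
Proof.
have mq : measurable_fun setT (fun y : C => (cnorm z * cnorm y)^-1).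
  apply: measurable_funV_ge0; first by move=> y; rewrite mulr_ge0 ?cnorm_ge0.
  by apply: measurable_funM => //; exact: measurable_cnorm.
apply: measurable_fun_sqrt; apply: measurable_funD; apply: measurable_funX.
  apply: measurable_funB => //; apply: measurable_funM => //.
  exact: measurable_cinner_re.
by apply: measurable_funM => //; exact: measurable_cinner_im.
Qed.

Lemma measurable_set0C : measurable [set czero].
Proof.
rewrite (_ : [set czero] = (@cnorm R n) @^-1` [set 0]).
  by rewrite -[X in measurable X]setTI; exact: measurable_cnorm.
by apply/seteqP; split => [z ->|z /cnorm_eq0 ->//] /=; rewrite cnorm0.
Qed.

Lemma measurable_cnorm_lt r : measurable [set z : C | cnorm z < r].
Proof.
rewrite (_ : [set _ | _] = (@cnorm R n) @^-1` `]-oo, r[%classic).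
  by rewrite -[X in measurable X]setTI; exact: measurable_cnorm.
by apply/seteqP; split => z /=; rewrite in_itv.
Qed.

Lemma measurable_unit_ball : measurable (@unit_ball R n).
Proof. exact: measurable_cnorm_lt. Qed.

Lemma measurable_pdist z : measurable_fun setT (pdist z).
Proof.
have [z0|z0] := eqVneq (cnorm z) 0.
  rewrite (_ : pdist z = fun y => cnorm z + cnorm y).
    by apply: measurable_funD => //; exact: measurable_cnorm.
  by apply/funext => y; rewrite /pdist z0 eqxx.
rewrite (_ : pdist z = fun y => if cnorm y == 0 then cnorm z
    else `|cnorm z - cnorm y| + angle z y).
  apply: measurable_fun_ifT => //.
  - by apply: measurable_fun_eqr => //; exact: measurable_cnorm.
  - apply: measurable_funD; last exact: measurable_angle.
    by apply: measurableT_comp => //; apply: measurable_funB => //; exact: measurable_cnorm.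
apply/funext => y; case: ifPn => [/eqP/cnorm_eq0 ->|y0].
  exact: pdist0r.
exact: pdistE.
Qed.

Lemma measurable_pball z r : measurable (pball z r).
Proof.
rewrite (_ : pball z r = (@unit_ball R n) `&` pdist z @^-1` `]-oo, r[%classic).
  apply: measurableI; first exact: measurable_unit_ball.
  by rewrite -[X in measurable X]setTI; exact: measurable_pdist.
by apply/seteqP; split => y /=; rewrite /pball/= in_itv.
Qed.

End Geometry.

(** * Volume of cones and shells *)

Section Volume.
Context (R : realType) (n : nat).
Hypothesis n_gt0 : (0 < n)%N.
Local Notation C := (Cn R n).
Context (mu : {measure set C -> \bar R}).
Hypothesis mu_leb : is_lebesgue_Cn mu.
Implicit Types (y z : C) (r s : R).

Lemma mu_unit_ball_lty : (mu (@unit_ball R n) < +oo)%E.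
Proof.
apply: le_lt_trans (mu_big_box_lty mu_leb 1); apply: le_measure.
- by rewrite inE; exact: measurable_unit_ball.
- by rewrite inE; exact: measurable_box.
move=> z z1 j; have [rz iz] := re_le_cnorm z j; rewrite /= !in_itv/=.
have {}rz := le_lt_trans rz z1; have {}iz := le_lt_trans iz z1.
move: rz iz; rewrite !ltr_norml => /andP[r1 r2] /andP[i1 i2].
by rewrite r2 i2 !ltW.
Qed.

(** The origin is fixed by dilations, so its finite mass [x] satisfies [x = 2^(2n) x]. *)
Lemma mu_czero : mu [set czero R n] = 0%E.
Proof.
have := mu_affine mu_leb (czero R n) (ltr0n R 2) (@measurable_set0C R n).
rewrite (_ : affine _ _ @^-1` _ = [set czero R n]); last first.
  apply/seteqP; split => z /=; last first.
    move=> ->; apply: cnorm_eq0; rewrite cnorm_scale// cnorm0 mulr0//.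
  move=> z0; apply: cnorm_eq0; have : cnorm (affine (czero R n) 2 z) = 0.
    by rewrite z0 cnorm0.
  by rewrite cnorm_scale// => /eqP; rewrite mulf_eq0 pnatr_eq0/= => /eqP.
have f : mu [set czero R n] \is a fin_num.
  rewrite ge0_fin_numE//; apply: le_lt_trans mu_unit_ball_lty.
  apply: le_measure; rewrite ?inE.
  - exact: measurable_set0C.
  - exact: measurable_unit_ball.
  by move=> _ ->; rewrite /unit_ball/= cnorm0.
rewrite -(fineK f) -EFinM => -[].
set x := fine _ => H; congr _%:E; apply/eqP.
have : (2 ^+ (2 * n) - 1) * x = 0 by rewrite mulrBl mul1r -H subrr.
move/eqP; rewrite mulf_eq0 subr_eq0 => /orP[|//].
by rewrite gt_eqF// exprn_egt1 ?ltr1n// -lt0n muln_gt0.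
Qed.

(** Away from the origin the angular part of the pseudo-distance does not see [|y|], so the cone is
    homogeneous and the volume of its shells splits into a radial factor times [aperture]. *)
Definition cone z s : set C :=
  [set y | [/\ cnorm y < 1, cnorm y != 0 & angle z y < s]].

Lemma measurable_cone z s : measurable (cone z s).
Proof.
rewrite (_ : cone z s = ((@unit_ball R n) `\` [set czero R n]) `&`
    angle z @^-1` `]-oo, s[%classic).
  apply: measurableI.
    by apply: measurableD; [exact: measurable_unit_ball|exact: measurable_set0C].
  by rewrite -[X in measurable X]setTI; exact: measurable_angle.
apply/seteqP; split => y /=; rewrite in_itv/=.
  by move=> [y1 y0 ys]; split=> //; split => // yE; rewrite yE cnorm0 eqxx in y0.
by move=> [[y1 y0] ys]; split => //; apply/eqP => /cnorm_eq0.
Qed.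

Lemma mu_cone_lty z s : (mu (cone z s) < +oo)%E.
Proof.
apply: le_lt_trans mu_unit_ball_lty; apply: le_measure; rewrite ?inE.
- exact: measurable_cone.
- exact: measurable_unit_ball.
by move=> y [].
Qed.

Definition aperture z s : R := fine (mu (cone z s)).

Lemma mu_coneE z s : mu (cone z s) = (aperture z s)%:E.
Proof. by rewrite fineK// ge0_fin_numE// mu_cone_lty. Qed.

Lemma aperture_ge0 z s : 0 <= aperture z s. Proof. exact: fine_ge0. Qed.

Lemma aperture_le z s s' : s <= s' -> aperture z s <= aperture z s'.
Proof.
move=> ss; rewrite -lee_fin -!mu_coneE; apply: le_measure; rewrite ?inE.
- exact: measurable_cone.
- exact: measurable_cone.
by move=> y [y1 y0 ys]; split => //; exact: lt_le_trans ss.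
Qed.

Lemma mu_cone_lt z s t : 0 < t <= 1 ->
  mu (cone z s `&` [set y | cnorm y < t]) = (t ^+ (2 * n) * aperture z s)%:E.
Proof.
move=> /andP[t0 t1].
rewrite (mu_affine mu_leb (czero R n) t0); last first.
  apply: measurableI; [exact: measurable_cone|exact: measurable_cnorm_lt].
rewrite EFinM -mu_coneE; congr (_ * mu _)%E.
apply/seteqP; split => y /=; rewrite /cone/= cnorm_scale ?ltW// angle_scale//.
  move=> [[_ + ys]]; rewrite mulf_eq0 negb_or => /andP[_ y0].
  by rewrite gtr_pMr// => y1; split.
move=> [y1 y0 ys]; rewrite mulf_eq0 negb_or y0 gt_eqF//= gtr_pMr//; split=> //.
by split => //; apply: le_lt_trans y1; rewrite ler_piMl ?cnorm_ge0.
Qed.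

Lemma mu_shell z s t1 t2 : 0 <= t1 -> t1 <= t2 -> 0 < t2 -> t2 <= 1 ->
  mu (cone z s `&` [set y | t1 <= cnorm y < t2]) =
  ((t2 ^+ (2 * n) - t1 ^+ (2 * n)) * aperture z s)%:E.
Proof.
move=> t10 t12 t20 t21.
pose A t : set C := cone z s `&` [set y | cnorm y < t].
have mA t : measurable (A t).
  by apply: measurableI; [exact: measurable_cone|exact: measurable_cnorm_lt].
have AE t : 0 < t -> t <= 1 -> mu (A t) = (t ^+ (2 * n) * aperture z s)%:E.
  by move=> t0 t_le1; apply: mu_cone_lt; rewrite t0.
have -> : cone z s `&` [set y | t1 <= cnorm y < t2] = A t2 `\` A t1.
  apply/seteqP; split => y /=.
    move=> [cy /andP[ty yt]]; split => // -[_] /=.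
    by rewrite ltNge ty.
  move=> [[cy yt] H]; split=> //; apply/andP; split=> //.
  by rewrite leNgt; apply/negP => ty; exact: H.
have A_lty : (mu (A t2) < +oo)%E by rewrite AE// ltry.
have -> : mu (A t2 `\` A t1) = (mu (A t2) - mu (A t2 `&` A t1))%E.
  exact: (measureD (mA t2) (mA t1)).
have -> : A t2 `&` A t1 = A t1.
  apply/seteqP; split => y [] // cy yt1; split=> //; split => //=.
  exact: lt_le_trans t12.
(* Scaling by [t1] is available only for [t1 > 0]; for [t1 = 0] the inner part is empty. *)
rewrite AE//; move: t10; rewrite le_eqVlt => /predU1P[t10|t10].
  have -> : A t1 = set0.
    by apply/seteqP; split => y //= -[_] /=; rewrite -t10 ltNge cnorm_ge0.
  by rewrite measure0 sube0 -t10 expr0n muln_eq0/= eqn0Ngt n_gt0/= subr0.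
by rewrite AE ?(le_trans t12)// -EFinD -mulrBl.
Qed.

(* The affine map [y |-> z / (2 |z|) + t y] with [t = 1 / (16 K)] sends
   [cone z (K s)] into [cone z s]: writing [p = Re <z, y> / |z|], the quantity
   [|y|^2 - p^2] is multiplied by [t^2]. *)
Lemma aperture_doubling z s (K : R) : cnorm z != 0 -> 1 <= K -> 0 < s ->
  aperture z (K * s) <= (16 * K) ^+ (2 * n) * aperture z s.
Proof.
move=> z0 K1 s0.
have K0 : 0 < K by exact: lt_le_trans K1.
have Z0 : 0 < cnorm z by rewrite lt_neqAle eq_sym z0 cnorm_ge0.
set t := (16 * K)^-1.
have t0 : 0 < t by rewrite invr_gt0 mulr_gt0.
have tK : t * K = 16^-1 by rewrite /t; field; rewrite gt_eqF.
have t16 : t <= 16^-1 by rewrite -tK ler_peMr// ltW.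
pose c := affine (czero R n) (2 * cnorm z)^-1 z.
have sub : cone z (K * s) `<=` affine c t @^-1` cone z s.
  move=> y [y1 y0 ys].
  have Y0 : 0 < cnorm y by rewrite lt_neqAle eq_sym y0 cnorm_ge0.
  set m := cnorm y in y1 y0 ys Y0.
  set Z := cnorm z in Z0 z0.
  pose p := cinner_re z y / Z; pose q := cinner_im z y / Z.
  have pE : cinner_re z y = Z * p by rewrite /p mulrC divfK.
  have qE : cinner_im z y = Z * q by rewrite /q mulrC divfK.
  have cs : modulus p q <= m.
    rewrite -(ler_pM2l Z0) -modulusM ?(ltW Z0)// -pE -qE.
    exact: modulus_cinner_le.
  have pm := le_trans (le_modulusl p q) cs.
  have qm := le_trans (le_modulusr p q) cs.
  have ang : angle z y = modulus (1 - p / m) (q / m).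
    rewrite /angle -/Z -/m pE qE; congr modulus; field; by rewrite ?z0 ?y0.
  have a1 : 1 - p / m < K * s.
    by apply: le_lt_trans ys; rewrite ang (le_trans (ler_norm _))// le_modulusl.
  have a2 : `|q| / m < K * s.
    apply: le_lt_trans ys; rewrite ang.
    rewrite -[X in _ / X](gtr0_norm Y0) -normf_div; exact: le_modulusr.
  have Ks0 : 0 < K * s by rewrite mulr_gt0.
  (* [p] is the component of [y] along [z], so this bounds the squared distance of [y] to the real
     line through [z]. *)
  have b1 : m ^+ 2 - p ^+ 2 <= 2 * (K * s).
    have -> : m ^+ 2 - p ^+ 2 = (m + p) * m * (1 - p / m) by field; exact: y0.
    have mp : 0 <= (m + p) * m <= 2.
      move: pm; rewrite ler_norml => /andP[p1 p2].
      have mp0 : 0 <= m + p by lra.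
      rewrite mulr_ge0 ?(ltW Y0)//=.
      apply: (@le_trans _ _ ((m + p) * 1)); last by lra.
      by rewrite ler_wpM2l// ltW.
    have [a0|a0] := leP 0 (1 - p / m).
      by case/andP: mp => mp1 mp2; apply: ler_pM => //; exact: ltW.
    apply: (@le_trans _ _ 0); last by rewrite mulr_ge0// ltW.
    by case/andP: mp => mp1 _; rewrite mulr_ge0_le0// ltW.
  have b2 : `|q| < K * s.
    apply: le_lt_trans a2; rewrite ler_peMr// -invr1 lef_pV2 ?posrE//.
    exact: ltW.
  have cz : cnorm c = 2^-1.
    rewrite cnorm_scale ?invr_ge0 ?mulr_ge0 ?(ltW Z0)//.
    by rewrite invfM -mulrA mulVf ?mulr1.
  have xP : cinner_re z (affine c t y) = Z * (2^-1 + t * p).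
    rewrite cinner_re_affiner pE cinner_re_affiner cinner_re_sym cinner_re0 add0r.
    by rewrite -sqr_cnorm -/Z; field.
  have xQ : cinner_im z (affine c t y) = Z * (t * q).
    rewrite cinner_im_affiner qE cinner_im_affiner cinner_im_sym cinner_im0.
    by rewrite cinner_im_self; ring.
  have xM : cnorm (affine c t y) ^+ 2 =
      (2^-1 + t * p) ^+ 2 + t ^+ 2 * (m ^+ 2 - p ^+ 2).
    rewrite sqr_cnorm_affine cz cinner_re_affine cinner_re0 pE -/m -/Z.
    by field.
  rewrite /cone/= /angle xP xQ; set M := cnorm (affine c t y) in xM *.
  set P := 2^-1 + t * p in xM *.
  have tp : t * `|p| <= 16^-1.
    apply: (@le_trans _ _ (t * 1)); last by rewrite mulr1.
    by rewrite ler_wpM2l ?(ltW t0)// (le_trans pm)// ltW.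
  have tp' : `|t * p| <= 16^-1 by rewrite normrM gtr0_norm.
  have P716 : 7 / 16 <= P.
    by move: tp'; rewrite ler_norml /P => /andP[h1 h2]; lra.
  have D0 : 0 <= m ^+ 2 - p ^+ 2.
    by rewrite subr_ge0 -[p ^+ 2]real_normK ?num_real// ler_sqr ?nnegrE// ltW.
  have PM : P <= M.
    rewrite -(@ler_pXn2r _ 2) ?nnegrE ?cnorm_ge0//; last by lra.
    by rewrite xM lerDl mulr_ge0// sqr_ge0.
  have M716 : 7 / 16 <= M by exact: le_trans PM.
  have M_gt0 : 0 < M by lra.
  have M1 : M < 1.
    rewrite -(@ltr_pXn2r _ 2) ?nnegrE ?cnorm_ge0// expr1n xM /P.
    have -> : (2^-1 + t * p) ^+ 2 + t ^+ 2 * (m ^+ 2 - p ^+ 2) =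
       4^-1 + t * p + (t * m) ^+ 2 by field.
    have tm : t * m <= 16^-1.
      apply: (@le_trans _ _ (t * 1)); last by rewrite mulr1.
      by rewrite ler_wpM2l ?(ltW t0)// ltW.
    have tm2 : (t * m) ^+ 2 <= 1.
      by rewrite exprn_ile1// ?mulr_ge0 ?(ltW t0) ?(ltW Y0)//; lra.
    have tm3 : (t * m) ^+ 2 <= 16^-1.
      rewrite expr2; apply: (@le_trans _ _ (t * m * 1)); last by lra.
      rewrite ler_wpM2l ?mulr_ge0 ?(ltW t0) ?(ltW Y0)//; lra.
    by move: tp'; rewrite ler_norml => /andP[h1 h2]; lra.
  split => //; first by rewrite gt_eqF.
  have -> : Z * P / (Z * M) = P / M by rewrite -mulf_div divff ?mul1r.
  have -> : Z * (t * q) / (Z * M) = t * q / M by rewrite -mulf_div divff ?mul1r.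
  apply: (le_lt_trans (modulus_le_add _ _)).
  (* [M^2 - P^2 = t^2 (m^2 - p^2)] is at most [2 t s (t K)], while [M] and [P] stay above [7/16].
     With [e2] the angle is below [s/16 + s/7 < s]. *)
  have e1 : `|1 - P / M| <= s / 16.
    have P0 : 0 < P by lra.
    have h0 : 0 <= 1 - P / M by rewrite subr_ge0 ler_pdivrMr// mul1r.
    rewrite ger0_norm//.
    have -> : 1 - P / M = (M ^+ 2 - P ^+ 2) / (M * (M + P)).
      by field; rewrite !gt_eqF// addr_gt0.
    rewrite ler_pdivrMr; last by rewrite mulr_gt0// addr_gt0.
    have -> : M ^+ 2 - P ^+ 2 = t ^+ 2 * (m ^+ 2 - p ^+ 2) by rewrite xM; ring.
    apply: (@le_trans _ _ (t ^+ 2 * (2 * (K * s)))).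
      by rewrite ler_wpM2l// sqr_ge0.
    have -> : t ^+ 2 * (2 * (K * s)) = (2 * t * s) * (t * K) by ring.
    rewrite tK; apply: (@le_trans _ _ (2 * 16^-1 * s * 16^-1)).
      by rewrite ler_wpM2r// ler_wpM2r ?(ltW s0)// ler_wpM2l.
    apply: (@le_trans _ _ (s / 16 * (7 / 16 * (7 / 16 + 7 / 16)))).
      have := s0; lra.
    rewrite ler_wpM2l ?divr_ge0 ?(ltW s0)//.
    by apply: ler_pM => //; lra.
  have e2 : `|t * q / M| <= s / 7.
    rewrite normrM normfV (gtr0_norm M_gt0) ler_pdivrMr// normrM (gtr0_norm t0).
    apply: (@le_trans _ _ (t * (K * s))); first by rewrite ler_wpM2l ?ltW.
    rewrite mulrA tK; apply: (@le_trans _ _ (s / 7 * (7 / 16))); last first.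
      by rewrite ler_wpM2l// divr_ge0 ?(ltW s0).
    have := s0; lra.
  have := s0; lra.
have mpre : measurable (affine c t @^-1` cone z s).
  rewrite -[X in measurable X]setTI; apply: measurable_affine => //.
  exact: measurable_cone.
have := mu_affine mu_leb c t0 (measurable_cone z s).
have preE : mu (affine c t @^-1` cone z s) \is a fin_num.
  rewrite ge0_fin_numE//; have [//|] := ltP (mu (affine c t @^-1` cone z s)) +oo%E.
  rewrite leye_eq => /eqP E.
  have := mu_affine mu_leb c t0 (measurable_cone z s).
  rewrite E mu_coneE gt0_muley ?lte_fin ?exprn_gt0//.
have le : aperture z (K * s) <= fine (mu (affine c t @^-1` cone z s)).
  rewrite -lee_fin (fineK preE) -mu_coneE; apply: le_measure; rewrite ?inE//.
  exact: measurable_cone.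
rewrite mu_coneE -(fineK preE) -EFinM => -[->].
apply: (le_trans le); rewrite mulrA -exprMn /t mulfV ?expr1n ?mul1r//.
by rewrite mulf_neq0// gt_eqF.
Qed.

End Volume.

(** * Volume of pseudo-balls *)

Section RealEstimates.
Context (R : realType).
Implicit Types x y b e : R.

Lemma powR_le_two u e : 2^-1 <= u -> u <= 2 -> u `^ e <= 2 `^ `|e|.
Proof.
move=> u1 u2; have u0 : 0 < u by lra.
have [e0|e0] := leP 0 e.
  by rewrite ger0_norm// ge0_ler_powR ?nnegrE//; exact: ltW.
rewrite ltr0_norm// -{1}(opprK e) powRN -powR_inv1 ?powR_ge0// powRAC.
rewrite ge0_ler_powR ?nnegrE ?powR_ge0 ?oppr_ge0 ?(ltW e0)//.
by rewrite powR_inv1 ?(ltW u0)// -[leRHS]invrK lef_pV2 ?posrE ?invr_gt0.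
Qed.

Lemma powR_comparable x b e : 0 < b -> b / 2 <= x -> x <= 2 * b ->
  (2 `^ `|e|)^-1 * b `^ e <= x `^ e <= 2 `^ `|e| * b `^ e.
Proof.
move=> b0 x1 x2; have x0 : 0 < x by apply: lt_le_trans x1; rewrite divr_gt0.
have twoe : 0 < 2 `^ `|e| :> R by exact: powR_gt0.
have H y z : 0 < y -> 0 < z -> z / 2 <= y -> y <= 2 * z ->
    y `^ e <= 2 `^ `|e| * z `^ e.
  move=> y0 z0 y1 y2.
  have -> : y = (y / z) * z by rewrite divfK// gt_eqF.
  rewrite powRM ?divr_ge0 ?(ltW y0) ?(ltW z0)// ler_wpM2r ?powR_ge0//.
  apply: powR_le_two; first by rewrite ler_pdivlMr// mulrC.
  by rewrite ler_pdivrMr.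
rewrite H// andbT mulrC ler_pdivrMr// mulrC; apply: H => //; lra.
Qed.

Lemma subrX_le_nat x y k : 0 <= y -> y <= x -> x <= 1 ->
  x ^+ k - y ^+ k <= k%:R * (x - y).
Proof.
move=> y0 yx x1; elim: k => [|k IH]; first by rewrite !expr0 subrr mul0r.
rewrite !exprS.
have -> : x * x ^+ k - y * y ^+ k = (x - y) * x ^+ k + y * (x ^+ k - y ^+ k) by ring.
rewrite -natr1 [in leRHS]mulrDl mul1r [leRHS]addrC lerD//.
  by rewrite ler_piMr ?subr_ge0// exprn_ile1// (le_trans y0).
apply: le_trans IH; rewrite ler_piMl ?(le_trans yx)//.
by rewrite subr_ge0 lerXn2r ?nnegrE// (le_trans y0).
Qed.

Lemma subrX_ge x y k : 0 <= y -> y <= x ->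
  (x - y) * x ^+ k <= x ^+ k.+1 - y ^+ k.+1.
Proof.
move=> y0 yx; rewrite mulrBl -exprS lerD2l lerN2 exprS ler_wpM2l//.
by rewrite lerXn2r ?nnegrE// (le_trans y0).
Qed.

Lemma exists_dyadic b h : 0 < h -> h <= b ->
  exists j : nat, b * 2^-1 ^+ j.+1 < h <= b * 2^-1 ^+ j.
Proof.
move=> h0 hb; have b0 : 0 < b by exact: lt_le_trans hb.
have ex : exists j, b * 2^-1 ^+ j.+1 < h.
  exists (Num.truncn (b / h)); set k := Num.truncn _.
  rewrite exprVn ltr_pdivrMr ?exprn_gt0// mulrC -ltr_pdivrMr//.
  apply: (lt_trans (truncnS_gt _)); rewrite -/k.
  by rewrite -natrX ltr_nat ltn_expl.
have [j jh jmin] := ex_minnP ex; exists j; rewrite jh/=.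
case: j jh jmin => [|j] jh jmin; first by rewrite expr0 mulr1.
by rewrite leNgt; apply/negP => /jmin; rewrite ltnn.
Qed.

Lemma nneseries_geometric_le (c x : R) : 0 <= c -> 0 <= x < 1 ->
  (\sum_(j <oo) (c * x ^+ j)%:E <= (c / (1 - x))%:E)%E.
Proof.
move=> c0 /andP[x0 x1].
apply: lime_le; first by apply: is_cvg_nneseries => j _ _;
  rewrite lee_fin mulr_ge0// exprn_ge0.
apply: nearW => k; rewrite sumEFin lee_fin big_mkord -mulr_sumr ler_wpM2l//.
have x1' : 0 < 1 - x by rewrite subr_gt0.
rewrite -[leRHS]mul1r ler_pdivlMr// mulrC -opprB mulNr -subrX1 opprB.
by rewrite gerBl exprn_ge0.
Qed.

End RealEstimates.

(** * Weighted volume of boundary layers and pseudo-balls *)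

Section DensityVolume.
Context (R : realType) (n : nat).
Hypothesis n_gt0 : (0 < n)%N.
Local Notation C := (Cn R n).
Context (mu : {measure set C -> \bar R}).
Hypothesis mu_leb : is_lebesgue_Cn mu.
Context (alpha : R).
Hypothesis alpha_gt0 : 0 < alpha.
Implicit Types (y z : C) (r s b : R) (A : set C).

(** The indicator makes [nu_alpha] a measure on all of [C^n] carried by the unit ball, which the
    abstract part requires. *)
Definition ball_dens z : R := dens alpha z * \1_(@unit_ball R n) z.

Lemma ball_dens_ge0 z : 0 <= ball_dens z.
Proof. by rewrite mulr_ge0// powR_ge0. Qed.

Lemma measurable_dens : measurable_fun setT (@dens R n alpha).
Proof.
apply: (measurableT_comp (measurable_powR (alpha - 1))).
apply: measurable_funB => //; apply: measurable_funX; exact: measurable_cnorm.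
Qed.

Lemma measurable_ball_dens : measurable_fun setT ball_dens.
Proof.
apply: measurable_funM; first exact: measurable_dens.
by apply: measurable_indic; exact: measurable_unit_ball.
Qed.

Definition nu_alpha : {measure set C -> \bar R} :=
  density mu ball_dens_ge0 measurable_ball_dens.

Lemma ball_densE z : unit_ball z -> ball_dens z = dens alpha z.
Proof. by move=> z1; rewrite /ball_dens indicE mem_set// mulr1. Qed.

Lemma ball_dens_gt0 z : unit_ball z -> 0 < ball_dens z.
Proof.
move=> z1; rewrite ball_densE// powR_gt0// subr_gt0.
by rewrite exprn_ilt1 ?cnorm_ge0.
Qed.

Lemma nu_alpha_le A M : measurable A ->
  (forall y, A y -> ball_dens y <= M) -> (nu_alpha A <= M%:E * mu A)%E.
Proof.
move=> mA H; rewrite densityE -integral_cst//.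
apply: ge0_le_integral => //.
- by move=> y _; rewrite lee_fin ball_dens_ge0.
- by apply/measurable_EFinP; apply: measurable_funTS; exact: measurable_ball_dens.
Qed.

Lemma nu_alpha_ge A M : measurable A -> 0 <= M ->
  (forall y, A y -> M <= ball_dens y) -> (M%:E * mu A <= nu_alpha A)%E.
Proof.
move=> mA M0 H; rewrite densityE -integral_cst//.
apply: ge0_le_integral => //.
by apply/measurable_EFinP; apply: measurable_funTS; exact: measurable_ball_dens.
Qed.

Let E := 2 `^ `|alpha - 1| : R.
Let E_gt0 : 0 < E. Proof. exact: powR_gt0. Qed.

(** [1 - |y|^2 = (1 - |y|) (1 + |y|)] lies between [b / 2] and [2 b]. *)
Lemma ball_dens_comparable y b : 0 < b -> b <= 1 -> b / 2 <= 1 - cnorm y <= b ->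
  cnorm y < 1 ->
  E^-1 * b `^ (alpha - 1) <= ball_dens y <= E * b `^ (alpha - 1).
Proof.
move=> b0 b1 /andP[h1 h2] y1; rewrite ball_densE//.
have y0 := cnorm_ge0 y.
apply: powR_comparable => //.
  rewrite (_ : 1 - _ = (1 - cnorm y) * (1 + cnorm y)); last by ring.
  by rewrite (le_trans h1)// ler_peMr ?subr_ge0 ?(ltW y1)//; lra.
rewrite (_ : 1 - _ = (1 + cnorm y) * (1 - cnorm y)); last by ring.
by apply: ler_pM => //; lra.
Qed.

Let shell z s t1 t2 : set C := cone z s `&` [set y | t1 <= cnorm y < t2].

Let measurable_shell z s t1 t2 : measurable (shell z s t1 t2).
Proof.
rewrite /shell (_ : _ `&` _ = cone z s `&` ([set y | cnorm y < t2] `\`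
   [set y | cnorm y < t1])).
  apply: measurableI; first exact: measurable_cone.
  by apply: measurableD; exact: measurable_cnorm_lt.
apply/seteqP; split => y /= [cy].
  by move=> /andP[h1 h2]; split=> //; split => //; apply/negP; rewrite -leNgt.
by move=> [h2 /negP]; rewrite -leNgt h2 andbT.
Qed.

(** [E] compares densities on a shell, [n] bounds the shell volume, and the denominator sums the
    geometric series of ratio [2^-alpha], convergent since [alpha > 0]. *)
Let L := E * n%:R / (1 - 2^-1 `^ alpha).

Let two_alpha : 0 <= (2^-1 : R) `^ alpha < 1.
Proof.
rewrite powR_ge0/=.
have := @gt0_ltr_powR R alpha alpha_gt0 2^-1 1.
rewrite powR1; apply; rewrite ?nnegrE ?invr_ge0//.
by rewrite invf_lt1// ltr1n.
Qed.

Lemma L_gt0 : 0 < L.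
Proof.
case/andP: two_alpha => _ h; rewrite /L divr_gt0 ?subr_gt0// mulr_gt0//.
by rewrite ltr0n.
Qed.

(* The boundary layer is cut into dyadic shells, on which the density is
   essentially constant. *)
Lemma nu_alpha_layer_le z s b : 0 < b -> b <= 1 ->
  (nu_alpha (cone z s `&` [set y | (1 - b <= cnorm y)%R]) <=
    (L * b `^ alpha * aperture mu z s)%:E)%E.
Proof.
move=> b0 b1.
pose bj (j : nat) := b * 2^-1 ^+ j.
have bj0 j : 0 < bj j by rewrite mulr_gt0// exprn_gt0.
have bj1 j : bj j <= 1.
  by rewrite mulr_ile1// ?(ltW b0) ?exprn_ge0// exprn_ile1// invf_le1// ler1n.
have bS j : bj j.+1 = bj j / 2 by rewrite /bj exprSr mulrA.
pose S j := shell z s (1 - bj j) (1 - bj j.+1).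
have mS j : measurable (S j) by exact: measurable_shell.
have sub : cone z s `&` [set y | (1 - b <= cnorm y)%R] `<=` \bigcup_j S j.
  move=> y [[y1 y0 ys] /= by_].
  have h0 : 0 < 1 - cnorm y by rewrite subr_gt0.
  have hb : 1 - cnorm y <= b by lra.
  have [j /andP[h1 h2]] := exists_dyadic h0 hb.
  exists j => //; split => //=; rewrite /bj; apply/andP; split; lra.
have mlayer : measurable (cone z s `&` [set y | (1 - b <= cnorm y)%R]).
  rewrite (_ : _ `&` _ = shell z s (1 - b) 1).
    exact: measurable_shell.
  apply/seteqP; split => y /= [[y1 y0 ys] yb]; split => //=.
    by rewrite yb.
  by case/andP: yb.
apply: (le_trans (measure_sigma_subadditive _ mS mlayer sub)).
have gam0 := aperture_ge0 mu z s.
set c := E * n%:R * b `^ alpha * aperture mu z s.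
have c0 : 0 <= c by rewrite !mulr_ge0 ?powR_ge0 ?ler0n.
apply: (@le_trans _ _ (\sum_(j <oo) (c * (2^-1 `^ alpha) ^+ j)%:E)%E); last first.
  apply: (le_trans (nneseries_geometric_le c0 two_alpha)).
  by rewrite lee_fin /c /L le_eqVlt; apply/orP; left; apply/eqP; ring.
apply: lee_nneseries => // j _.
apply: (@le_trans _ _ ((E * bj j `^ (alpha - 1))%:E * mu (S j))%E).
  apply: nu_alpha_le => // y [[y1 y0 ys]] /= /andP[h1 h2].
  have H : bj j / 2 <= 1 - cnorm y <= bj j.
    by rewrite -bS; apply/andP; split; lra.
  by case/andP: (ball_dens_comparable (bj0 j) (bj1 j) H y1).
have bj2 : 0 <= 1 - bj j by rewrite subr_ge0.
have bjS := bj0 j.+1.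
have bj3 : 1 - bj j <= 1 - bj j.+1 by rewrite bS; have := bj0 j; lra.
have bj4 : 0 < 1 - bj j.+1 by rewrite bS; have := bj0 j; have := bj1 j; lra.
have bj5 : 1 - bj j.+1 <= 1 by lra.
rewrite /S /shell (mu_shell n_gt0 mu_leb z s bj2 bj3 bj4 bj5).
rewrite -EFinM lee_fin.
apply: (@le_trans _ _ (E * bj j `^ (alpha - 1) *
    ((2 * n)%:R * (bj j / 2) * aperture mu z s))).
  rewrite ler_wpM2l ?mulr_ge0 ?powR_ge0 ?(ltW E_gt0)//.
  rewrite ler_wpM2r//.
  have -> : bj j / 2 = (1 - bj j.+1) - (1 - bj j) by rewrite bS; field.
  exact: subrX_le_nat.
have bjE : bj j `^ (alpha - 1) * bj j = b `^ alpha * (2^-1 `^ alpha) ^+ j.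
  rewrite mulrC mulr_powRB1 ?(ltW (bj0 j))//.
  rewrite powRM ?(ltW b0) ?exprn_ge0//; congr (_ * _).
  by rewrite -powR_mulrn ?invr_ge0// powRAC powR_mulrn ?powR_ge0.
rewrite /c natrM le_eqVlt; apply/orP; left; apply/eqP.
transitivity (E * n%:R * aperture mu z s * (bj j `^ (alpha - 1) * bj j)).
  by field.
by rewrite bjE; ring.
Qed.

Lemma nu_alpha_null A : measurable A -> mu A = 0%E -> nu_alpha A = 0%E.
Proof.
move=> mA A0; rewrite densityE; apply: null_set_integral => //.
by apply/measurable_EFinP; apply: measurable_funTS; exact: measurable_ball_dens.
Qed.

Lemma nu_alpha_czero : nu_alpha [set czero R n] = 0%E.
Proof.
by apply: nu_alpha_null; [exact: measurable_set0C|exact: mu_czero].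
Qed.

Lemma nu_alpha_outside : nu_alpha (~` @unit_ball R n) = 0%E.
Proof.
rewrite densityE; apply: integral0_eq => y y1.
by rewrite /ball_dens indicE memNset// mulr0.
Qed.

Let nu_le_czero A B : measurable A -> measurable B ->
  A `<=` [set czero R n] `|` B -> (nu_alpha A <= nu_alpha B)%E.
Proof.
move=> mA mB AB; apply: (@le_trans _ _ (nu_alpha ([set czero R n] `|` B))).
  apply: le_measure; rewrite ?inE//.
  by apply: measurableU => //; exact: measurable_set0C.
apply: (le_trans (measureU2 _ _ _)) => //; first exact: measurable_set0C.
by rewrite [X in (X + _)%E]nu_alpha_czero add0e.
Qed.

Let measurable_layer z s b :
  measurable (cone z s `&` [set y | (b <= cnorm y)%R]).
Proof.
rewrite (_ : _ `&` _ = shell z s b 1); first exact: measurable_shell.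
apply/seteqP; split => y /= [[y1 y0 ys] yb]; split => //=.
  by rewrite yb.
by case/andP: yb.
Qed.

Lemma nu_alphaT_lty : (nu_alpha setT < +oo)%E.
Proof.
apply: (@le_lt_trans _ _ (nu_alpha (@unit_ball R n) + nu_alpha (~` @unit_ball R n))%E).
  rewrite -(setUv (@unit_ball R n)); apply: measureU2.
    exact: measurable_unit_ball.
  by apply: measurableC; exact: measurable_unit_ball.
rewrite [X in (_ + X)%E]nu_alpha_outside adde0.
(* Angles are at most 2, so the cone of aperture 3 is the punctured ball, seen as a layer of depth
   1. *)
apply: (@le_lt_trans _ _
  (nu_alpha (cone (czero R n) 3 `&` [set y | (1 - 1 <= cnorm y)%R]))).
  apply: nu_le_czero; [exact: measurable_unit_ball|exact: measurable_layer|].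
  move=> y y1; have [y0|y0] := eqVneq (cnorm y) 0.
    by left; exact: cnorm_eq0.
  right; split => /=; last by rewrite subrr cnorm_ge0.
  by split => //; apply: le_lt_trans (angle_le2 _ _) _; rewrite ltr_nat.
by apply: (le_lt_trans (nu_alpha_layer_le _ _ _ _)); rewrite ?ltry.
Qed.

Lemma mu_unit_ball_gt0 : (0 < mu (@unit_ball R n))%E.
Proof.
(* A cube of side [e] at the origin fits in the ball, because its points satisfy
   [|z|^2 <= 2 n e^2 = e < 1]. *)
set e : R := (2 * n)%:R^-1.
have e0 : 0 < e by rewrite invr_gt0 ltr0n muln_gt0.
have : (0 < mu (box (fun=> 0%R) (fun=> e) (fun=> 0%R) (fun=> e)))%E.
  rewrite mu_box//; under eq_bigr do
    rewrite !lebesgue_itv_co subr0 max_r ?(ltW e0)// -EFinM.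
  by rewrite prodEFin lte_fin; apply: prodr_gt0 => j _; exact: mulr_gt0.
move/lt_le_trans; apply; apply: le_measure; rewrite ?inE.
- exact: measurable_box.
- exact: measurable_unit_ball.
move=> z H; rewrite /unit_ball/=.
rewrite -(@ltr_pXn2r _ 2) ?nnegrE ?cnorm_ge0// expr1n sqr_cnorm.
apply: (@le_lt_trans _ _ (\sum_(j < n) (2 * e ^+ 2))).
  apply: ler_sum => j _; have := H j; rewrite /= !in_itv/= -!expr2.
  move=> [/andP[r0 r1] /andP[i0 i1]].
  by rewrite mulr_natl mulr2n lerD// lerXn2r ?nnegrE// ltW.
rewrite sumr_const card_ord.
have -> : 2 * e ^+ 2 *+ n = e.
  rewrite -mulr_natr /e natrM; field.
  by rewrite pnatr_eq0 -lt0n.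
rewrite invf_lt1 ?ltr0n ?muln_gt0// ltr1n.
by rewrite (@leq_trans (2 * 1)%N)// leq_mul2l.
Qed.

(** The cone of aperture 3 is the whole punctured ball, of positive volume, and [aperture_doubling]
    brings this down to [s]. *)
Lemma aperture_gt0 z s : cnorm z != 0 -> 0 < s -> 0 < aperture mu z s.
Proof.
move=> z0 s0; pose K : R := Num.max 1 (3 / s).
have K1 : 1 <= K by rewrite le_max lexx.
have K3 : 3 <= K * s by rewrite -ler_pdivrMr// le_max lexx orbT.
have K0 : 0 < K by exact: lt_le_trans K1.
have a3 : 0 < aperture mu z 3.
  rewrite -lte_fin -mu_coneE//; apply: (lt_le_trans mu_unit_ball_gt0).
  apply: (@le_trans _ _ (mu ([set czero R n] `|` cone z 3))).
    apply: le_measure; rewrite ?inE; [exact: measurable_unit_ball| |].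
      by apply: measurableU; [exact: measurable_set0C|exact: measurable_cone].
    move=> y y1; have [y0|y0] := eqVneq (cnorm y) 0.
      by left; exact: cnorm_eq0.
    right; split => //; apply: le_lt_trans (angle_le2 _ _) _.
    by rewrite ltr_nat.
  apply: (le_trans (measureU2 _ _ _)).
  - exact: measurable_set0C.
  - exact: measurable_cone.
  by rewrite [X in (X + _)%E](mu_czero n_gt0 mu_leb) add0e.
have := lt_le_trans a3 (le_trans (aperture_le mu_leb z K3)
  (aperture_doubling mu_leb z0 K1 s0)).
by rewrite pmulr_rgt0// exprn_gt0// mulr_gt0.
Qed.

Section Pball.
Context (z : C) (r : R).
Hypothesis z_neq0 : cnorm z != 0.
Hypothesis z_lt1 : cnorm z < 1.
Hypothesis r_gt : 1 - cnorm z < r.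
(** Depth of the pseudo-ball near the boundary. Its weighted volume, and that of the pseudo-ball of
    radius [10 r], are comparable to [b^alpha * aperture mu z (r / 4)]. *)
Let b := Num.min r 1 / 2.
Let Z0 : 0 < cnorm z. Proof. by rewrite lt_neqAle eq_sym z_neq0 cnorm_ge0. Qed.
Let r0 : 0 < r. Proof. by apply: le_lt_trans r_gt; rewrite subr_ge0 ltW. Qed.
Let b0 : 0 < b. Proof. by rewrite divr_gt0// lt_min r0 ltr01. Qed.
Let b1 : b <= 2^-1. Proof. by rewrite /b ler_pdivrMr// mulVf// ge_min lexx orbT. Qed.
Let br : b <= r / 2. Proof. by rewrite /b ler_pM2r// ge_min lexx. Qed.

Lemma nu_pball_ge :
  ((E^-1 * 2^-1 ^+ (2 * n) * b `^ alpha * aperture mu z (r / 4))%:E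
     <= nu_alpha (pball z r))%E.
Proof.
apply: (@le_trans _ _ (nu_alpha (shell z (r / 4) (1 - b) (1 - b / 2)))); last first.
  apply: le_measure; rewrite ?inE; [exact: measurable_shell|exact: measurable_pball|].
  move=> y [[y1 y0 ya] /= /andP[h1 h2]]; split => //; rewrite pdistE//.
  have := r_gt; have := br; have := b0; have := z_lt1.
  (* [1 - |z|] may be close to [r]; cutting the shell at [1 - b / 2] instead of 1 gains the quarter
     of [r] that is left for the angle. *)
  have H : `|cnorm z - cnorm y| <= 3 / 4 * r.
    rewrite ler_norml; apply/andP; split; last first.
      have := br; have := z_lt1; lra.
    have [rle|rle] := leP r 1.
      have bE : b = r / 2 by rewrite /b min_l.
      have := r_gt; lra.
    have bE : b = 2^-1 by rewrite /b min_r ?(ltW rle)// mul1r.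
    have := Z0; lra.
  by move: H ya; lra.
have M0 : 0 <= E^-1 * b `^ (alpha - 1).
  by rewrite mulr_ge0 ?powR_ge0// invr_ge0 ltW.
apply: (le_trans _ (nu_alpha_ge (measurable_shell _ _ _ _) M0 _)); last first.
  move=> y [[y1 y0 ya] /= /andP[h1 h2]].
  have b1' : b <= 1 by have := b1; lra.
  have H : b / 2 <= 1 - cnorm y <= b by apply/andP; split; lra.
  by case/andP: (ball_dens_comparable b0 b1' H y1).
have t1 : 0 <= 1 - b by have := b1; lra.
have t2 : 1 - b <= 1 - b / 2 by have := b0; lra.
have t3 : 0 < 1 - b / 2 by have := b1; lra.
have t4 : 1 - b / 2 <= 1 by have := b0; lra.
rewrite /shell (mu_shell n_gt0 mu_leb z _ t1 t2 t3 t4) -EFinM lee_fin mulrA.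
rewrite ler_wpM2r ?aperture_ge0//.
have [k n2] : exists k, (2 * n)%N = k.+1.
  by exists (2 * n).-1; rewrite prednK// muln_gt0.
have le1 : b / 2 * 2^-1 ^+ k <=
    (1 - b / 2) ^+ (2 * n) - (1 - b) ^+ (2 * n).
  rewrite n2; apply: (le_trans _ (subrX_ge _ t1 t2)).
  have -> : 1 - b / 2 - (1 - b) = b / 2 by field.
  apply: ler_wpM2l; first by apply: divr_ge0 => //; exact: ltW.
  apply: lerXn2r; rewrite ?nnegrE; [by rewrite invr_ge0|exact: ltW|].
  by have := b1; lra.
apply: (le_trans _ (ler_wpM2l M0 le1)).
rewrite n2 exprS -(mulr_powRB1 (ltW b0) alpha_gt0).
by rewrite le_eqVlt; apply/orP; left; apply/eqP; field; rewrite gt_eqF.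
Qed.

(** If [d(z, y) < 10 r], then [|y| > |z| - 10 r > 1 - 11 r], so [y] lies in a layer of depth
    [b' <= 22 b]. The aperture grows from [r / 4] to [10 r], a factor 40, whence [640 = 16 * 40]. *)
Lemma nu_pball_le : (nu_alpha (pball z (10 * r)) <=
  (L * 22 `^ alpha * 640 ^+ (2 * n) * b `^ alpha * aperture mu z (r / 4))%:E)%E.
Proof.
pose b' := Num.min (11 * r) 1.
have b'0 : 0 < b' by rewrite lt_min ltr01 andbT mulr_gt0.
have b'1 : b' <= 1 by rewrite ge_min lexx orbT.
have b'b : b' <= 22 * b.
  rewrite /b' /b; have [rle|rle] := leP r 1.
    by rewrite ge_min; apply/orP; left; lra.
  by rewrite ge_min; apply/orP; right; lra.
apply: (@le_trans _ _
  (nu_alpha (cone z (10 * r) `&` [set y | (1 - b' <= cnorm y)%R]))).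
  apply: nu_le_czero; [exact: measurable_pball|exact: measurable_layer|].
  move=> y [y1 yd]; have [y0|y0] := eqVneq (cnorm y) 0.
    by left; exact: cnorm_eq0.
  move: yd; rewrite pdistE// => yd.
  have a0 := angle_ge0 z y; have n0 := normr_ge0 (cnorm z - cnorm y).
  right; split => /=; first by split => //; lra.
  have := ler_norm (cnorm z - cnorm y); have := cnorm_ge0 y.
  rewrite /b'; have [rle|rle] := leP (11 * r) 1; last by lra.
  have := r_gt; lra.
apply: (le_trans (nu_alpha_layer_le _ _ b'0 b'1)); rewrite lee_fin.
have ap : aperture mu z (10 * r) <= 640 ^+ (2 * n) * aperture mu z (r / 4).
  have -> : 10 * r = 40 * (r / 4) by field.
  have -> : 640 = 16 * 40 :> R by ring.
  by apply: aperture_doubling => //; rewrite ?divr_gt0// ler1n.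
have bp : b' `^ alpha <= 22 `^ alpha * b `^ alpha.
  rewrite -powRM ?(ltW b0)// ge0_ler_powR ?nnegrE ?(ltW alpha_gt0) ?(ltW b'0)//.
  by rewrite mulr_ge0// ltW.
apply: (@le_trans _ _ (L * (22 `^ alpha * b `^ alpha) *
    (640 ^+ (2 * n) * aperture mu z (r / 4)))).
  have L0 := ltW L_gt0.
  apply: ler_pM => //; first by apply: mulr_ge0 => //; exact: powR_ge0.
    exact: aperture_ge0.
  exact: ler_wpM2l.
by rewrite le_eqVlt; apply/orP; left; apply/eqP; ring.
Qed.

End Pball.

Definition doubling_const : R :=
  L * 22 `^ alpha * 640 ^+ (2 * n) * E * 2 ^+ (2 * n).

Lemma doubling_const_gt0 : 0 < doubling_const.
Proof.
have h2 : 0 < 22 `^ alpha :> R by apply: powR_gt0; rewrite ltr0n.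
have h3 : 0 < 640 ^+ (2 * n) :> R by apply: exprn_gt0; rewrite ltr0n.
have h4 : 0 < 2 ^+ (2 * n) :> R by apply: exprn_gt0; rewrite ltr0n.
exact: (mulr_gt0 (mulr_gt0 (mulr_gt0 (mulr_gt0 L_gt0 h2) h3) E_gt0) h4).
Qed.

Lemma nu_pball_gt0 z r : cnorm z != 0 -> cnorm z < 1 -> 1 - cnorm z < r ->
  (0 < nu_alpha (pball z r))%E.
Proof.
move=> z0 z1 rz; apply: lt_le_trans (nu_pball_ge z0 z1 rz).
have r0 : 0 < r by apply: le_lt_trans rz; rewrite subr_ge0 ltW.
rewrite lte_fin mulr_gt0 ?aperture_gt0 ?divr_gt0//.
apply: mulr_gt0; last by apply: powR_gt0; rewrite divr_gt0// lt_min r0 ltr01.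
by apply: mulr_gt0; [rewrite invr_gt0|apply: exprn_gt0; rewrite invr_gt0].
Qed.

Lemma nu_pball_doubling z r : cnorm z != 0 -> cnorm z < 1 -> 1 - cnorm z < r ->
  (nu_alpha (pball z (10 * r)) <= doubling_const%:E * nu_alpha (pball z r))%E.
Proof.
move=> z0 z1 rz; apply: (le_trans (nu_pball_le z0 z1 rz)).
have c0 : (0 <= doubling_const%:E)%E by rewrite lee_fin ltW// doubling_const_gt0.
apply: (le_trans _ (lee_wpmul2l c0 (nu_pball_ge z0 z1 rz))).
rewrite -EFinM lee_fin /doubling_const !exprVn.
rewrite le_eqVlt; apply/orP; left; apply/eqP; field.
by rewrite expf_neq0//= gt_eqF.
Qed.

End DensityVolume.

(** * A countable family of cells comparable to all pseudo-balls *)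

Section RationalBalls.
Context (R : realType) (n : nat).
Hypothesis n_gt0 : (0 < n)%N.
Local Notation C := (Cn R n).
Implicit Types (y z : C) (r : R).

Definition rat_point (q : n.-tuple (rat * rat)) : C :=
  [tuple (ratr (tnth q j).1, ratr (tnth q j).2) | j < n].

Lemma rat_point_dense z (e : R) : 0 < e ->
  exists q, cnorm (csub z (rat_point q)) < e.
Proof.
move=> e0; pose dl := e / (2 * n)%:R.
have n20 : 0 < (2 * n)%:R :> R by rewrite ltr0n muln_gt0.
have dl0 : 0 < dl by rewrite divr_gt0.
have approx (x : R) : exists q : rat, `|x - ratr q| <= dl.
  have lt : x - dl < x + dl by lra.
  have [q] := rat_in_itvoo lt; rewrite in_itv/= => /andP[h1 h2]; exists q; rewrite ler_norml.
  by apply/andP; split; lra.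
have [f fP] := choice approx.
exists [tuple (f (re z j), f (im z j)) | j < n].
set y := rat_point _.
have ry j : re y j = ratr (f (re z j)) by rewrite /re !tnth_mktuple.
have iy j : im y j = ratr (f (im z j)) by rewrite /im !tnth_mktuple.
rewrite -(@ltr_pXn2r _ 2) ?nnegrE ?cnorm_ge0 ?(ltW e0)// sqr_cnorm.
apply: (@le_lt_trans _ _ (\sum_(j < n) (2 * dl ^+ 2))).
  apply: ler_sum => j _; rewrite re_affine im_affine ry iy !mulN1r -!expr2.
  rewrite mulr_natl mulr2n lerD// -(real_normK (num_real _));
    by rewrite lerXn2r ?nnegrE ?(ltW dl0)//; exact: fP.
rewrite sumr_const card_ord.
have nR : n%:R != 0 :> R by rewrite pnatr_eq0 -lt0n.
have -> : 2 * dl ^+ 2 *+ n = e ^+ 2 / (2 * n)%:R.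
  by rewrite -mulr_natr /dl natrM; field.
rewrite ltr_pdivrMr// ltr_pMr ?exprn_gt0//.
by rewrite ltr1n (@leq_trans (2 * 1)%N)// leq_mul2l.
Qed.

Let code : Type := (n.-tuple (rat * rat) * rat)%type.

Definition admissible (z : C) r := [&& cnorm z != 0, cnorm z < 1 & 1 - cnorm z < r].

Let valid (c : code) := admissible (rat_point c.1) (ratr c.2).

(* The default ball has radius 4, so that the pseudo-balls centred at the origin,
   which are the whole unit ball, are also covered by a cell. *)
Let valid_default : exists c, valid c && (4 == c.2).
Proof.
have n20 : 0 < (2 * n)%:R :> R by rewrite ltr0n muln_gt0.
pose e : rat := (2 * n)%:R^-1.
exists ([tuple (e, 0) | j < n], 4); rewrite eqxx andbT /valid/=.
set z := rat_point _.
have rz j : re z j = (2 * n)%:R^-1.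
  by rewrite /re !tnth_mktuple /= /e fmorphV/= ratr_nat.
have iz j : im z j = 0 by rewrite /im !tnth_mktuple /= rmorph0.
have nR : n%:R != 0 :> R by rewrite pnatr_eq0 -lt0n.
have zE : cnorm z ^+ 2 = (4 * n%:R)^-1.
  rewrite sqr_cnorm /cinner_re; under eq_bigr do rewrite rz iz.
  by rewrite sumr_const card_ord -mulr_natr natrM; field.
have z2 : 0 < cnorm z ^+ 2 by rewrite zE invr_gt0 mulr_gt0// ltr0n.
have z1 : cnorm z < 1.
  rewrite -(@ltr_pXn2r _ 2) ?nnegrE ?cnorm_ge0// expr1n zE.
  rewrite invf_lt1 ?mulr_gt0 ?ltr0n// -natrM ltr1n.
  by rewrite (@leq_trans (4 * 1)%N)// leq_mul2l.
apply/and3P; split => //.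
  by rewrite -sqrf_eq0 gt_eqF.
by rewrite ratr_nat; have := cnorm_ge0 z; lra.
Qed.

Let default := xchoose valid_default.

(** Enumerates all admissible rational centres and radii; an integer coding no admissible pair is
    sent to the default, so that every index yields a genuine cell. *)
Let decode (k : nat) : code :=
  if unpickle k is Some c then (if valid c then c else default) else default.

Definition center k := rat_point (decode k).1.
Definition radius k : R := ratr (decode k).2.

Lemma decode_admissible k : admissible (center k) (radius k).
Proof.
have vd : valid default by have /andP[] := xchooseP valid_default.
rewrite /center /radius /decode; case: unpickle => [c|//].
by case: ifP.
Qed.

Lemma decode_onto q (r : rat) : admissible (rat_point q) (ratr r) ->
  exists k, center k = rat_point q /\ radius k = ratr r.
Proof.
move=> v; exists (pickle ((q, r) : code)).
by rewrite /center /radius /decode pickleK /valid/= v.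
Qed.

Lemma decode_four : exists k, radius k = 4.
Proof.
have /andP[v /eqP r4] := xchooseP valid_default.
have [k [_ kr]] := decode_onto v; exists k; rewrite kr.
by rewrite -r4 ratr_nat.
Qed.

(* The quasi-triangle inequality fails when the middle point is the origin, so
   the origin, a null set, is removed from the pseudo-balls. *)
Definition pcell z r : set C := pball z r `\` [set czero R n].

Lemma measurable_pcell z r : measurable (pcell z r).
Proof.
by apply: measurableD; [exact: measurable_pball|exact: measurable_set0C].
Qed.

Lemma pcellP z r y : pcell z r y <-> [/\ cnorm y < 1, cnorm y != 0 & pdist z y < r].
Proof.
split; first by move=> [[y1 yr] y0]; split => //; apply/eqP => /cnorm_eq0.
by move=> [y1 y0 yr]; split => // yE; rewrite yE cnorm0 eqxx in y0.
Qed.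

(** Through a common point [x]: [d(z', y) < 2 (r' + 2 (r + r)) <= 10 r']. This is the origin of the
    factor 10. *)
Lemma pcell_engulf z z' r r' : cnorm z != 0 -> cnorm z' != 0 ->
  pcell z r `&` pcell z' r' !=set0 -> r <= r' -> pcell z r `<=` pcell z' (10 * r').
Proof.
move=> z0 z'0 [x [/pcellP[x1 x0 xz] /pcellP[_ _ xz']]] rr y /pcellP[y1 y0 yz].
apply/pcellP; split => //.
have h1 := pdist_quasi_triangle z'0 x0 y0.
have h2 := pdist_quasi_triangle x0 z0 y0.
rewrite (pdist_sym x z) in h2; lra.
Qed.

Context (mu : {measure set C -> \bar R}).
Hypothesis mu_leb : is_lebesgue_Cn mu.
Context (alpha : R).
Hypothesis alpha_gt0 : 0 < alpha.
Local Notation nu := (nu_alpha mu alpha).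

Lemma nu_pcell z r : nu (pcell z r) = nu (pball z r).
Proof.
apply/eqP; rewrite eq_le; apply/andP; split.
  apply: le_measure; rewrite ?inE; [exact: measurable_pcell|exact: measurable_pball|].
  by move=> y [].
apply: (@le_trans _ _ (nu ([set czero R n] `|` pcell z r))).
  apply: le_measure; rewrite ?inE; first exact: measurable_pball.
    by apply: measurableU; [exact: measurable_set0C|exact: measurable_pcell].
  by move=> y yz; have [->|y0] := pselect (y = czero R n); [left|right; split].
apply: (le_trans (measureU2 _ _ _)).
- exact: measurable_set0C.
- exact: measurable_pcell.
by rewrite [X in (X + _)%E](nu_alpha_czero n_gt0 mu_leb) add0e.
Qed.

Let K := 1 + doubling_const n alpha.

Lemma calB_subset_rational E : calB E ->
  exists k, E `\` [set czero R n] `<=` pcell (center k) (radius k) /\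
    (nu (pcell (center k) (radius k)) <= K%:E * nu E)%E.
Proof.
have D0 := doubling_const_gt0 n_gt0 alpha_gt0.
have K1 : 1 <= K by rewrite lerDl ltW.
move=> [z [r [z1 [zr ->]]]].
have [z0|z0] := eqVneq (cnorm z) 0.
  have ball_sub : @unit_ball R n `<=` pball z r.
    move=> y y1; split=> //; rewrite /pdist z0 eqxx/= add0r.
    by apply: lt_trans zr; rewrite z0 subr0.
  have [k rk] := decode_four; exists k.
  have /and3P[c0 c1 cr] := decode_admissible k.
  split.
    move=> y [[y1 _] yn]; apply/pcellP.
    have y0 : cnorm y != 0 by apply/eqP => /cnorm_eq0.
    split => //; rewrite pdistE// rk.
    have := angle_le2 (center k) y; have := cnorm_ge0 (center k); have := cnorm_ge0 y.
    have H : `|cnorm (center k) - cnorm y| <= 1.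
      have := cnorm_ge0 (center k); have := cnorm_ge0 y; move: c1 y1.
      rewrite /unit_ball/= => *; rewrite ler_norml; apply/andP; split; lra.
    move: H; lra.
  apply: (@le_trans _ _ (nu (pball z r))).
    apply: le_measure; rewrite ?inE; [exact: measurable_pcell|exact: measurable_pball|].
    by move=> y /pcellP[y1 _ _]; exact: ball_sub.
  by rewrite -[leLHS]mul1e; apply: lee_wpmul2r => //; rewrite lee_fin.
have Z0 : 0 < cnorm z by rewrite lt_neqAle eq_sym z0 cnorm_ge0.
have r0 : 0 < r by apply: le_lt_trans zr; rewrite subr_ge0 ltW.
(* [M] bounds the constant [1 + 2 / |x|] of [pdist_near] when [|x| >= |z| / 2]. The three bounds in
   [eta] ensure this, [|x| < 1] and [d(z, x) < r / 8] respectively. *)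
pose M := 1 + 4 / cnorm z.
have M1 : 1 <= M by rewrite lerDl divr_ge0// ltW.
have M0 : 0 < M by exact: lt_le_trans M1.
pose eta := Num.min (cnorm z / 2) (Num.min (1 - cnorm z) (r / 8 / M)).
have eta0 : 0 < eta by rewrite !lt_min !divr_gt0// subr_gt0 z1.
have [q] := rat_point_dense z eta0.
set x := rat_point q; set tau := cnorm (csub z x).
rewrite !lt_min => /and3P[t1 t2 t3].
have tau0 : 0 <= tau by exact: cnorm_ge0.
have xz := cnorm_sub_le z x; rewrite -/tau ler_norml in xz.
move/andP: xz => [xz1 xz2].
have x2 : cnorm z / 2 <= cnorm x by lra.
have X0 : 0 < cnorm x by apply: lt_le_trans x2; rewrite divr_gt0.
have x0 : cnorm x != 0 by rewrite gt_eqF.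
have x1 : cnorm x < 1 by lra.
have tM : M * tau < r / 8 by rewrite mulrC -ltr_pdivlMr.
have tr : tau < r / 8 by apply: le_lt_trans tM; rewrite ler_peMl.
have dzx : pdist z x < r / 8.
  apply: le_lt_trans tM; apply: (le_trans (pdist_near z0 x0)).
  rewrite -/tau ler_wpM2r// lerD2l ler_pdivrMr// mulrAC ler_pdivlMr//.
  by move: x2; lra.
(* [2 (r/8 + r) = 9r/4] makes the cell contain the pseudo-ball, and [2 (r/8 + 3r) < 10 r] puts the
   cell inside the dilated pseudo-ball. *)
have lt : 9 / 4 * r < 3 * r by lra.
have [r' r'in] := rat_in_itvoo lt.
have /andP[r'1 r'2] : (9 / 4 * r < ratr r') && (ratr r' < 3 * r).
  by rewrite in_itv in r'in.
have adm : admissible x (ratr r') by rewrite /admissible x0 x1/=; lra.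
have [k [kc kr]] := decode_onto adm; exists k; rewrite kc kr -/x.
split.
  move=> y [[y1 yz] yn]; apply/pcellP.
  have y0 : cnorm y != 0 by apply/eqP => /cnorm_eq0.
  split => //; have := pdist_quasi_triangle x0 z0 y0.
  by rewrite (pdist_sym x z); lra.
apply: (@le_trans _ _ (nu (pball z (10 * r)))).
  apply: le_measure; rewrite ?inE; [exact: measurable_pcell|exact: measurable_pball|].
  move=> y /pcellP[y1 y0 yx]; split => //.
  by have := pdist_quasi_triangle z0 x0 y0; lra.
apply: (le_trans (nu_pball_doubling n_gt0 mu_leb alpha_gt0 z0 z1 zr)).
by apply: lee_wpmul2r => //; rewrite lee_fin lerDr.
Qed.

End RationalBalls.

(** * Averages and the factorization *)

Lemma measurable_epow (R : realType) (s : R) :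
  measurable_fun [set: R] (fun x => epow x s).
Proof.
have mp : measurable_fun [set: R] (fun x => (x `^ s)%:E).
  by apply/measurable_EFinP; exact: measurable_powR.
rewrite /epow; case: ltP => s0.
  under eq_fun do rewrite andbT.
  apply: measurable_fun_ifT => //.
  by apply: measurable_fun_eqr.
by under eq_fun do rewrite andbF.
Qed.

Lemma epow_ge0 (R : realType) (x s : R) : (0 <= epow x s)%E.
Proof. by rewrite /epow; case: ifP => // _; rewrite lee_fin powR_ge0. Qed.

Lemma epow_gt0 (R : realType) (x s : R) : 0 < x -> epow x s = (x `^ s)%:E.
Proof. by move=> x0; rewrite /epow gt_eqF. Qed.

Lemma epow0 (R : realType) (s : R) : s < 0 -> epow 0 s = +oo%E.
Proof. by move=> s0; rewrite /epow eqxx s0. Qed.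

(** * Averages over pseudo-balls, and pointwise consequences of [B_1] *)

Section Averages.
Context (R : realType) (n : nat).
Hypothesis n_gt0 : (0 < n)%N.
Local Notation C := (Cn R n).
Context (mu : {measure set C -> \bar R}).
Hypothesis mu_leb : is_lebesgue_Cn mu.
Context (alpha : R).
Hypothesis alpha_gt0 : 0 < alpha.
Local Notation nu := (nu_alpha mu alpha).
Local Notation ball := (@unit_ball R n).
Local Notation avg := (avg_alpha mu alpha).
Implicit Types (E : set C) (f g : C -> \bar R).
Local Open Scope ereal_scope.

Lemma calB_measurable E : calB E -> measurable E.
Proof. by move=> [z [r [_ [_ ->]]]]; exact: measurable_pball. Qed.

Lemma calB_sub_ball E : calB E -> E `<=` ball.
Proof. by move=> [z [r [_ [_ ->]]]] y []. Qed.

(** The source of all global integrability: conditions over pseudo-balls can be tested on the whole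
    ball. *)
Lemma calB_ball : calB ball.
Proof.
exists (czero R n), 2%R; rewrite cnorm0 subr0; split.
  by rewrite /unit_ball/= cnorm0.
split; first by rewrite ltr1n.
apply/seteqP; split => [y y1|y []//]; split => //.
rewrite pdist_sym pdist0r; apply: lt_trans y1 _.
by rewrite ltr1n.
Qed.

Lemma ball_dens_int E f : E `<=` ball ->
  \int[mu]_(z in E) (f z * (ball_dens alpha z)%:E) = int_alpha mu alpha E f.
Proof.
move=> Eb; rewrite /int_alpha (setIidl Eb).
by apply: eq_integral => z /[!inE] /Eb z1; rewrite ball_densE.
Qed.

Lemma int_alphaE E f : measurable E -> E `<=` ball -> measurable_fun E f ->
  (forall z, E z -> 0 <= f z) ->
  int_alpha mu alpha E f = \int[nu]_(z in E) f z.
Proof.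
move=> mE Eb mf f0; rewrite -ball_dens_int//.
by rewrite /nu_alpha integral_density.
Qed.

Lemma mu_alphaE E : measurable E -> E `<=` ball -> mu_alpha mu alpha E = nu E.
Proof.
move=> mE Eb; rewrite /mu_alpha -ball_dens_int//.
by apply: eq_integral => z _; rewrite mul1e.
Qed.

Lemma avg_alphaE E f : calB E -> measurable_fun E f ->
  (forall z, E z -> 0 <= f z) ->
  avg E f = average nu f E.
Proof.
move=> BE mf f0; have mE := calB_measurable BE; have Eb := calB_sub_ball BE.
by rewrite /avg_alpha mu_alphaE// int_alphaE.
Qed.

Lemma nu_lty E : measurable E -> nu E < +oo.
Proof.
move=> mE; apply: le_lt_trans (nu_alphaT_lty n_gt0 mu_leb alpha_gt0).
by apply: le_measure; rewrite ?inE.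
Qed.

Lemma nu_gt0 E : measurable E -> E `<=` ball -> 0 < mu E -> 0 < nu E.
Proof.
by move=> mE Eb mE0; apply: density_gt0 => // z /Eb; exact: ball_dens_gt0.
Qed.

Lemma calB_nu_gt0 E : calB E -> 0 < nu E.
Proof.
move=> [z [r [z1 [zr ->]]]].
have [z0|z0] := eqVneq (cnorm z) 0%R; last exact: nu_pball_gt0.
have -> : pball z r = ball.
  apply/seteqP; split => [y []//|y y1]; split => //.
  by rewrite /pdist z0 eqxx/= add0r; apply: lt_trans zr; rewrite z0 subr0.
apply: nu_gt0 => //; first exact: measurable_unit_ball.
exact: mu_unit_ball_gt0.
Qed.

Lemma calB_nu_fine E : calB E -> nu E = (fine (nu E))%:E /\ (0 < fine (nu E))%R.
Proof.
move=> BE; have h0 := calB_nu_gt0 BE; have h1 := nu_lty (calB_measurable BE).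
by rewrite fineK ?ge0_fin_numE// fine_gt0// h0 h1.
Qed.

Lemma calB_mu_neq0 E : calB E -> mu E != 0.
Proof.
move=> BE; apply/eqP => E0; have := calB_nu_gt0 BE.
by rewrite nu_alpha_null ?ltxx//; exact: calB_measurable.
Qed.

(** A pseudo-ball is not null, so an almost everywhere property holds at one of its points; one
    point is enough to prove an average finite. *)
Lemma ae_calB_ex E (P : set C) : calB E -> {ae mu, forall z, E z -> P z} ->
  exists z, E z /\ P z.
Proof.
move=> BE [N [mN N0 NP]].
apply: contrapT => H; have : mu E <= mu N.
  apply: le_measure; rewrite ?inE//; first exact: calB_measurable.
  move=> z Ez; apply: NP => /= /(_ Ez) Pz.
  by apply: H; exists z.
rewrite N0 measure_le0 => /eqP E0.
by have := calB_mu_neq0 BE; rewrite E0 eqxx.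
Qed.

Let measurable_fun_dens E f : measurable_fun E f ->
  measurable_fun E (fun z => f z * (dens alpha z)%:E).
Proof.
move=> mf; apply: emeasurable_funM => //.
by apply/measurable_EFinP; apply: measurable_funTS; exact: measurable_dens.
Qed.

Lemma avg_ge0 E f : (forall z, E z -> 0 <= f z) -> 0 <= avg E f.
Proof.
move=> f0; rewrite /avg_alpha mule_ge0//.
  rewrite lee_fin invr_ge0 fine_ge0//; apply: integral_ge0 => z _.
  by rewrite mul1e lee_fin powR_ge0.
by apply: integral_ge0 => z [/f0 fz _]; rewrite mule_ge0// lee_fin powR_ge0.
Qed.

Lemma ae_le_avg E f g : calB E -> measurable_fun E f -> measurable_fun E g ->
  (forall z, E z -> 0 <= f z) -> (forall z, E z -> 0 <= g z) ->
  {ae mu, forall z, E z -> f z <= g z} -> avg E f <= avg E g.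
Proof.
move=> BE mf mg f0 g0 fg; have mE := calB_measurable BE.
have Eb := calB_sub_ball BE.
apply: lee_wpmul2l.
  by rewrite lee_fin invr_ge0 fine_ge0// mu_alphaE.
rewrite /int_alpha (setIidl Eb); apply: ae_ge0_le_integral => //.
- by move=> z Ez; rewrite mule_ge0 ?f0// lee_fin powR_ge0.
- exact: measurable_fun_dens.
- by move=> z Ez; rewrite mule_ge0 ?g0// lee_fin powR_ge0.
- exact: measurable_fun_dens.
apply: filterS fg => z + Ez; move=> /(_ Ez) fgz.
by apply: lee_wpmul2r => //; rewrite lee_fin powR_ge0.
Qed.

Lemma ae_eq_avg E f g : calB E -> measurable_fun E f -> measurable_fun E g ->
  (forall z, E z -> 0 <= f z) -> (forall z, E z -> 0 <= g z) ->
  {ae mu, forall z, E z -> f z = g z} -> avg E f = avg E g.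
Proof.
move=> BE mf mg f0 g0 fg; apply/eqP; rewrite eq_le; apply/andP; split;
  apply: ae_le_avg => //; by apply: filterS fg => z H /H ->.
Qed.

Lemma avgZ E f (c : R) : calB E -> (0 <= c)%R -> measurable_fun E f ->
  (forall z, E z -> 0 <= f z) -> avg E (fun z => c%:E * f z) = c%:E * avg E f.
Proof.
move=> BE c0 mf f0; have mE := calB_measurable BE; have Eb := calB_sub_ball BE.
rewrite /avg_alpha /int_alpha (setIidl Eb) muleCA; congr (_ * _).
rewrite -ge0_integralZl//.
- by apply: eq_integral => z _; rewrite muleA.
- exact: measurable_fun_dens.
- by move=> z Ez; rewrite mule_ge0 ?f0// lee_fin powR_ge0.
Qed.

Lemma avg0_ae E f : calB E -> measurable_fun E f ->
  (forall z, E z -> 0 <= f z) -> avg E f = 0 ->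
  {ae mu, forall z, E z -> f z = 0}.
Proof.
move=> BE mf f0; have mE := calB_measurable BE; have Eb := calB_sub_ball BE.
have [nuE n0] := calB_nu_fine BE.
rewrite /avg_alpha mu_alphaE// /int_alpha (setIidl Eb).
move/eqP; rewrite mule_eq0 eqe invr_eq0 gt_eqF//= => /eqP int0.
have : ae_eq mu E (fun z => f z * (dens alpha z)%:E) (cst 0).
  apply/(ae_eq_integral_abs _ mE); first exact: measurable_fun_dens.
  rewrite -[RHS]int0; apply: eq_integral => z /[!inE] Ez.
  by rewrite gee0_abs// mule_ge0 ?f0// lee_fin powR_ge0.
apply: filterS => z /= H Ez; have := H Ez; move/eqP.
rewrite mule_eq0 => /orP[/eqP//|].
by rewrite -ball_densE; [rewrite eqe gt_eqF// ball_dens_gt0//; exact: Eb|exact: Eb].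
Qed.

Lemma weight_measurable w E : is_weight mu w -> calB E ->
  measurable_fun E w.
Proof.
move=> [_ [mw _]] BE; apply: measurable_funS mw; first exact: measurable_unit_ball.
exact: calB_sub_ball.
Qed.

Lemma weight_ge0 w E : is_weight mu w -> calB E -> forall z, E z -> (0 <= w z)%R.
Proof. by move=> [w0 _] BE z /(calB_sub_ball BE); exact: w0. Qed.

Lemma in_B1_avg w : is_weight mu w -> in_B1 mu alpha w ->
  exists2 D : R, (0 < D)%R & forall E, calB E ->
    {ae mu, forall z, E z -> avg E (EFin \o w) <= (D * w z)%:E}.
Proof.
move=> ww B1.
have [D D0 HD] : exists2 D : R, (0 < D)%R & {ae mu, forall z, ball z ->
    m_alpha mu alpha w z * epow (w z) (-1) <= D%:E}.
  have : {ae mu, forall z, (if z \in ball then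
      (m_alpha mu alpha w z * epow (w z) (-1))%E else 0%E) <=
      (Num.max 1 (fine (ess_sup mu (fun z => if z \in ball then
      (m_alpha mu alpha w z * epow (w z) (-1))%E else 0%E))))%:E}.
    (* The maximum with 1 makes the bound a positive real even when the essential supremum is
       [-oo]. *)
    apply/ess_supP; move: B1; rewrite /in_B1; set S := ess_sup _ _.
    case: S => [x _|//|_]; last by rewrite leNye.
    by rewrite lee_fin le_max lexx orbT.
  set D := Num.max _ _ => H; exists D; first by rewrite lt_max ltr01.
  by apply: filterS H => z /= + zb; rewrite mem_set.
exists D => // E BE; apply: filterS HD => z H Ez.
have zb := calB_sub_ball BE Ez.
have w0 := weight_ge0 ww BE Ez.
have avgE : avg E (EFin \o w) = avg E (fun x => (`|w x|)%:E).
  rewrite /avg_alpha /int_alpha; congr (_ * _); apply: eq_integral => y.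
  rewrite inE => -[Ey _]; congr (_ * _).
  by rewrite /= ger0_norm// (weight_ge0 ww BE).
have a0 : 0 <= avg E (EFin \o w).
  by apply: avg_ge0 => y Ey; rewrite lee_fin (weight_ge0 ww BE).
have : avg E (EFin \o w) * epow (w z) (-1) <= D%:E.
  apply: le_trans (H zb); apply: lee_wpmul2r; first exact: epow_ge0.
  by rewrite avgE; apply: ereal_sup_ubound; exists E.
(* Where [w] vanishes the ratio has the factor [+oo], so a finite bound forces the average itself to
   be 0. *)
have [wz|wz] := eqVneq (w z) 0%R.
  rewrite wz epow0 ?ltrN10// mulr0.
  have [->//|an0] := eqVneq (avg E (EFin \o w)) 0.
  by rewrite gt0_muley ?leye_eq// lt0e an0.
have wz0 : (0 < w z)%R by rewrite lt_neqAle eq_sym wz.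
rewrite epow_gt0// powR_inv1// muleC lee_pdivrMl//.
by rewrite -EFinM mulrC.
Qed.

End Averages.

(** * From [B_1] factors to [B_p] *)

Section Factorization.
Context (R : realType) (n : nat).
Hypothesis n_gt0 : (0 < n)%N.
Local Notation C := (Cn R n).
Context (mu : {measure set C -> \bar R}).
Hypothesis mu_leb : is_lebesgue_Cn mu.
Context (alpha : R).
Hypothesis alpha_gt0 : 0 < alpha.
Context (p : R).
Hypothesis p_gt1 : 1 < p.
Local Notation nu := (nu_alpha mu alpha).
Local Notation ball := (@unit_ball R n).
Local Notation avg := (avg_alpha mu alpha).
Implicit Types (E : set C) (w : C -> R).
Local Open Scope ereal_scope.

Let p10 : (0 < p - 1)%R. Proof. by rewrite subr_gt0. Qed.
Let r := ((p - 1)^-1)%R.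
Let r0 : (0 < r)%R. Proof. by rewrite invr_gt0. Qed.

Lemma in_Bp_of_B1 w w1 w2 :
  is_weight mu w -> is_weight mu w1 -> is_weight mu w2 ->
  in_B1 mu alpha w1 -> in_B1 mu alpha w2 ->
  {ae mu, forall z, ball z -> (w z)%:E = (w1 z)%:E * epow (w2 z) (1 - p)} ->
  in_Bp mu alpha p w.
Proof.
move=> ww ww1 ww2 B1 B2 wE.
have [D1 D10 H1] := in_B1_avg ww1 B1.
have [D2 D20 H2] := in_B1_avg ww2 B2.
exists (D1 * D2 `^ (p - 1))%R => E BE.
have DD : (0 <= D1 * D2 `^ (p - 1))%R by rewrite mulr_ge0 ?powR_ge0// ltW.
have Eb := calB_sub_ball BE.
have mE_ u : is_weight mu u -> measurable_fun E (fun x => (u x)%:E).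
  by move=> wu; apply/measurable_EFinP; exact: (weight_measurable wu BE).
have u0 u : is_weight mu u -> forall z, E z -> 0 <= (u z)%:E.
  by move=> wu z Ez; rewrite lee_fin (weight_ge0 wu BE).
(* The second average may then be [+oo], but the product is 0 by the convention [0 * +oo = 0]. *)
have w0_case : {ae mu, forall z, E z -> (w z)%:E = 0} ->
    avg E (fun x => (w x)%:E) *
    avg E (fun x => epow (w x) (- (p - 1)^-1)) `^ (p - 1) <=
    (D1 * D2 `^ (p - 1))%:E.
  move=> w0.
  have -> : avg E (fun x => (w x)%:E) = avg E (fun x => 0%:E * (w x)%:E).
    apply: (ae_eq_avg alpha BE); first exact: mE_.
    - by apply: measurable_funeM; exact: mE_.
    - exact: u0.
    - by move=> z Ez; rewrite mul0e.
    - by apply: filterS w0 => z H /H ->; rewrite mul0e.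
  rewrite (avgZ mu alpha BE)//; [|exact: mE_|exact: u0].
  by rewrite mul0e mul0e lee_fin.
have fin_avg u D : is_weight mu u -> {ae mu, forall z, E z ->
    avg E (EFin \o u) <= (D * u z)%:E} -> exists2 a : R, (0 <= a)%R &
    avg E (EFin \o u) = a%:E.
  move=> wu H; have [z [Ez]] := ae_calB_ex n_gt0 mu_leb alpha_gt0 BE H.
  have := avg_ge0 mu alpha (u0 u wu).
  rewrite -/(EFin \o u); case: avg => [a a0 _|//|//].
  by exists a.
have [a1 a10 a1E] := fin_avg _ _ ww1 (H1 E BE).
have [a2 a20 a2E] := fin_avg _ _ ww2 (H2 E BE).
have [a1z|a1z] := eqVneq a1 0%R.
  apply: w0_case.
  have H : {ae mu, forall z, E z -> (w1 z)%:E = 0}.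
    apply: (avg0_ae n_gt0 mu_leb alpha_gt0 BE (mE_ _ ww1) (u0 _ ww1)).
    by move: a1E; rewrite a1z.
  apply: filterS2 wE H => z h1 h2 Ez.
  by rewrite h1 ?(h2 Ez) ?mul0e//; exact: Eb.
(* Now [w2 = 0] almost everywhere on [E] and its negative power is [+oo]. As [w] is real-valued, the
   factorization forces [w1 = 0] there, hence [w = 0]. *)
have [a2z|a2z] := eqVneq a2 0%R.
  apply: w0_case.
  have H : {ae mu, forall z, E z -> (w2 z)%:E = 0}.
    apply: (avg0_ae n_gt0 mu_leb alpha_gt0 BE (mE_ _ ww2) (u0 _ ww2)).
    by move: a2E; rewrite a2z.
  apply: filterS2 wE H => z h1 h2 Ez.
  have := h1 (Eb _ Ez); have [->] := h2 Ez.
  rewrite epow0 ?subr_lt0//.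
  have [->|w1z] := eqVneq (w1 z) 0%R; first by rewrite mul0e => ->.
  by rewrite gt0_muley// lte_fin lt_neqAle eq_sym w1z (weight_ge0 ww1 BE Ez).
have {}a10 : (0 < a1)%R by rewrite lt_neqAle eq_sym a1z.
have {}a20 : (0 < a2)%R by rewrite lt_neqAle eq_sym a2z.
(* Lower bounds for [w1] and [w2] on [E] supplied by [B_1]. They control the negative powers, and
   the averages [a1], [a2] cancel from the final product. *)
pose b2 := (a2 / D2)%R; pose b1 := (a1 / D1)%R.
have b20 : (0 < b2)%R by rewrite divr_gt0.
have b10 : (0 < b1)%R by rewrite divr_gt0.
have good : {ae mu, forall z, E z ->
    [/\ (b1 <= w1 z)%R, (b2 <= w2 z)%R & (w z = w1 z * w2 z `^ (1 - p))%R]}.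
  have h1 := H1 E BE; have h2 := H2 E BE.
  apply: filterS3 h1 h2 wE => z h1 h2 h3 Ez.
  have := h1 Ez; rewrite a1E lee_fin => l1.
  have := h2 Ez; rewrite a2E lee_fin => l2.
  have l1' : (b1 <= w1 z)%R by rewrite ler_pdivrMr// mulrC.
  have l2' : (b2 <= w2 z)%R by rewrite ler_pdivrMr// mulrC.
  split => //; have := h3 (Eb _ Ez); rewrite epow_gt0; last exact: lt_le_trans l2'.
  by rewrite -EFinM => -[].
have mep s u : is_weight mu u -> measurable_fun E (fun x => epow (u x) s).
  move=> wu; apply: (measurableT_comp (measurable_epow s)).
  exact: (weight_measurable wu BE).
have avg1 : avg E (fun x => (w x)%:E) <= (b2 `^ (1 - p) * a1)%:E.
  rewrite EFinM -a1E -(avgZ mu alpha BE) ?powR_ge0//;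
    [|exact: mE_|exact: u0].
  apply: (ae_le_avg alpha BE); first exact: mE_.
  - by apply: measurable_funeM; exact: mE_.
  - exact: u0.
  - by move=> z Ez; rewrite mule_ge0 ?u0// lee_fin powR_ge0.
  apply: filterS good => z H Ez; have [h1 h2 ->] := H Ez.
  rewrite -EFinM lee_fin mulrC ler_wpM2r ?(weight_ge0 ww1 BE)//.
  rewrite -(opprB p) !powRN lef_pV2 ?posrE ?powR_gt0//; last exact: lt_le_trans h2.
  by rewrite ge0_ler_powR ?nnegrE ?(ltW p10) ?(ltW b20)// (le_trans (ltW b20)).
have avg2 : avg E (fun x => epow (w x) (- (p - 1)^-1)) <= (b1 `^ (- r) * a2)%:E.
  rewrite EFinM -a2E -(avgZ mu alpha BE) ?powR_ge0//;
    [|exact: mE_|exact: u0].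
  apply: (ae_le_avg alpha BE); first exact: mep.
  - by apply: measurable_funeM; exact: mE_.
  - by move=> z _; exact: epow_ge0.
  - by move=> z Ez; rewrite mule_ge0 ?u0// lee_fin powR_ge0.
  apply: filterS good => z H Ez; have [h1 h2 wz] := H Ez.
  have w1z : (0 < w1 z)%R by exact: lt_le_trans h1.
  have w2z : (0 < w2 z)%R by exact: lt_le_trans h2.
  rewrite epow_gt0; last by rewrite wz mulr_gt0// powR_gt0.
  rewrite -EFinM lee_fin wz powRM ?powR_ge0 ?(ltW w1z)// -powRrM.
  have -> : ((1 - p) * - r = 1)%R by rewrite -(opprB p) mulrNN mulfV// gt_eqF.
  rewrite powRr1 ?(ltW w2z)// ler_wpM2r ?(ltW w2z)//.
  rewrite !powRN lef_pV2 ?posrE ?powR_gt0//.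
  by rewrite ge0_ler_powR ?nnegrE ?(ltW r0) ?(ltW b10) ?(ltW w1z).
have avg20 := avg_ge0 mu alpha
  (fun z (_ : E z) => epow_ge0 (w z) (- (p - 1)^-1)).
apply: (@le_trans _ _ ((b2 `^ (1 - p) * a1)%:E * (b1 `^ (- r) * a2)%:E `^ (p - 1))).
  apply: lee_pmul => //.
  - by apply: (avg_ge0 mu alpha); exact: u0.
  - exact: poweR_ge0.
  - exact: gee0_ler_poweR.
rewrite poweR_EFin -EFinM lee_fin powRM ?powR_ge0 ?(ltW a20)// -powRrM.
have -> : (- r * (p - 1) = -1)%R by rewrite mulNr mulVf// gt_eqF.
rewrite powR_inv1 ?(ltW b10)// /b1 /b2 powRM ?invr_ge0 ?(ltW a20) ?(ltW D20)//.
rewrite -(opprB p) !powRN.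
have -> : (D2^-1 `^ (p - 1) = (D2 `^ (p - 1))^-1)%R.
  by rewrite -(powR_inv1 (ltW D20)) powRAC powR_inv1 ?powR_ge0.
have h1 := powR_gt0 (p - 1) a20; have h2 := powR_gt0 (p - 1) D20.
by rewrite le_eqVlt; apply/orP; left; apply/eqP; field; rewrite !gt_eqF.
Qed.

End Factorization.

Lemma measurable_cnorm_le (R : realType) (n : nat) (rho : R) :
  measurable [set z : Cn R n | cnorm z <= rho].
Proof.
rewrite (_ : [set _ | _] = (@cnorm R n) @^-1` `]-oo, rho]%classic).
  by rewrite -[X in measurable X]setTI; exact: measurable_cnorm.
by apply/seteqP; split => z /=; rewrite in_itv.
Qed.

(** * From bounds on cells to membership in [B_1] *)

Section CellsToB1.
Context (R : realType) (n : nat).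
Hypothesis n_gt0 : (0 < n)%N.
Local Notation C := (Cn R n).
Context (mu : {measure set C -> \bar R}).
Hypothesis mu_leb : is_lebesgue_Cn mu.
Context (alpha : R).
Hypothesis alpha_gt0 : 0 < alpha.
Local Notation nu := (nu_alpha mu alpha).
Local Notation ball := (@unit_ball R n).
Local Notation avg := (avg_alpha mu alpha).
Local Notation cell k := (pcell (center R n_gt0 k) (radius R n_gt0 k)).

(** Lets a weighted integral control the unweighted one on compact subballs; the sign of [alpha - 1]
    decides which of the two constants serves. *)
Lemma dens_lower_bound (rho : R) : 0 <= rho < 1 ->
  exists2 c : R, 0 < c & forall z : C, cnorm z <= rho -> c <= dens alpha z.
Proof.
move=> /andP[rho0 rho1].
have q0 : 0 < 1 - rho ^+ 2 by rewrite subr_gt0 exprn_ilt1.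
exists (Num.min 1 ((1 - rho ^+ 2) `^ (alpha - 1))).
  by rewrite lt_min ltr01 powR_gt0.
move=> z zr; have z0 := cnorm_ge0 z.
have zq : 1 - rho ^+ 2 <= 1 - cnorm z ^+ 2.
  by rewrite lerD2l lerN2 lerXn2r ?nnegrE.
have q1 : 1 - cnorm z ^+ 2 <= 1 by rewrite gerBl sqr_ge0.
have x0 : 0 < 1 - cnorm z ^+ 2 by exact: lt_le_trans zq.
rewrite /dens ge_min; have [a1|a1] := leP 0 (alpha - 1).
  by apply/orP; right; rewrite ge0_ler_powR ?nnegrE ?(ltW q0) ?(ltW x0).
apply/orP; left; rewrite -(opprK (alpha - 1)) powRN -[leLHS]invr1.
rewrite lef_pV2 ?posrE ?powR_gt0//.
apply: (@le_trans _ _ (1 `^ (- (alpha - 1)))); last by rewrite powR1.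
by rewrite ge0_ler_powR ?nnegrE ?(ltW x0)// oppr_ge0 ltW.
Qed.

Local Open Scope ereal_scope.
Context (f : C -> R) (g : C -> \bar R) (D : R).
Hypothesis mf : measurable_fun setT f.
Hypothesis f0 : forall z, (0 <= f z)%R.
Hypothesis mg : measurable_fun setT g.
Hypothesis g0 : forall z, 0 <= g z.
Hypothesis D0 : (0 <= D)%R.
Hypothesis fg : {ae mu, forall z, ball z -> (f z)%:E = g z /\ (0 < f z)%R}.
Hypothesis g_cell : forall k x, cell k x ->
  \int[nu]_(y in cell k) g y <= D%:E * nu (cell k) * g x.

Let K := (1 + doubling_const n alpha)%R.
Let K0 : (0 < K)%R.
Proof. by rewrite addr_gt0// doubling_const_gt0. Qed.

(** Up to the origin [E] lies in a cell of comparable measure, and that cell also contains [z]. *)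
Lemma avg_le_cell E z : calB E -> E z -> cnorm z != 0%R ->
  avg E (EFin \o f) <= (K * D)%:E * g z.
Proof.
move=> BE Ez z0; have mE := calB_measurable BE; have Eb := calB_sub_ball BE.
have [nuE nE0] := calB_nu_fine n_gt0 mu_leb alpha_gt0 BE.
have mfE : measurable_fun E (EFin \o f).
  by apply/measurable_EFinP; exact: measurable_funTS.
have mgE : measurable_fun E g by exact: measurable_funTS.
have -> : avg E (EFin \o f) = avg E g.
  apply: (ae_eq_avg alpha BE) => //.
    by move=> y _; rewrite lee_fin.
  by apply: filterS fg => y H /Eb /H[].
rewrite (avg_alphaE _ _ BE)// /average.
have [k [Ek kE]] := calB_subset_rational n_gt0 mu_leb alpha_gt0 BE.
have kz : cell k z.
  by apply: Ek; split => // zE; rewrite zE cnorm0 eqxx in z0.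
rewrite lee_pdivrMl//.
have -> : \int[nu]_(x in E) g x = \int[nu]_(x in E `\` [set czero R n]) g x.
  apply: ge0_negligible_integral => //; first exact: measurable_set0C.
  exact: nu_alpha_czero.
apply: (@le_trans _ _ (\int[nu]_(x in cell k) g x)).
  apply: ge0_subset_integral => //.
  - by apply: measurableD => //; exact: measurable_set0C.
  - exact: measurable_pcell.
  - exact: measurable_funTS.
apply: (le_trans (g_cell kz)).
rewrite muleA; apply: lee_wpmul2r => //.
apply: (@le_trans _ _ (D%:E * (K%:E * nu E))).
  by apply: lee_wpmul2l; rewrite ?lee_fin.
by rewrite nuE -!EFinM lee_fin le_eqVlt; apply/orP; left; apply/eqP; ring.
Qed.

Let ae_good : {ae mu, forall z, ball z ->
  [/\ (f z)%:E = g z, (0 < f z)%R & cnorm z != 0%R]}.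
Proof.
have zn : {ae mu, forall z : C, cnorm z != 0%R}.
  exists [set czero R n]; split; [exact: measurable_set0C|exact: mu_czero|].
  by move=> z /= /negP; rewrite negbK => /eqP /cnorm_eq0.
by apply: filterS2 fg zn => z H zn zb; have [h1 h2] := H zb.
Qed.

Lemma cells_in_B1 : in_B1 mu alpha f.
Proof.
have KD0 : (0 <= K * D)%R by rewrite mulr_ge0// ltW.
rewrite /in_B1; apply: (@le_lt_trans _ _ (K * D)%:E); last exact: ltry.
apply/ess_supP; apply: filterS ae_good => z H.
case: ifPn => [|_]; last by rewrite lee_fin.
rewrite inE => zb; have [fz fz0 z0] := H zb.
rewrite epow_gt0// powR_inv1// muleC lee_pdivrMl//.
apply: ge_ereal_sup => _ [E [BE Ez] <-].
have -> : avg E (fun x => (`|f x|)%:E) = avg E (EFin \o f).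
  congr (avg E _); apply/funext => x.
  by rewrite /= ger0_norm.
by rewrite muleC fz; exact: avg_le_cell.
Qed.

(** The bound of [avg_le_cell] on the whole ball, at one point where [g] is finite, gives a finite
    weighted integral; the density is bounded below on each smaller ball. *)
Lemma cells_is_weight : is_weight mu f.
Proof.
split; first by move=> z _.
split; first exact: measurable_funTS.
move=> rho rho01; have [c c0 cd] := dens_lower_bound rho01.
have mrho := @measurable_cnorm_le R n rho.
have rho_ball : [set z : C | (cnorm z <= rho)%R] `<=` ball.
  by move=> z /= zr; case/andP: rho01 => _; exact: le_lt_trans.
have BB := @calB_ball R n.
apply/integrableP; split; first by apply/measurable_EFinP; exact: measurable_funTS.
have [z [zb [fz fz0 z0]]] := ae_calB_ex n_gt0 mu_leb alpha_gt0 BB ae_good.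
have avgB := avg_le_cell BB zb z0.
have [nuE nE0] := calB_nu_fine n_gt0 mu_leb alpha_gt0 BB.
have intB : int_alpha mu alpha ball (EFin \o f) < +oo.
  move: avgB; rewrite /avg_alpha mu_alphaE//; last exact: measurable_unit_ball.
  rewrite lee_pdivrMl// => /le_lt_trans; apply.
  by rewrite -fz -!EFinM ltry.
apply: (@le_lt_trans _ _ ((c^-1)%:E * int_alpha mu alpha ball (EFin \o f))); last first.
  apply: lte_mul_pinfty => //; first by rewrite lee_fin invr_ge0 ltW.
have mfd A : measurable_fun A (fun z => (f z)%:E * (dens alpha z)%:E).
  apply: emeasurable_funM; apply/measurable_EFinP; apply: measurable_funTS => //.
  exact: measurable_dens.
rewrite lee_pdivlMl// -ge0_integralZl//; last 2 first.
- by apply: measurableT_comp => //; apply/measurable_EFinP; exact: measurable_funTS.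
- by rewrite lee_fin ltW.
rewrite /int_alpha setIid.
apply: (@le_trans _ _ (\int[mu]_(z in [set z : C | (cnorm z <= rho)%R])
    ((f z)%:E * (dens alpha z)%:E))).
  apply: ge0_le_integral => //.
  - by move=> x _; rewrite mule_ge0// lee_fin ltW.
  - apply: measurable_funeM; apply: measurableT_comp => //.
    by apply/measurable_EFinP; exact: measurable_funTS.
  - move=> x xr; rewrite /= ger0_norm// -!EFinM lee_fin mulrC ler_wpM2l//.
    exact: cd.
apply: ge0_subset_integral => //; first exact: measurable_unit_ball.
by move=> x _; rewrite mule_ge0 ?lee_fin// powR_ge0.
Qed.

End CellsToB1.

(** * From [B_p] to a factorization *)

Section Forward.
Context (R : realType) (n : nat).
Hypothesis n_gt0 : (0 < n)%N.
Local Notation C := (Cn R n).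
Context (mu : {measure set C -> \bar R}).
Hypothesis mu_leb : is_lebesgue_Cn mu.
Context (alpha : R).
Hypothesis alpha_gt0 : 0 < alpha.
Context (p : R).
Hypothesis p_gt1 : 1 < p.
Local Notation nu := (nu_alpha mu alpha).
Local Notation ball := (@unit_ball R n).
Local Notation avg := (avg_alpha mu alpha).
Local Notation cell k := (pcell (center R n_gt0 k) (radius R n_gt0 k)).
Implicit Types (E : set C) (w : C -> R).
Local Open Scope ereal_scope.

Let p0 : (0 < p)%R. Proof. exact: lt_trans p_gt1. Qed.
Let p10 : (0 < p - 1)%R. Proof. by rewrite subr_gt0. Qed.

Lemma is_weight0 : is_weight mu (fun=> 0%R).
Proof.
split => //; split; first exact: measurable_cst.
move=> rho _; apply: eq_integrable (integrable0 _ _) => //.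
exact: measurable_cnorm_le.
Qed.

Lemma in_B1_0 : in_B1 mu alpha (fun=> 0%R).
Proof.
rewrite /in_B1; apply: (@le_lt_trans _ _ 0%:E); last exact: ltry.
apply/ess_supP; apply: nearW => z; case: ifPn => [_|_]; last by rewrite lee_fin.
apply: mule_le0_ge0; last exact: epow_ge0.
apply: ge_ereal_sup => _ [E [BE Ez] <-].
have mE := calB_measurable BE.
rewrite (_ : avg E _ = avg E (fun=> 0%:E * 0%:E)); last first.
  by congr (avg E _); apply/funext => y; rewrite normr0 mul0e.
rewrite (avgZ mu alpha BE)//.
by rewrite mul0e.
Qed.

Lemma one_weight : is_weight mu (fun=> 1%R) /\ in_B1 mu alpha (fun=> 1%R).
Proof.
have cst1 : {ae mu, forall z : C, ball z ->
    (1 : R)%:E = (1%E : \bar R) /\ (0 < (1 : R))%R}.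
  by apply: (aeW mu) => z _; split => //; exact: ltr01.
have cell1 k x : cell k x ->
    \int[nu]_(y in cell k) cst 1 y <= 1%:E * nu (cell k) * cst 1 x.
  by move=> _; rewrite integral_cst ?mule1//; exact: measurable_pcell.
split.
  by apply: (cells_is_weight mu_leb alpha_gt0 (g := cst 1) (D := 1%R) _ _ _ _ _ cst1 cell1) => //;
    exact: measurable_cst.
by apply: (cells_in_B1 mu_leb alpha_gt0 (g := cst 1) (D := 1%R) _ _ _ _ _ cst1 cell1) => //;
  exact: measurable_cst.
Qed.

Lemma avgE_nu E (f : C -> \bar R) : calB E -> measurable_fun E f ->
  (forall z, E z -> 0 <= f z) ->
  \int[nu]_(z in E) f z = (fine (nu E))%:E * avg E f.
Proof.
move=> BE mf f0; have [nuE n0] := calB_nu_fine n_gt0 mu_leb alpha_gt0 BE.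
rewrite (avg_alphaE _ _ BE)// /average muleA -EFinM mulfV ?mul1e//.
by rewrite gt_eqF.
Qed.

(** The density is positive in the ball, so null sets of the weighted measure inside the ball are
    null for [mu]. *)
Lemma ae_fin_of_integral (h : C -> \bar R) : measurable_fun setT h ->
  (forall z, 0 <= h z) -> \int[nu]_(z in ball) h z < +oo ->
  {ae mu, forall z, ball z -> h z < +oo}.
Proof.
move=> mh h0 hint.
have mb := @measurable_unit_ball R n.
have mhd : measurable_fun ball (fun z => h z * (ball_dens alpha z)%:E).
  apply: emeasurable_funM; first exact: measurable_funTS.
  by apply/measurable_EFinP; apply: measurable_funTS; exact: measurable_ball_dens.
have hd0 z : 0 <= h z * (ball_dens alpha z)%:E.
  by rewrite mule_ge0// lee_fin ball_dens_ge0.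
have : mu.-integrable ball (fun z => h z * (ball_dens alpha z)%:E).
  apply/integrableP; split => //.
  under eq_integral do rewrite gee0_abs//.
  by move: hint; rewrite integral_density//; exact: measurable_funTS.
move/integrable_ae => /(_ mb); apply: filterS => z H zb.
have := H zb; have := h0 z; case: (h z) => [x _ _|_|//]; first exact: ltry.
by rewrite gt0_mulye// lte_fin ball_dens_gt0.
Qed.

Theorem factor_in_Bp w : is_weight mu w -> in_Bp mu alpha p w ->
  exists w1 w2 : C -> R,
    [/\ is_weight mu w1, is_weight mu w2,
        in_B1 mu alpha w1, in_B1 mu alpha w2 &
        {ae mu, forall z, ball z -> (w z)%:E = (w1 z)%:E * epow (w2 z) (1 - p)}].
Proof.
move=> ww [C0 HC].
pose sg x := epow (w x) (- (p - 1)^-1).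
have BB := @calB_ball R n.
have mb := @measurable_unit_ball R n.
have w0 := weight_ge0 ww BB.
have mw E : calB E -> measurable_fun E w by exact: weight_measurable ww.
have mwE E : calB E -> measurable_fun E (fun z => (w z)%:E).
  by move=> BE; apply/measurable_EFinP; exact: mw.
have msg E : calB E -> measurable_fun E sg.
  by move=> BE; apply: (measurableT_comp (measurable_epow _)); exact: mw.
have sg0 z : 0 <= sg z by exact: epow_ge0.
have w0E E : calB E -> forall z, E z -> 0 <= (w z)%:E.
  by move=> BE z Ez; rewrite lee_fin w0//; exact: (calB_sub_ball BE).
have [a0|a0] := eqVneq (avg ball (fun z => (w z)%:E)) 0.
  have wae := avg0_ae n_gt0 mu_leb alpha_gt0 BB (mwE _ BB) (w0E _ BB) a0.
  have [W1 B1] := one_weight.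
  exists (fun=> 0%R), (fun=> 1%R).
  split; [exact: is_weight0|exact: W1|exact: in_B1_0|exact: B1|].
  by apply: filterS wae => z H zb; rewrite mul0e; exact: H.
have a_gt0 : 0 < avg ball (fun z => (w z)%:E).
  by rewrite lt0e a0/=; apply: (avg_ge0 mu alpha); exact: w0E.
have s_neg : (- (p - 1)^-1 < 0)%R by rewrite oppr_lt0 invr_gt0.
have sg_gt0 z : ball z -> 0 < sg z.
  move=> zb; have := w0 z zb; rewrite le_eqVlt => /predU1P[wz|wz].
    by rewrite /sg -wz epow0.
  by rewrite /sg epow_gt0// lte_fin powR_gt0.
have b_gt0 : 0 < avg ball sg.
  rewrite lt0e (avg_ge0 mu alpha) ?andbT//; apply/eqP => b0.
  have := avg0_ae n_gt0 mu_leb alpha_gt0 BB (msg _ BB) (fun z _ => sg0 z) b0.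
  move/(ae_calB_ex n_gt0 mu_leb alpha_gt0 BB) => [z [zb sgz]].
  by have := sg_gt0 z zb; rewrite sgz ltxx.
(* Both averages over the ball are positive, so if either were infinite the [B_p] product would be
   too. *)
have b_lty : avg ball sg < +oo.
  rewrite ltey; apply/eqP => by_; have := HC ball BB.
  by rewrite -/sg by_ poweRyr ?gt_eqF// gt0_muley.
have a_lty : avg ball (fun z => (w z)%:E) < +oo.
  rewrite ltey; apply/eqP => ay; have := HC ball BB.
  by rewrite ay gt0_mulye// poweR_gt0.
pose wb := w \_ ball.
have mwb : measurable_fun setT wb.
  exact: (measurable_restrictT w mb).1 (mw _ BB).
have wbE z : ball z -> wb z = w z by move=> zb; rewrite /wb patchE mem_set.
pose w' z := if (0 < wb z)%R then wb z else 1%R.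
have w'_gt0 z : (0 < w' z)%R by rewrite /w'; case: ifP.
have mw' : measurable_fun setT w'.
  apply: measurable_fun_ifT; [|exact: mwb|exact: measurable_cst].
  by apply: measurable_fun_ltr; [exact: measurable_cst|exact: mwb].
pose v z := (w' z `^ (- (p - 1)^-1))%R.
have v_gt0 z : (0 < v z)%R by exact: powR_gt0.
have mv : measurable_fun setT v.
  exact: (measurableT_comp (measurable_powR _)).
have w'v z : (w' z * v z `^ (p - 1) = 1)%R.
  rewrite /v -powRrM mulNr mulVf ?gt_eqF// powR_inv1 ?ltW//.
  by rewrite mulfV// gt_eqF.
have w_gt0 : {ae mu, forall z, ball z -> (0 < w z)%R}.
  pose sgb z := epow (wb z) (- (p - 1)^-1).
  have msgb : measurable_fun setT sgb.
    exact: (measurableT_comp (measurable_epow _)).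
  have : {ae mu, forall z, ball z -> sgb z < +oo}.
    apply: ae_fin_of_integral => //; first by move=> z; exact: epow_ge0.
    rewrite (eq_integral sg); last by move=> z /[!inE] zb; rewrite /sgb wbE.
    rewrite (avgE_nu BB (msg _ BB)) //; apply: lte_mul_pinfty => //.
  apply: filterS => z H zb; have := H zb.
  rewrite /sgb wbE//; have := w0 z zb; rewrite le_eqVlt => /predU1P[<-|//].
  by rewrite epow0.
have ww' : {ae mu, forall z, ball z -> w' z = w z}.
  by apply: filterS w_gt0 => z H zb; rewrite /w' wbE// H.
have sgv : {ae mu, forall z, ball z -> sg z = (v z)%:E}.
  apply: filterS2 w_gt0 ww' => z H1 H2 zb.
  by rewrite /sg epow_gt0 ?H1// /v H2.
have nu_avg (h : C -> R) (hb : C -> \bar R) E : calB E ->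
    measurable_fun setT h -> (forall z, (0 < h z)%R) ->
    measurable_fun E hb -> (forall z, E z -> 0 <= hb z) ->
    {ae mu, forall z, ball z -> hb z = (h z)%:E} ->
    \int[nu]_(z in E) (h z)%:E = (fine (nu E))%:E * avg E hb.
  move=> BE mh h0 mhb hb0 hE.
  have mhE : measurable_fun E (fun z => (h z)%:E).
    by apply/measurable_EFinP; exact: measurable_funTS.
  have h0' z : 0 <= (h z)%:E by rewrite lee_fin ltW.
  rewrite (avgE_nu BE)//; congr (_ * _); apply: (ae_eq_avg alpha BE) => //.
  by apply: filterS hE => z H /(calB_sub_ball BE) /H ->.
have total (h : C -> R) : measurable_fun setT h -> (forall z, (0 < h z)%R) ->
    \int[nu]_z (h z)%:E = \int[nu]_(z in ball) (h z)%:E.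
  move=> mh h0; rewrite (@ge0_negligible_integral _ _ _ nu setT (~` ball)).
  - by rewrite setTD setCK.
  - exact: measurableC.
  - by [].
  - exact/measurable_EFinP.
  - by move=> z _; rewrite lee_fin ltW.
  - exact: nu_alpha_outside.
have wE' : {ae mu, forall z, ball z -> (w z)%:E = (w' z)%:E}.
  by apply: filterS ww' => z H /H ->.
have w'int : \int[nu]_z (w' z)%:E < +oo.
  rewrite total//.
  rewrite (nu_avg _ _ _ BB mw' w'_gt0 (mwE _ BB) (w0E _ BB) wE').
  by apply: lte_mul_pinfty.
have vint : \int[nu]_z (v z)%:E < +oo.
  rewrite total//.
  rewrite (nu_avg _ _ _ BB mv v_gt0 (msg _ BB) (fun z _ => sg0 z) sgv).
  by apply: lte_mul_pinfty.
pose F k := cell k.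
(* [big k] contains the origin when the pseudo-ball does and so belongs to [calB], where [B_p] can
   be applied; [G k] differs from it by a null set at most. *)
pose big k := pball (center R n_gt0 k) (10 * radius R n_gt0 k).
pose G k := pcell (center R n_gt0 k) (10 * radius R n_gt0 k).
have adm k := decode_admissible R n_gt0 k.
have rad_gt0 k : (0 < radius R n_gt0 k)%R.
  by have /and3P[_ c1 cr] := adm k; apply: le_lt_trans cr; rewrite subr_ge0 ltW.
have B_big k : calB (big k).
  have /and3P[c0 c1 cr] := adm k.
  exists (center R n_gt0 k), (10 * radius R n_gt0 k)%R; split => //; split => //.
  by apply: lt_trans cr _; rewrite ltr_pMl// ltr1n.
have nuG k : nu (G k) = nu (big k) by exact: nu_pcell.
have mG k : measurable (G k) by exact: measurable_pcell.
have mF k : measurable (F k) by exact: measurable_pcell.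
have intG (h : C -> R) k : measurable_fun setT h -> (forall z, (0 < h z)%R) ->
    \int[nu]_(z in G k) (h z)%:E = \int[nu]_(z in big k) (h z)%:E.
  move=> mh h0; rewrite [RHS](@ge0_negligible_integral _ _ _ nu _ [set czero R n])//.
  - exact: measurable_set0C.
  - exact: calB_measurable.
  - by apply/measurable_EFinP; exact: measurable_funTS.
  - by move=> z _; rewrite lee_fin ltW.
  - exact: nu_alpha_czero.
pose A := Num.max 1%R C0.
have A_gt0 : (0 < A)%R by rewrite lt_max ltr01.
have int_lty (h : C -> R) E : measurable E -> measurable_fun setT h ->
    (forall z, (0 < h z)%R) ->
    \int[nu]_z (h z)%:E < +oo -> \int[nu]_(z in E) (h z)%:E < +oo.
  move=> mE mh h0; apply: le_lt_trans; apply: ge0_subset_integral => //.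
    exact/measurable_EFinP.
  by move=> z _; rewrite lee_fin ltW.
have ap k : (fine (\int[nu]_(x in G k) (w' x)%:E) *
    fine (\int[nu]_(x in G k) (v x)%:E) `^ (p - 1) <=
    A * fine (nu (G k)) `^ p)%R.
  have BE := B_big k; have mE := calB_measurable BE.
  have [nuE nE0] := calB_nu_fine n_gt0 mu_leb alpha_gt0 BE.
  have wl := int_lty w' (big k) mE mw' w'_gt0 w'int.
  have vl := int_lty v (big k) mE mv v_gt0 vint.
  rewrite (intG _ k mw' w'_gt0) (intG _ k mv v_gt0) nuG.
  move: wl vl (HC _ BE); rewrite -/sg.
  rewrite (nu_avg _ _ _ BE mw' w'_gt0 (mwE _ BE) (w0E _ BE) wE').
  rewrite (nu_avg _ _ _ BE mv v_gt0 (msg _ BE) (fun z _ => sg0 z) sgv).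
  move: nE0; set N := fine _ => N0.
  have := avg_ge0 mu alpha (w0E _ BE).
  have := avg_ge0 mu alpha (fun z (_ : big k z) => sg0 z).
  case: (avg _ sg) => [b b0| _|//]; last first.
    by move=> _ _; rewrite gt0_muley// lte_fin.
  case: (avg _ (fun z => (w z)%:E)) => [a a0'| _|//]; last first.
    by rewrite gt0_muley// lte_fin.
  rewrite !lee_fin in b0 a0'; move=> _ _.
  rewrite poweR_EFin -!EFinM lee_fin /= => ab.
  rewrite powRM ?(ltW N0)// -(mulr_powRB1 (ltW N0) p0).
  have -> : (N * a * (N `^ (p - 1) * b `^ (p - 1)) =
      a * b `^ (p - 1) * (N * N `^ (p - 1)))%R by ring.
  rewrite ler_wpM2r ?mulr_ge0 ?powR_ge0 ?(ltW N0)//.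
  by rewrite (le_trans ab)// /A le_max lexx orbT.
have engulf i j : F i `&` F j !=set0 ->
    (radius R n_gt0 i <= radius R n_gt0 j)%R -> F i `<=` G j.
  have /and3P[ci _ _] := adm i; have /and3P[cj _ _] := adm j.
  exact: pcell_engulf.
have nuF_gt0 k : 0 < nu (F k).
  by have /and3P[c0 c1 cr] := adm k; rewrite nu_pcell//; exact: nu_pball_gt0.
have nuG_lty k : nu (G k) < +oo by exact: nu_lty.
have nuGF k : nu (G k) <= (doubling_const n alpha)%:E * nu (F k).
  have /and3P[c0 c1 cr] := adm k.
  by rewrite !nu_pcell//; exact: nu_pball_doubling.
have [u [D [mu_ u1 D0 uint ucell]]] := muckenhoupt_supersolution mF mG engulf
  (doubling_const_gt0 n_gt0 alpha_gt0) nuF_gt0 nuG_lty nuGF p_gt1 A_gt0 mw' mv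
  w'_gt0 v_gt0 w'v w'int vint ap.
have u0 z : 0 <= u z by exact: le_trans (u1 z).
have mw'E : measurable_fun setT (fun z => (w' z)%:E) by apply/measurable_EFinP.
have ufin : {ae mu, forall z, ball z -> u z \is a fin_num}.
  have : {ae mu, forall z, ball z -> u z `^ p * (w' z)%:E < +oo}.
    apply: ae_fin_of_integral.
    - by apply: emeasurable_funM => //; exact: measurable_fun_poweR.
    - by move=> z; rewrite mule_ge0 ?poweR_ge0// lee_fin ltW.
    apply: le_lt_trans uint; apply: ge0_subset_integral => //.
      by apply: emeasurable_funM => //; exact: measurable_fun_poweR.
    by move=> z _; rewrite mule_ge0 ?poweR_ge0// lee_fin ltW.
  apply: filterS => z H zb; have := H zb; have := u0 z.
  case: (u z) => [//|_|//]; rewrite poweRyr ?gt_eqF// gt0_mulye//.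
  by rewrite lte_fin.
(* [u] is finite almost everywhere in the ball, because [u^p w'] is integrable and [w'] is
   positive. *)
pose w2 z := fine (u z).
have mw2 : measurable_fun setT w2.
  by apply: (measurableT_comp (fine_measurable measurableT)).
have w20 z : (0 <= w2 z)%R by exact: fine_ge0.
have w2u : {ae mu, forall z, ball z -> (w2 z)%:E = u z /\ (0 < w2 z)%R}.
  apply: filterS ufin => z H zb; have uf := H zb.
  have uE : (w2 z)%:E = u z by rewrite /w2 fineK.
  by split => //; rewrite -lte_fin uE; apply: lt_le_trans (u1 z).
pose w1 z := (w' z * w2 z `^ (p - 1))%R.
have mw1 : measurable_fun setT w1.
  apply: measurable_funM => //.
  exact: (measurableT_comp (measurable_powR _)).
have w10 z : (0 <= w1 z)%R by rewrite mulr_ge0 ?powR_ge0// ltW.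
pose g1 z := (w' z)%:E * u z `^ (p - 1).
have mg1 : measurable_fun setT g1.
  by apply: emeasurable_funM => //; exact: measurable_fun_poweR.
have g10 z : 0 <= g1 z by rewrite mule_ge0 ?poweR_ge0// lee_fin ltW.
have w1g : {ae mu, forall z, ball z -> (w1 z)%:E = g1 z /\ (0 < w1 z)%R}.
  apply: filterS w2u => z H zb; have [h1 h2] := H zb.
  split; last by rewrite mulr_gt0// powR_gt0.
  by rewrite /g1 -h1 poweR_EFin -EFinM.
have cell2 k x : cell k x -> \int[nu]_(y in cell k) u y <= D%:E * nu (cell k) * u x.
  by move=> kx; case: (ucell k x kx).
have cell1 k x : cell k x -> \int[nu]_(y in cell k) g1 y <= D%:E * nu (cell k) * g1 x.
  by move=> kx; case: (ucell k x kx).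
exists w1, w2; split.
- exact: (cells_is_weight mu_leb alpha_gt0 mw1 w10 mg1 g10 D0 w1g cell1).
- exact: (cells_is_weight mu_leb alpha_gt0 mw2 w20 mu_ u0 D0 w2u cell2).
- exact: (cells_in_B1 mu_leb alpha_gt0 mw1 w10 mg1 g10 D0 w1g cell1).
- exact: (cells_in_B1 mu_leb alpha_gt0 mw2 w20 mu_ u0 D0 w2u cell2).
(* The exponents [p - 1] and [1 - p] of [w2] cancel, which leaves [w' = w]. *)
apply: filterS2 ww' w2u => z H1 H2 zb; have [_ w2z] := H2 zb.
rewrite epow_gt0// -EFinM /w1 -(H1 zb) -mulrA -powRD.
  by rewrite -(opprB p 1%R) subrr powRr0 mulr1.
by rewrite (gt_eqF w2z) implybT.
Qed.

End Forward.

Unset Implicit Arguments.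

Theorem mainTheorem19 (R : realType) (n : nat) (n_gt0 : (0 < n)%N)
    (mu : {measure set (Cn R n) -> \bar R}) (mu_leb : is_lebesgue_Cn mu)
    (alpha : R) (alpha_gt0 : 0 < alpha)
    (p : R) (p_gt1 : 1 < p)
    (w : Cn R n -> R) (w_weight : is_weight mu w) :
  in_Bp mu alpha p w <->
  exists w1 w2 : Cn R n -> R,
    [/\ is_weight mu w1, is_weight mu w2,
        in_B1 mu alpha w1, in_B1 mu alpha w2 &
        {ae mu, forall z, unit_ball z ->
           ((w z)%:E = (w1 z)%:E * epow (w2 z) (1 - p))%E}].
Proof.
split; first exact: (factor_in_Bp n_gt0 mu_leb alpha_gt0 p_gt1 w_weight).
by move=> [w1 [w2 [ww1 ww2 B1 B2 wE]]];
  exact: (in_Bp_of_B1 n_gt0 mu_leb alpha_gt0 p_gt1 w_weight ww1 ww2 B1 B2 wE).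
Qed.
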